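(* A graph $\Gamma$ is a Deza circulant graph with $\mathrm{rk}_{\mathrm{WL}}(\Gamma)=4$ if and only if $\Gamma$ is isomorphic to one of the following graphs: (1) $\overline{K_4\times K_m}$, where $m>1$ is odd; (2) $K_2\times K_m$, where $m>1$ is odd; (3) $m\mathcal{C}_5$, where $m>1$; (4) $lK_{m,m}$, where $l,m>1$; (5) $K_l[mK_2]$, where $l,m>1$; (6) $\mathrm{Paley}(p)[K_2]$, where $p$ is a prime with $p\equiv 1 \pmod 4$; (7) $\mathrm{GPaley}(p,\frac{p-1}{3})$, where $p$ is a prime of the form $p=t^2+3$ for some integer $t$; (8) $\overline{\mathrm{GPaley}(p,\frac{p-1}{3})}$, where $p$ is a prime of the form $p=t^2+12$ for some integer $t$.
   Context: A coherent configuration on a finite set $V$ is a partition $\mathcal{R}$ of $V\times V$ such that the diagonal $\{(v,v):v\in V\}$ is a union of classes, $r\in\mathcal{R}$ implies $r^*=\{(\beta,\alpha):(\alpha,\beta)\in r\}\in\mathcal{R}$, and for all $r,s,t\in\mathcal{R}$ the number $|\{\gamma:(\alpha,\gamma)\in r,(\gamma,\beta)\in s\}|$ does not depend on the choice of $(\alpha,\beta)\in t$. For a (di)graph $\Gamma=(V,E)$, the WL-closure of $\Gamma$ is the coarsest coherent configuration on $V$ such that $E$ is a union of its classes, and the WL-rank $\mathrm{rk}_{\mathrm{WL}}(\Gamma)$ is its number of classes. A $k$-regular graph with $n$ vertices is a Deza graph if there are nonnegative integers $a,b$ such that every pair of distinct vertices has either $a$ or $b$ common neighbours. A circulant graph is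 a Cayley graph $\mathrm{Cay}(G,S)$ over a finite cyclic group $G$, i.e. $S\subseteq G$, $e\notin S$, $S=S^{-1}$, vertex set $G$ and $g$ adjacent to $sg$ for $s\in S$. $K_n$ is the complete graph, $\mathcal{C}_n$ the cycle on $n$ vertices, $K_{l,m}$ the complete bipartite graph, $\overline{\Gamma}$ the complement, $m\Gamma$ the disjoint union of $m$ copies of $\Gamma$. The tensor product $\Gamma_1\times\Gamma_2$ has vertex set $V_1\times V_2$ with $(v_1,v_2)\sim(u_1,u_2)$ iff $v_1\sim u_1$ and $v_2\sim u_2$. The lexicographic product $\Gamma_1[\Gamma_2]$ has vertex set $V_1\times V_2$ with $(v_1,v_2)\sim(u_1,u_2)$ iff $v_1\sim u_1$ in $\Gamma_1$, or $v_1=u_1$ and $v_2\sim u_2$ in $\Gamma_2$. For a prime $p$ and a divisor $k$ of $p-1$ with $\frac{p-1}{k}$ even, $\mathrm{GPaley}(p,\frac{p-1}{k})$ is the graph on $\mathbb{Z}_p$ with $x\sim y$ iff $x-y$ lies in the subgroup of index $k$ of the multiplicative group $\mathbb{Z}_p^*$; $\mathrm{Paley}(p)=\mathrm{GPaley}(p,\frac{p-1}{2})$. *)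

(* Defs.v *)
From mathcomp Require Import all_boot.
Set Implicit Arguments. Unset Strict Implicit. Unset Printing Implicit Defensive.

Definition simple_graph (T : finType) (e : rel T) : Prop :=
  symmetric e /\ irreflexive e.

Definition graph_iso (T1 T2 : finType) (e1 : rel T1) (e2 : rel T2) : Prop :=
  exists f : T1 -> T2, bijective f /\ forall x y, e2 (f x) (f y) = e1 x y.

Definition common_nbrs (T : finType) (e : rel T) (x y : T) : nat :=
  #|[set z | e x z && e y z]|.

Definition is_Deza (T : finType) (e : rel T) : Prop :=
  (exists k, forall x, #|[set y | e x y]| = k) /\
  (exists a b, forall x y, x != y ->
      common_nbrs e x y = a \/ common_nbrs e x y = b).

Definition cay_circ (n : nat) (S : {set 'I_n}) : rel 'I_n :=
  fun i j => [exists s in S, val j == (val s + val i) %% n].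

Definition is_circulant (T : finType) (e : rel T) : Prop :=
  exists n (S : {set 'I_n}),
    [/\ 0 < n,
        (forall s, s \in S -> val s != 0),
        (forall s, s \in S -> exists2 s', s' \in S & val s' = (n - val s) %% n)
      & graph_iso e (cay_circ S)].

Definition diag_set (T : finType) : {set T * T} := [set p | p.1 == p.2].
Definition edge_set (T : finType) (e : rel T) : {set T * T} := [set p | e p.1 p.2].
Definition transp_set (T : finType) (r : {set T * T}) : {set T * T} :=
  [set p | (p.2, p.1) \in r].

Definition union_of_classes (T : finType) (P : {set {set T * T}}) (E : {set T * T}) :=
  forall r, r \in P -> (r \subset E) || [disjoint r & E].

Definition coherent_config (T : finType) (P : {set {set T * T}}) : Prop :=
  [/\ partition P [set: T * T],
      union_of_classes P (diag_set T),
      (forall r, r \in P -> transp_set r \in P)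
    & forall r s t, r \in P -> s \in P -> t \in P ->
        forall a b a' b', (a, b) \in t -> (a', b') \in t ->
          #|[set g | ((a, g) \in r) && ((g, b) \in s)]|
          = #|[set g | ((a', g) \in r) && ((g, b') \in s)]| ].

Definition refines (T : finType) (Q P : {set {set T * T}}) : Prop :=
  forall q, q \in Q -> exists2 p, p \in P & q \subset p.

Definition WL_closure (T : finType) (e : rel T) (P : {set {set T * T}}) : Prop :=
  [/\ coherent_config P, union_of_classes P (edge_set e)
    & forall Q, coherent_config Q -> union_of_classes Q (edge_set e) -> refines Q P].

Definition WL_rank_is (T : finType) (e : rel T) (k : nat) : Prop :=
  exists P, WL_closure e P /\ #|P| = k.

Definition complete (n : nat) : rel 'I_n := fun i j => i != j.

Definition cycle_graph (n : nat) : rel 'I_n :=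
  fun i j => (val j == (val i + 1) %% n) || (val i == (val j + 1) %% n).

Definition complete_bip (l m : nat) : rel ('I_l + 'I_m)%type :=
  fun x y => match x, y with
             | inl _, inr _ | inr _, inl _ => true
             | _, _ => false end.

Definition gcompl (T : finType) (e : rel T) : rel T := fun x y => (x != y) && ~~ e x y.

Definition mcopies (m : nat) (T : finType) (e : rel T) : rel ('I_m * T) :=
  fun x y => (x.1 == y.1) && e x.2 y.2.

Definition tensor (T1 T2 : finType) (e1 : rel T1) (e2 : rel T2) : rel (T1 * T2) :=
  fun x y => e1 x.1 y.1 && e2 x.2 y.2.

Definition lexprod (T1 T2 : finType) (e1 : rel T1) (e2 : rel T2) : rel (T1 * T2) :=
  fun x y => e1 x.1 y.1 || ((x.1 == y.1) && e2 x.2 y.2).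

(* GPaley(p, d): x ~ y iff x - y lies in the subgroup of index k = (p-1)/d of
   Z_p^*, i.e. (Z_p^* being cyclic) x - y is a nonzero k-th power mod p. *)
Definition gpaley (p d : nat) : rel 'I_p :=
  fun x y => (x != y) &&
    [exists z : 'I_p, (val z ^ ((p.-1) %/ d)) %% p == (val x + p - val y) %% p].

Arguments complete n : clear implicits.
Arguments cycle_graph n : clear implicits.
Arguments complete_bip l m : clear implicits.
Arguments mcopies m [T] e.
Arguments gpaley p d : clear implicits.

Definition paley (p : nat) : rel 'I_p := gpaley p ((p.-1) %/ 2).
Arguments paley p : clear implicits.

(* Main.v *)
(* Let the graph be Cay(Z_n, S).  Its WL-closure is invariant under translations, so it is
   given by an S-ring over Z_n, whose colours are symmetric because merging each colour with
   its negative gives an S-ring again; rank 4 means three colours apart from {0}.  If no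
   proper nontrivial subgroup is a union of colours, the counting argument of
   Schur and Wielandt makes n prime, and Schur's theorem on multipliers makes the colours
   the cubic residue classes.  Otherwise the S-ring is a tensor product of two trivial
   ones, the chain of two subgroups, or a wreath product of a trivial S-ring with that of
   the quadratic residues, in one of the two orders.  The common neighbour counts are the
   coefficients of the square of S in the group ring Z[Z_n]; being Deza means that two of
   the three coincide, which fixes the parameters.  In the prime case the cyclotomic
   numbers of order 3 give 4 p = L^2 + 27 M^2, and the coincidence is p = t^2 + 3 or
   p = t^2 + 12, the converse by uniqueness of that representation.  Each family has an
   S-ring of rank 4 on which membership in S and the number of common neighbours separate
   the colours, so that the closure cannot be coarser. *)

(* The hard case of the classification is a single proper colour subgroup H with two colours outside
   it: the quotient by H is an S-ring only once these colours are known to be unions of cosets of H.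
   The cyclic group enters through Schur's power argument, which gives invariance under a subgroup
   of prime order for those elements whose multiple by that prime leaves H. A double count of the
   differences lying in H then makes the index of H a prime p and n a power of p, and there the
   multipliers 1 + v with v in H give the contradiction.

   Rank exactly 4 is used as minimality. S is one of eight unions of the three nonzero colours, and
   whenever membership in S depends on one subgroup only, a smaller S-ring already contains S. For
   the surviving sets the three counts are explicit, and each coincidence is an equation between the
   orders of the subgroups.

   Quadratic and cubic classes carry an arbitrary residue r, because the colours do not tell which
   class is the group of powers. Multiplication by a power of the generator moves class r back to
   the group only when the graph is built. *)
From HB Require Import structures.
From mathcomp Require Import all_boot all_order all_algebra cyclic finfield.
From mathcomp Require Import ring lra zify.
Require Import Defs.
Set Implicit Arguments. Unset Strict Implicit. Unset Printing Implicit Defensive.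
Import Order.TTheory GRing.Theory Num.Theory.
Local Open Scope ring_scope.
(** * Group rings *)

(* Functions under pointwise addition and convolution: the group ring K[G]. *)
Definition galg (K : comNzRingType) (G : finZmodType) : Type := {ffun G -> K}.

Section GroupAlgebra.
Variables (K : comNzRingType) (G : finZmodType).

HB.instance Definition _ := GRing.Zmodule.on (galg K G).

Definition galg_one : galg K G := [ffun x => (x == 0)%:R].
Definition galg_mul (f g : galg K G) : galg K G :=
  [ffun x => \sum_z f z * g (x - z)].

Fact galg_mulC : commutative galg_mul.
Proof.
move=> f g; apply/ffunP=> x; rewrite !ffunE.
rewrite (reindex (fun z => x - z)) /=; last first.
  by exists (fun z => x - z) => z _; rewrite opprB addrC subrK.
by apply: eq_bigr => z _; rewrite opprB [_ + (z - x)]addrC subrK mulrC.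
Qed.

Fact galg_mulA : associative galg_mul.
Proof.
move=> f g h; apply/ffunP=> x; rewrite !ffunE.
under eq_bigr => z _ do rewrite ffunE mulr_sumr.
under [RHS]eq_bigr => z _ do rewrite ffunE mulr_suml.
rewrite [RHS]exchange_big /=; apply: eq_bigr => z _.
rewrite [RHS](reindex (fun y => y + z)) /=; last first.
  by exists (fun y => y - z) => y _; rewrite ?addrK ?subrK.
by apply: eq_bigr => y _; rewrite addrK mulrA opprD addrA addrAC.
Qed.

Fact galg_mul1 : left_id galg_one galg_mul.
Proof.
move=> f; apply/ffunP=> x; rewrite !ffunE (bigD1 0) //= !ffunE eqxx mul1r subr0.
by rewrite big1 ?addr0 // => z /negPf z0; rewrite ffunE z0 mul0r.
Qed.

Fact galg_mulDl : left_distributive galg_mul +%R.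
Proof.
move=> f g h; apply/ffunP=> x; rewrite !ffunE -big_split /=.
by apply: eq_bigr => z _; rewrite ffunE mulrDl.
Qed.

Fact galg_one_neq0 : galg_one != 0.
Proof.
by apply/eqP=> /ffunP/(_ 0); rewrite !ffunE eqxx => /eqP; rewrite oner_eq0.
Qed.

HB.instance Definition _ := GRing.Zmodule_isComNzRing.Build (galg K G)
  galg_mulA galg_mulC galg_mul1 galg_mulDl galg_one_neq0.

End GroupAlgebra.

Section Indicators.
Variables (K : comNzRingType) (G : finZmodType).
Implicit Types (f g : galg K G) (A B : {set G}).

Definition ind A : galg K G := [ffun x => (x \in A)%:R].

Lemma galgM f g x : (f * g) x = \sum_z f z * g (x - z).
Proof. by rewrite [LHS]ffunE. Qed.
Lemma galgD f g x : (f + g) x = f x + g x. Proof. exact: ffunE. Qed.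
Lemma galgN f x : (- f) x = - f x. Proof. exact: ffunE. Qed.
Lemma galg1 x : (1 : galg K G) x = (x == 0)%:R. Proof. exact: ffunE. Qed.
Lemma galg0 x : (0 : galg K G) x = 0. Proof. exact: ffunE. Qed.
Lemma galgMn f m x : (f *+ m) x = f x *+ m.
Proof. by elim: m => [|m IH]; rewrite ?mulr0n ?galg0 // !mulrS galgD IH. Qed.
Lemma galgMz f (m : int) x : (f *~ m) x = f x *~ m.
Proof.
by case: m => m; rewrite ?NegzE ?mulrNz ?galgN -!pmulrn galgMn.
Qed.
Lemma galg_sum I (r : seq I) (P : pred I) (F : I -> galg K G) x :
  (\sum_(i <- r | P i) F i) x = \sum_(i <- r | P i) F i x.
Proof. by elim/big_rec2: _ => [|i y f _ <-]; rewrite ?galg0 ?galgD. Qed.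

Lemma indE A x : ind A x = (x \in A)%:R. Proof. exact: ffunE. Qed.

Lemma indM A B x : (ind A * ind B) x = #|[set z in A | x - z \in B]|%:R.
Proof.
rewrite galgM -sum1_card natr_sum [RHS]big_mkcond /=; apply: eq_bigr => z _.
by rewrite !indE inE; do 2 case: (_ \in _); rewrite ?mul1r ?mul0r.
Qed.

Lemma ind_sum A : ind A = \sum_(x in A) ind [set x].
Proof.
apply/ffunP=> y; rewrite galg_sum indE.
case yA: (y \in A); last first.
  rewrite big1 // => x xA; rewrite indE inE; case: eqP => // yx.
  by rewrite -yx yA in xA.
rewrite (bigD1 y) //= indE inE eqxx big1 ?addr0 // => x /andP[_ /negPf xy].
by rewrite indE inE eq_sym xy.
Qed.

Lemma ind1X (x : G) k : ind [set x] ^+ k = ind [set x *+ k].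
Proof.
elim: k => [|k IH].
  by apply/ffunP=> y; rewrite expr0 mulr0n galg1 indE inE.
rewrite exprS IH; apply/ffunP=> y; rewrite galgM (bigD1 x) //= !indE !inE eqxx mul1r.
rewrite big1 ?addr0; last by move=> z /negPf zx; rewrite indE inE zx mul0r.
by rewrite subr_eq addrC -mulrS.
Qed.

(** In characteristic [p] the Frobenius map of the group ring is additive, so the power passes to
    the singletons of [A], and that of the point [z] is the point [z *+ p]. *)
Lemma ind_pow_char A p : p \in [pchar K] ->
  forall x, (ind A ^+ p) x = #|[set z in A | z *+ p == x]|%:R.
Proof.
move=> pK; have pG : p \in [pchar (galg K G)].
  rewrite inE (pcharf_prime pK) /=; apply/eqP/ffunP=> x.
  by rewrite galgMn galg1 galg0 (mulrn_pchar pK).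
move=> x; rewrite -(pFrobenius_autE pG) ind_sum rmorph_sum galg_sum.
rewrite -sum1_card natr_sum big_mkcond [RHS]big_mkcond /=; apply: eq_bigr => z _.
rewrite inE; case: (z \in A) => //=.
by rewrite pFrobenius_autE ind1X indE inE eq_sym; case: eqP.
Qed.

End Indicators.
Arguments ind {K G} A.

(** * Schur rings over cyclic groups *)

Section Multiples.
Variables (n : nat) (n_gt1 : (1 < n)%N).
Local Notation R := 'Z_n.
Implicit Types (x y : R) (H M : {set R}) (m k : nat).

Lemma n_gt0 : (0 < n)%N. Proof. exact: ltnW. Qed.
Lemma Zn_card : #|R| = n. Proof. by rewrite card_ord Zp_cast. Qed.
Lemma Zn_lt x : (x < n)%N.
Proof. by have := ltn_ord x; rewrite [X in (_ < X)%N -> _]Zp_cast. Qed.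
Lemma Zn_natE x : x = (x : nat)%:R. Proof. by rewrite natr_Zp. Qed.
Lemma Zn_val k : (k%:R : R) = (k %% n)%N :> nat. Proof. exact: val_Zp_nat. Qed.
Lemma Zn_eq0 k : ((k%:R : R) == 0) = (n %| k)%N.
Proof. by rewrite -val_eqE /= Zn_val. Qed.
Lemma Zn_eq k l : ((k%:R : R) == l%:R) = (k == l %[mod n]).
Proof. by rewrite -val_eqE /= !Zn_val. Qed.

Definition multiples m : {set R} := [set x : R | (m %| x)%N].

Lemma mem_multiples m k : (m %| n)%N -> ((k%:R : R) \in multiples m) = (m %| k)%N.
Proof. by move=> mn; rewrite inE Zn_val /dvdn modn_dvdm. Qed.

Definition is_subgroup H := 0 \in H /\ forall x y, x \in H -> y \in H -> x - y \in H.

Lemma subgN H x : is_subgroup H -> (- x \in H) = (x \in H).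
Proof.
case=> H0 HB; apply/idP/idP => xH; last by rewrite -[- x]sub0r HB.
by rewrite -[x]opprK -[- - x]sub0r HB.
Qed.

Lemma subgD H x y : is_subgroup H -> x \in H -> (x + y \in H) = (y \in H).
Proof.
move=> sH xH; case: (sH) => H0 HB; apply/idP/idP => yH.
  by rewrite -[y](addKr x) addrC HB.
by rewrite addrC -[x]opprK HB // subgN.
Qed.

Lemma subgDr H x y : is_subgroup H -> x \in H -> (y + x \in H) = (y \in H).
Proof. by rewrite addrC; apply: subgD. Qed.

Lemma subgMn H x k : is_subgroup H -> x \in H -> x *+ k \in H.
Proof.
move=> sH xH; elim: k => [|k IH]; first by case: sH.
by rewrite mulrS subgD.
Qed.

Lemma subg_mul H x y : is_subgroup H -> x \in H -> x * y \in H.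
Proof. by move=> sH xH; rewrite [y]Zn_natE mulr_natr subgMn. Qed.

(** The group is finite, so [- y] is already a multiple of [y], namely [y *+ n.-1]. *)
Lemma subg_closed H : 0 \in H -> (forall x y, x \in H -> y \in H -> x + y \in H) ->
  is_subgroup H.
Proof.
move=> H0 HD; split=> // x y xH yH; apply: (HD) => //.
have -> : - y = y *+ n.-1.
  apply/eqP; rewrite eq_sym -addr_eq0 -mulrSr prednK ?n_gt0 //.
  by rewrite -mulr_natr; apply/eqP; rewrite (eqP (_ : n%:R == 0)) ?mulr0 ?Zn_eq0.
by elim: n.-1 => // k IH; rewrite mulrS HD.
Qed.

Lemma multiples_subg m : (m %| n)%N -> is_subgroup (multiples m).
Proof.
move=> mn; apply: subg_closed; first by rewrite inE dvdn0.
move=> x y; rewrite [x]Zn_natE [y]Zn_natE -natrD !mem_multiples // => mx my.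
exact: dvdn_add.
Qed.

Lemma subg_multiples H : is_subgroup H -> exists2 m, (m %| n)%N & H = multiples m.
Proof.
move=> sH; have ex : exists m, (0 < m)%N && (m%:R \in H).
  exists n; rewrite n_gt0 (eqP (_ : n%:R == 0 :> R)) ?Zn_eq0 //.
  by case: sH.
case: (ex_minnP ex) => m /andP[m0 mH] mmin.
have key k : (k%:R \in H) = (m %| k)%N.
  apply/idP/idP => [kH|/dvdnP[q ->]]; last first.
    by rewrite mulnC natrM mulr_natr subgMn.
  have rH : (k %% m)%:R \in H.
    move: kH; rewrite {1}(divn_eq k m) natrD subgD // mulnC natrM mulr_natr.
    exact: subgMn.
  rewrite /dvdn; case: posnP => // r0.
  have := mmin (k %% m)%N; rewrite r0 rH => /(_ isT).
  by rewrite leqNgt ltn_mod m0.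
have mn : (m %| n)%N.
  by rewrite -key (eqP (_ : n%:R == 0 :> R)) ?Zn_eq0 //; case: sH.
by exists m => //; apply/setP=> x; rewrite [x]Zn_natE mem_multiples.
Qed.

Lemma card_multiples m : (m %| n)%N -> (#|multiples m| = n %/ m)%N.
Proof.
move=> mn; have m0 : (0 < m)%N by apply: dvdn_gt0 mn; exact: n_gt0.
pose f (i : 'I_(n %/ m)) : R := (m * i)%:R.
have lt (i : 'I_(n %/ m)) : (m * i < n)%N.
  by rewrite -[X in (_ < X)%N](divnK mn) [(m * _)%N]mulnC ltn_pmul2r.
have fi : injective f.
  move=> i j /eqP; rewrite Zn_eq !modn_small // eqn_pmul2l // => /eqP; exact: val_inj.
rewrite -[RHS]card_ord -(card_imset _ fi); apply: eq_card => x.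
apply/idP/imsetP => [|[i _ ->]]; last by rewrite mem_multiples // dvdn_mulr.
rewrite inE => mx; have xl : (x %/ m < n %/ m)%N by rewrite ltn_divRL // divnK ?Zn_lt.
by exists (Ordinal xl) => //; rewrite /f /= mulnC divnK // -Zn_natE.
Qed.

Lemma multiples1 : multiples 1 = setT.
Proof. by apply/setP=> x; rewrite !inE dvd1n. Qed.
Lemma multiplesn : multiples n = [set 0].
Proof. by apply/setP=> x; rewrite !inE -Zn_eq0 -Zn_natE. Qed.

Lemma multiples_sub k m : (k %| n)%N -> (m %| n)%N ->
  (multiples m \subset multiples k) = (k %| m)%N.
Proof.
move=> kn mn; apply/subsetP/idP => [/(_ m%:R)|km x].
  by rewrite !mem_multiples // => ->.
by rewrite !inE; apply: dvdn_trans.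
Qed.

Lemma natr_coprime_unit k : coprime k n -> exists v : R, v * k%:R = 1.
Proof.
move=> kn; exists (k%:R^-1); apply: mulVr.
by rewrite unitZpE // coprime_sym.
Qed.

End Multiples.
Arguments multiples : clear implicits.

Section SchurRings.
Variables (n : nat) (n_gt1 : (1 < n)%N) (C : eqType).
Local Notation R := 'Z_n.
Implicit Types (x y : R) (X Y H M : {set R}) (m k : nat).
Implicit Types (c : R -> C).

(* A partition of Z_n is the set of fibres of a colouring c; it is an S-ring if the
   functions that are constant on colours are closed under negation and convolution. *)
Definition cconst c (V : Type) (f : R -> V) := forall x y, c x = c y -> f x = f y.
Definition cset c X := cconst c (fun x => x \in X).
Definition cclass c x := [set y | c y == c x].

Definition Sring c := [/\ cset c [set 0], cconst c (fun x => c (- x))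
  & forall f g : galg int R, cconst c f -> cconst c g -> cconst c (f * g : galg int R)].

Variables (c : R -> C) (Sc : Sring c).

Lemma cclass_cset x : cset c (cclass c x).
Proof. by move=> y z yz; rewrite !inE yz. Qed.

Lemma cclass_id x : x \in cclass c x.
Proof. by rewrite inE. Qed.

Lemma cset_ind K X : cset c X -> cconst c (ind X : galg K R).
Proof. by move=> cX x y xy; rewrite !indE (cX x y). Qed.

Lemma csetN X : cset c X -> cset c [set x | - x \in X].
Proof. by case: Sc => _ cN _ cX x y xy; rewrite !inE; apply/cX/cN. Qed.

Lemma cset_count X Y : cset c X -> cset c Y ->
  cconst c (fun x => #|[set z in X | x - z \in Y]|).
Proof.
case: Sc => _ _ cM cX cY x y xy; have := cM _ _ (cset_ind int cX) (cset_ind int cY) x y xy.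
by rewrite !indM => /eqP; rewrite eqr_nat => /eqP.
Qed.

Lemma cset_lambda X : cset c X -> cconst c (fun x => #|[set z in X | z - x \in X]|).
Proof.
move=> cX x y xy; have := cset_count cX (csetN cX) xy.
have E u : [set z in X | u - z \in [set t | - t \in X]] = [set z in X | z - u \in X].
  by apply/setP=> z; rewrite !inE opprB.
by rewrite !E.
Qed.

(** Coefficients are lifted to their representatives in [int], where [Sc] applies; reduction back to
    ['F_p] commutes with convolution. *)
Lemma cconst_Fp p (f g : galg 'F_p R) :
  cconst c f -> cconst c g -> cconst c (f * g : galg _ R).
Proof.
move=> cf cg; pose lift (h : galg 'F_p R) : galg int R := [ffun x => (h x : nat)%:Z].
have cl (h : galg 'F_p R) : cconst c h -> cconst c (lift h) by move=> ch x y /ch; rewrite !ffunE => ->.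
case: Sc => _ _ cM x y xy; have := cM _ _ (cl f cf) (cl g cg) x y xy.
have E u : (f * g) u = ((lift f * lift g : galg int R) u)%:~R.
  rewrite !galgM rmorph_sum /=; apply: eq_bigr => z _.
  by rewrite !ffunE rmorphM /= -!pmulrn !natr_Zp.
by rewrite !E => ->.
Qed.

(* Frobenius in F_p[Z_n]: the p-th power of X is the sum of the p-fold multiples. *)
Lemma schur_power_count p X : prime p -> cset c X ->
  cconst c (fun x => #|[set z in X | z *+ p == x]| %% p)%N.
Proof.
move=> p_pr cX x y xy.
have cE k : cconst c (ind X ^+ k : galg 'F_p R).
  elim: k => [|k IH]; last by rewrite exprS; apply: cconst_Fp => //; exact: cset_ind.
  case: Sc => c0 _ _ u v uv; rewrite expr0 !galg1.
  by have := c0 u v uv; rewrite !inE => ->.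
have := cE p x y xy; rewrite !(ind_pow_char _ (pchar_Fp p_pr)) => E.
by have := congr1 val E; rewrite /= !val_Fp_nat.
Qed.

(* Schur's theorem on multipliers. For a prime k the fibres of multiplication by k have at
   most one element, hence are determined by their size modulo k. *)
Lemma cmult k : coprime k n -> cconst c (fun x => c (x * k%:R)).
Proof.
(* The Frobenius count controls division, not multiplication: for a prime [p] not dividing [n], the
   only [z] with [z *+ p = x] is the quotient of [x] by [p]. The induction therefore multiplies by
   the inverse [v] of [w], removing one prime factor of [w] at a time. *)
have inv_prime w : coprime w n -> forall v : R, v * w%:R = 1 -> cconst c (fun x => c (v * x)).
  elim/ltn_ind: w => w IH cw v vw.
  case: (ltngtP w 1) => w1; last 1 first.
  - by move=> x y xy; move: vw; rewrite w1 mulr1 => ->; rewrite !mul1r.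
  - move: cw; rewrite ltnS leqn0 in w1; rewrite (eqP w1) /coprime gcd0n => /eqP n1.
    by have := n_gt1; rewrite [X in (1 < X)%N]n1.
  have [p [w' [p_pr wE]]] : exists p w', prime p /\ (w = p * w')%N.
    by exists (pdiv w), (w %/ pdiv w)%N; rewrite pdiv_prime // mulnC divnK ?pdiv_dvd.
  have [cp cw'] : coprime p n /\ coprime w' n.
    by apply/andP; rewrite -coprimeMl -wE.
  have vw' : v * p%:R * w'%:R = 1 by rewrite -[RHS]vw wE natrM mulrA.
  pose vp := v * w'%:R; pose v' := v * p%:R.
  have vpE : vp * p%:R = 1 by rewrite -[RHS]vw' /vp; ring.
  have v'E : v' * w'%:R = 1 by [].
  have Mp : cconst c (fun x => c (vp * x)).
    move=> x y xy; pose X := cclass c (vp * x).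
    have E u : #|[set z in X | z *+ p == u]| = (vp * u \in X) :> nat.
      case uX: (vp * u \in X).
        rewrite (_ : [set _ | _] = [set vp * u]) ?cards1 //; apply/setP=> z; rewrite !inE.
        apply/idP/eqP => [/andP[_ /eqP <-]|->].
          by rewrite -mulr_natr mulrCA [vp * _]vpE mulr1.
        have := uX; rewrite inE => -> /=.
        by rewrite -mulr_natr mulrAC vpE mul1r.
      apply/eqP; rewrite cards_eq0; apply/eqP/setP=> z; rewrite [in RHS]inE inE.
      apply/negP=> /andP[zX /eqP zu]; move/negP: uX; apply.
      by rewrite -zu -mulr_natr mulrCA vpE mulr1.
    have := schur_power_count p_pr (@cclass_cset (vp * x)) xy; rewrite -/X /= !E.
    rewrite !modn_small; do ?by rewrite (leq_ltn_trans (leq_b1 _)) ?prime_gt1.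
    rewrite cclass_id /X inE; by case: eqP => // ->.
  have lt : (w' < w)%N.
    rewrite wE ltn_Pmull ?prime_gt1 //; case: posnP w1 => // w0.
    by rewrite wE w0 muln0.
  have M' := IH _ lt cw' v' v'E.
  move=> x y xy; have E u : v * u = v' * (vp * u).
    by rewrite -[in LHS](mulr1 v) -vw' /v' /vp; ring.
  by rewrite (E x) (E y); apply/M'/Mp.
(* Since [k%:R] is the inverse of [v], dividing by the representative of [v] is multiplying by
   [k]. *)
move=> ck; have [v vk] := natr_coprime_unit n_gt1 ck.
have vU : coprime (v : nat) n.
  have : v \is a GRing.unit by apply/unitrP; exists k%:R; rewrite vk mulrC.
  by rewrite {1}[v]Zn_natE unitZpE // coprime_sym.
have kv : k%:R * (v : nat)%:R = 1 :> R by rewrite -Zn_natE mulrC.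
by move=> x y /(inv_prime _ vU _ kv); rewrite ![_ * k%:R]mulrC.
Qed.

Lemma cmult_unit (u : R) : u \is a GRing.unit -> cconst c (fun x => c (x * u)).
Proof. by rewrite {1 2}[u]Zn_natE unitZpE // coprime_sym; apply: cmult. Qed.

(* The largest union of colours inside M. *)
Definition ccore M := [set x | [forall y, (c y == c x) ==> (y \in M)]].

Lemma ccore_cset M : cset c (ccore M).
Proof. by move=> x y xy; rewrite !inE xy. Qed.

Lemma ccore_sub M : ccore M \subset M.
Proof. by apply/subsetP=> x; rewrite inE => /forallP/(_ x); rewrite eqxx. Qed.

Lemma ccore_max M X : cset c X -> X \subset M -> X \subset ccore M.
Proof.
move=> cX /subsetP XM; apply/subsetP=> x xX; rewrite inE; apply/forallP=> y.
by apply/implyP=> /eqP yx; rewrite XM // (cX y x).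
Qed.

(** The sums of two elements of the core form a union of colours, being the support of a
    convolution, and they stay in the group [M]; by maximality they are in the core. *)
Lemma ccore_subg M : is_subgroup M -> is_subgroup (ccore M).
Proof.
move=> sM; have W0 : 0 \in ccore M.
  rewrite -sub1set; apply: ccore_max; first by case: Sc.
  by rewrite sub1set; case: sM.
apply: subg_closed => // x y xW yW.
pose S := [set u : R | (0 < #|[set z in ccore M | (u - z)%R \in ccore M]|)%N].
have cS : cset c S.
  by move=> u v uv; rewrite !inE (cset_count (@ccore_cset M) (@ccore_cset M) uv).
have SM : S \subset M.
  apply/subsetP=> u; rewrite inE card_gt0 => /set0Pn[z]; rewrite inE => /andP[zW uzW].
  rewrite -[u](subrK z) subgD //; exact: (subsetP (ccore_sub M)).
apply: (subsetP (ccore_max cS SM)); rewrite inE card_gt0; apply/set0Pn; exists x.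
by rewrite inE xW addrC addKr.
Qed.

(* The stabilizer of X under translations, called the radical in the theory of S-rings. *)
Definition crad X := [set g : R | [forall x, (x + g \in X) == (x \in X)]].

Lemma cradP X g : reflect (forall x, (x + g \in X) = (x \in X)) (g \in crad X).
Proof. by rewrite inE; apply: (iffP forallP) => h x; apply/eqP/h. Qed.

Lemma crad_subg X : is_subgroup (crad X).
Proof.
apply: subg_closed => //; first by apply/cradP => x; rewrite addr0.
by move=> g h /cradP gX /cradP hX; apply/cradP=> x; rewrite addrA hX gX.
Qed.

Lemma crad_sub X g : (forall x, x \in X -> x + g \in X) -> g \in crad X.
Proof.
move=> h; have inj : injective (fun x : R => x + g) by exact: addIr.
have E : (fun x => x + g) @: X = X.
  apply/eqP; rewrite eqEcard card_imset // leqnn andbT.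
  by apply/subsetP=> _ /imsetP[x xX ->]; exact: h.
apply/cradP=> x; apply/idP/idP => [|/h //].
by rewrite -{1}E => /imsetP[y yX /addIr ->].
Qed.

(** An element stabilizes [X] exactly when the number of its representations as a difference in [X]
    reaches the maximum [#|X|], and this number depends only on the colour. *)
Lemma crad_cset X : cset c X -> cset c (crad X).
Proof.
move=> cX; have E g : (g \in crad X) = (#|[set z in X | z - g \in X]| == #|X|).
  rewrite -(subgN _ (crad_subg X)); apply/idP/idP => [/cradP h|/eqP h].
    by apply/eqP; apply: eq_card => z; rewrite !inE h andbb.
  apply: crad_sub => x xX.
  have /eqP: [set z in X | z - g \in X] == X.
    by rewrite eqEcard h leqnn andbT; apply/subsetP=> z; rewrite inE => /andP[].
  by move=> /setP/(_ x); rewrite !inE xX.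
by move=> x y xy; rewrite !E (cset_lambda cX xy).
Qed.

End SchurRings.

(** * Schur's argument at a prime divisor of n, and primitive S-rings *)

Section Primitivity.
Variables (n : nat) (n_gt1 : (1 < n)%N) (C : eqType) (c : 'Z_n -> C) (Sc : Sring c).
Local Notation R := 'Z_n.
Implicit Types (x y g : R) (X Y H M : {set R}) (m k p : nat).

Lemma mulrn_multiples p x : (p %| n)%N -> x *+ p \in multiples n p.
Proof.
by move=> pn; rewrite {1}[x]Zn_natE -[_ *+ p]mulr_natr -natrM mem_multiples ?dvdn_mull.
Qed.

Lemma mulrn_mem p m x : (0 < p)%N -> (p %| m)%N -> (m %| n)%N ->
  (x *+ p \in multiples n m) = (x \in multiples n (m %/ p)).
Proof.
move=> p0 pm mn; rewrite [x]Zn_natE -[_ *+ p]mulr_natr -natrM !mem_multiples //; last first.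
  by apply: dvdn_trans mn; rewrite -{2}(divnK pm) dvdn_mulr.
by rewrite -{1}(divnK pm) dvdn_pmul2r.
Qed.

Lemma Zn_mulrn_eq0 p x : (0 < p)%N -> (p %| n)%N ->
  (x *+ p == 0) = (x \in multiples n (n %/ p)).
Proof.
by move=> p0 pn; rewrite -mulrn_mem // multiplesn // inE.
Qed.

Lemma divn_dvdl p m : (p %| m)%N -> (m %/ p %| m)%N.
Proof. by move=> pm; rewrite -{2}(divnK pm) dvdn_mulr. Qed.

(* The coefficient of g in the p-th power of X is, modulo p, the number of elements of X
   above g under multiplication by p, hence a full or an empty coset of the subgroup of
   order p unless g lies in a colour set contained in pG. *)
Lemma schur_coset X p x g : prime p -> (p %| n)%N -> cset c X ->
  x *+ p \notin ccore c (multiples n p) -> g \in multiples n (n %/ p) ->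
  (x + g \in X) = (x \in X).
Proof.
move=> p_pr pn cX xW gP; have p0 := prime_gt0 p_pr.
have sP : is_subgroup (multiples n (n %/ p)) by apply/multiples_subg/divn_dvdl.
have cardP : #|multiples n (n %/ p)| = p by rewrite card_multiples ?divn_dvdl ?divnA ?mulKn ?n_gt0.
pose F (u : R) := [set z in X | z *+ p == u].
pose Y := [set u : R | (#|F u| %% p != 0)%N].
have cY : cset c Y by move=> u v uv; rewrite !inE (schur_power_count Sc p_pr cX uv).
have YM : Y \subset multiples n p.
  apply/subsetP=> u; rewrite inE => Fu; have : (0 < #|F u|)%N.
    by case: posnP Fu => // ->; rewrite mod0n.
  rewrite card_gt0 => /set0Pn[z]; rewrite inE => /andP[_ /eqP <-].
  exact: mulrn_multiples.
have key u : u \in X -> u *+ p = x *+ p -> forall h, h \in multiples n (n %/ p) -> u + h \in X.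
  move=> uX ux h hP; have /negP uY : x *+ p \notin Y.
    by apply: contra xW; apply/subsetP/ccore_max.
  have FC : F (x *+ p) \subset [set u + k | k in multiples n (n %/ p)].
    apply/subsetP=> z; rewrite inE -ux => /andP[_ /eqP zu]; apply/imsetP; exists (z - u).
      by rewrite -Zn_mulrn_eq0 // mulrnBl zu subrr.
    by rewrite addrC subrK.
  have cC : #|[set u + k | k in multiples n (n %/ p)]| = p by rewrite card_imset //; exact: addrI.
  have F0 : (0 < #|F (x *+ p)|)%N.
    by rewrite card_gt0; apply/set0Pn; exists u; rewrite inE uX ux eqxx.
  (* A nonempty fibre whose size is a multiple of [p], inside a coset with [p] elements, is the
     whole coset. *)
  have Fp : (p <= #|F (x *+ p)|)%N.
    by apply: dvdn_leq => //; rewrite /dvdn; apply: contraPT uY; rewrite inE => ->.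
  have /eqP FE : F (x *+ p) == [set u + k | k in multiples n (n %/ p)].
    by rewrite eqEcard FC cC.
  have : u + h \in F (x *+ p) by rewrite FE; apply/imsetP; exists h.
  by rewrite inE => /andP[].
have gp : g *+ p = 0 by apply/eqP; rewrite Zn_mulrn_eq0.
apply/idP/idP => [xgX|xX]; last exact: key.
have := key _ xgX; rewrite mulrnDl gp addr0 => /(_ erefl (- g)).
by rewrite subgN // addrK; apply.
Qed.

Lemma sum_lambda X H :
  (\sum_(g in H) #|[set z in X | (z - g)%R \in X]| = \sum_(z in X) #|[set g in H | (z - g)%R \in X]|)%N.
Proof.
under eq_bigr => g _ do rewrite -sum1_card.
under [RHS]eq_bigr => z _ do rewrite -sum1_card.
rewrite (exchange_big_dep (mem X)) /=; last by move=> g z _; rewrite inE => /andP[].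
apply: eq_bigr => z zX; apply: eq_bigl => g; rewrite !inE zX /=.
by [].
Qed.

(* The boolean form allows case analysis over the divisors of n without classical axioms. *)
Definition csetb X := [forall x, forall y, (c x == c y) ==> ((x \in X) == (y \in X))].

Lemma csetP X : reflect (cset c X) (csetb X).
Proof.
apply: (iffP forallP) => [h x y xy|h x].
  by have /forallP/(_ y) := h x; rewrite xy eqxx => /eqP.
by apply/forallP=> y; apply/implyP=> /eqP/h ->.
Qed.

Definition cprim := forall m, (m %| n)%N -> cset c (multiples n m) -> m = 1%N \/ m = n.

Lemma cprimP : cprim \/ exists m, [/\ (1 < m < n)%N, (m %| n)%N & cset c (multiples n m)].
Proof.
case: (boolP [exists m : 'I_n, [&& (1 < m)%N, (m %| n)%N & csetb (multiples n m)]]).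
  by move=> /existsP[m /and3P[m1 mn /csetP cm]]; right; exists m; rewrite m1 ltn_ord.
move=> /existsPn no; left=> m mn cm.
have := dvdn_leq (n_gt0 n_gt1) mn; rewrite leq_eqVlt => /orP[/eqP|mltn]; first by right.
have := dvdn_gt0 (n_gt0 n_gt1) mn; rewrite leq_eqVlt => /orP[/eqP|m1]; first by left.
by have := no (Ordinal mltn); rewrite /= m1 mn /=; move/csetP: cm => ->.
Qed.

Lemma cprim_subg H : cprim -> is_subgroup H -> cset c H -> H = [set 0] \/ H = setT.
Proof.
move=> pc /(subg_multiples n_gt1)[m mn ->] /(pc m mn)[] ->; [right|left].
  exact: multiples1.
exact: multiplesn.
Qed.

(* Let P be the subgroup of prime order p, and suppose n is composite. Outside P every colour
   X is a union of P-cosets, and every colour meets P. So each difference in Z_n - 0 occurs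
   at least #|X - P| times in X, which is too often for the smaller of two colours. *)
Theorem cprim_prime (x0 y0 : R) :
  cprim -> x0 != 0 -> y0 != 0 -> c x0 <> c y0 -> prime n.
Proof.
move=> pc; wlog le : x0 y0 / (#|cclass c x0| <= #|cclass c y0|)%N.
  move=> W x00 y00 xy; case/orP: (leq_total #|cclass c x0| #|cclass c y0|) => le.
    exact: (W x0 y0).
  by apply: (W y0 x0) => // /esym.
move=> x00 y00 xy; apply/negPn/negP => npr.
have p_pr : prime (pdiv n) by exact: pdiv_prime.
have pn : (pdiv n %| n)%N by exact: pdiv_dvd.
set p := pdiv n in p_pr pn; have p0 := prime_gt0 p_pr.
have pltn : (p < n)%N.
  rewrite ltn_neqAle dvdn_leq ?n_gt0 // andbT; apply: contra npr => /eqP <-; exact: p_pr.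
set P := multiples n (n %/ p).
have npn := divn_dvdl pn.
have sP : is_subgroup P by apply: multiples_subg.
have cardP : #|P| = p by rewrite card_multiples // divnA // mulKn ?n_gt0.
(* By primitivity the core is trivial, so [schur_coset] applies at every [x] with [x *+ p] nonzero,
   that is, everywhere outside [P]. *)
have W0 : ccore c (multiples n p) = [set 0].
  have sW := ccore_subg n_gt1 Sc (multiples_subg n_gt1 pn).
  case: (cprim_subg pc sW (@ccore_cset _ _ c _)) => // WT.
  have := ccore_sub c (multiples n p); rewrite WT -(multiples1 n) multiples_sub ?dvd1n //.
  by rewrite dvdn1 => /eqP p1; rewrite p1 in p_pr.
have inv X x g : cset c X -> x \notin P -> g \in P -> (x + g \in X) = (x \in X).
  move=> cX xP gP; apply: (schur_coset p_pr pn) => //.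
  by rewrite W0 inE Zn_mulrn_eq0.
(* A colour disjoint from [P] would be a union of cosets of [P]; its radical, a nontrivial colour
   subgroup, would be the whole group, and the colour would contain 0. *)
have meet x : x != 0 -> exists2 g, g \in P & c g = c x.
  move=> x_n0; have [/set0Pn[g]|] := boolP (cclass c x :&: P != set0).
    by rewrite !inE => /andP[/eqP gx gP]; exists g; rewrite ?inE.
  rewrite negbK => /eqP XP; exfalso.
  have PR : P \subset crad (cclass c x).
    apply/subsetP=> g gP; apply: crad_sub => u uX; rewrite inv //; first exact: cclass_cset.
    by apply/negP=> uP; have: u \in cclass c x :&: P; [rewrite in_setI uX|rewrite XP inE].
  case: (cprim_subg pc (crad_subg n_gt1 (cclass c x))) => [||RT].
  - by apply: (crad_cset n_gt1 Sc); exact: cclass_cset.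
  - move=> RE; rewrite RE in PR.
    by have := subset_leq_card PR; rewrite cards1 cardP leqNgt prime_gt1.
  - have /cradP/(_ x) : - x \in crad (cclass c x) by rewrite RT inE.
    rewrite subrr cclass_id inE => /eqP cx; move: x_n0.
    by case: (Sc) => /(_ 0 x cx); rewrite !inE eqxx => <-.
pose X := cclass c x0; pose Y := cclass c y0.
have cX : cset c X by exact: cclass_cset.
have XP : (p <= #|X :\: P|)%N.
  have /set0Pn[x] : X :\: P != set0.
    apply/negP=> /eqP XP0; have XP : X \subset P by rewrite -setD_eq0 XP0.
    have XW := ccore_max cX XP; have x0W := subsetP XW x0 (cclass_id c x0).
    case: (cprim_subg pc (ccore_subg n_gt1 Sc sP) (@ccore_cset _ _ c _)) => WE.
      by move: x0W; rewrite WE inE (negPf x00).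
    have := subset_leq_card (ccore_sub c P); rewrite WE cardsT Zn_card // cardP.
    by rewrite leqNgt pltn.
  rewrite in_setD => /andP[xP xX]; rewrite -cardP -(card_imset _ (addrI x)).
  apply: subset_leq_card; apply/subsetP=> _ /imsetP[g gP ->].
  by rewrite in_setD (inv X) // xX andbT subgDr.
have X0 : 0 \notin X.
  rewrite inE; apply/eqP=> cx; move: x00.
  by case: (Sc) => /(_ 0 x0 cx); rewrite !inE eqxx => <-.
(* The 2 accounts for 0 and for an element of the other colour, both in [P] and not in [X]. *)
have XPle : (#|X :&: P| + 2 <= p)%N.
  have [g gP gy] := meet y0 y00.
  have g_n0 : g != 0.
    apply: contra y00 => /eqP g0; rewrite g0 in gy.
    by case: (Sc) => /(_ 0 y0 gy); rewrite !inE eqxx => <-.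
  have c2 : #|[set 0; g]| = 2%N by rewrite cards2 eq_sym g_n0.
  rewrite -cardP -c2 -(cardsUI (X :&: P) [set 0; g]).
  rewrite [X in (_ + X)%N](_ : _ = 0%N) ?addn0.
    apply: subset_leq_card; apply/subsetP=> u.
    rewrite in_setU in_setI in_set2 => /orP[/andP[]//|/orP[]/eqP -> //].
    by case: sP.
  apply/eqP; rewrite cards_eq0; apply/eqP/setP=> u; rewrite in_set0; apply/negP.
  rewrite !in_setI in_set2 => /andP[/andP[uX _] /orP[]/eqP uE]; rewrite uE in uX.
    by rewrite uX in X0.
  by move: uX; rewrite inE gy => /eqP/esym.
have lam g : g != 0 -> (#|X :\: P| <= #|[set z in X | (z - g)%R \in X]|)%N.
  move=> /meet[g' g'P gE]; rewrite -(cset_lambda Sc cX gE).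
  apply: subset_leq_card; apply/subsetP=> z; rewrite in_setD => /andP[zP zX].
  by rewrite inE zX inv // subgN.
have Xn : (#|X| + #|Y| + 1 <= n)%N.
  rewrite -(cards1 (0 : R)) -[X in (_ <= X)%N](Zn_card n_gt1) -cardsT.
  rewrite -cardsUI [X in (_ + X + _)%N](_ : _ = 0%N); last first.
    apply/eqP; rewrite cards_eq0; apply/eqP/setP=> u; rewrite in_set0; apply/negP.
    by rewrite !inE => /andP[/eqP E1 /eqP E2]; apply: xy; rewrite -E1 -E2.
  rewrite addn0 -cardsUI [X in (_ + X)%N](_ : _ = 0%N); last first.
    apply/eqP; rewrite cards_eq0; apply/eqP/setP=> u; rewrite in_set0; apply/negP.
    rewrite in_setI in_set1 in_setU => /andP[/orP[]uX /eqP u0]; rewrite u0 in uX.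
      by rewrite uX in X0.
    move: uX; rewrite inE => /eqP cy; move: y00.
    by case: (Sc) => /(_ 0 y0 cy); rewrite !inE eqxx => <-.
  by rewrite addn0; apply: subset_leq_card; exact: subsetT.
have sumX : (#|X| + (n.-1) * #|X :\: P| <= #|X| * #|X|)%N.
  have := sum_lambda X setT; rewrite (bigD1 0) ?inE //=.
  have -> : #|[set z in X | z - 0 \in X]| = #|X|.
    by apply: eq_card => z; rewrite !inE subr0 andbb.
  have -> : (\sum_(z in X) #|[set g in setT | (z - g)%R \in X]| = #|X| * #|X|)%N.
    rewrite -sum_nat_const; apply: eq_bigr => z zX.
    have inj : injective (fun u : R => z - u) by move=> u v /addrI/oppr_inj.
    rewrite -(card_imset (mem X) inj); apply: eq_card => u; rewrite in_set in_setT /=.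
    apply/idP/imsetP => [uX|[v vX ->]]; last by rewrite opprB addrC subrK.
    by exists (z - u); rewrite // opprB addrC subrK.
  move=> <-; rewrite leq_add2l.
  have -> : n.-1 = #|[pred g : R | g != 0]|.
    have E := cardC (pred1 (0 : R)); rewrite card1 Zn_card // in E.
    apply: (@addnI 1%N); rewrite [LHS]add1n prednK ?n_gt0 // -[LHS]E.
  rewrite -sum_nat_const; rewrite big_mkcond [X in (_ <= X)%N]big_mkcond /=.
  by apply: leq_sum => g _; rewrite !inE; case: ifP => // /lam.
have := cardsID P X; rewrite -/X -/Y in le; move: le Xn sumX XPle XP.
move: #|X| #|Y| #|X :\: P| #|X :&: P| => a b d i le Xn sumX XPle XP aE.
(* Here [a = i + d] with [i + 2 <= p <= d], hence [a <= 2 * d - 2]. As [X] is the smaller colour,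
   [2 * a <= n.-1], and the count of differences gives [a * (2 * d + 1) <= a * a], which is
   impossible. *)
have l1 : (2 * a * d <= n.-1 * d)%N by rewrite leq_mul2r; apply/orP; right; lia.
have l2 : (a * (2 * d + 1) <= a * a)%N by lia.
have a0 : (0 < a)%N by lia.
by move: l2; rewrite leq_pmul2l //; lia.
Qed.

End Primitivity.

Section GroupAlgebraInt.
Variable G : finZmodType.
Implicit Types (f g : galg int G) (A B : {set G}) (a : int).

Lemma galgZ a f x : (a%:~R * f) x = a * f x.
Proof. by rewrite mulrzl galgMz -mulrzl intz. Qed.

Lemma galg_int a x : (a%:~R : galg int G) x = a * (x == 0)%:R.
Proof. by rewrite -[a%:~R]mulr1 galgZ galg1. Qed.

Lemma indTM A : ind [set: G] * ind A = (#|A| : int)%:~R * ind [set: G] :> galg int G.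
Proof.
apply/ffunP=> x; rewrite mulrC indM galgZ indE inE mulr1 natz.
by congr (_%:Z); apply: eq_card => z; rewrite !inE andbT.
Qed.

Lemma indM0 A B : (forall x, x \in B -> - x \in B) ->
  (ind A * ind B : galg int G) 0 = (#|A :&: B|)%:Z.
Proof.
move=> BN; rewrite indM natz; congr (_%:Z); apply: eq_card => z; rewrite !inE sub0r.
by case: (z \in A) => //=; apply/idP/idP => /BN //; rewrite opprK.
Qed.

End GroupAlgebraInt.

(** * Cyclotomic classes and cyclotomic numbers *)

Section Cyclotomy.
Variables (F : finFieldType).
Local Notation L := (#|F|.-1).

Lemma card_predF : L = #|[pred x : F | x != 0]|.
Proof.
have := cardC (pred1 (0 : F)); rewrite card1 => <-; rewrite add1n /=.
by apply: eq_card.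
Qed.

Lemma finField_primitive : exists g : F, L.-primitive_root g.
Proof.
pose rs := enum [pred x : F | x != 0].
have L0 : (0 < L)%N by rewrite -subn1 subn_gt0 card_finNzRing_gt1.
have /hasP[g _ gP] : has L.-primitive_root rs; last by exists g.
apply: has_prim_root; rewrite ?enum_uniq //; last by rewrite -cardE card_predF.
apply/allP=> x; rewrite mem_enum inE => x0; rewrite unity_rootE.
apply/eqP/(mulfI x0); rewrite mulr1 -exprS prednK ?expf_card //.
by rewrite (leq_trans _ (card_finNzRing_gt1 F)).
Qed.

Variables (g : F) (gP : L.-primitive_root g).

Lemma gen_neq0 : g != 0.
Proof.
apply/eqP=> g0; have := prim_expr_order gP; rewrite g0 expr0n.
have := prim_order_gt0 gP; case: L => // k _ /= /eqP.
by rewrite eq_sym oner_eq0.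
Qed.

Lemma genX_neq0 k : g ^+ k != 0.
Proof. by rewrite expf_neq0 ?gen_neq0. Qed.

(* Discrete logarithm to base g; junk at 0. *)
Definition lg (x : F) : nat := odflt ord0 [pick k : 'I_L.+1 | g ^+ k == x].

Lemma lgK x : x != 0 -> g ^+ lg x = x.
Proof.
move=> x0; rewrite /lg; case: pickP => [k /eqP //|no].
have xL : x ^+ L = 1.
  apply/(mulfI x0); rewrite mulr1 -exprS prednK ?expf_card //.
  by rewrite (leq_trans _ (card_finNzRing_gt1 F)).
have [i xE] := prim_rootP gP xL.
by have := no (widen_ord (leqnSn _) i); rewrite -xE eqxx.
Qed.

(** The cyclotomic classes of order [d]. The index is any natural number, read modulo [d], so that
    shifts [i + k] need no reduction. *)
Definition cyc d i : {set F} := [set x | (x != 0) && (lg x == i %[mod d])].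

Variables (d : nat) (dL : (d %| L)%N).

Lemma mem_cyc k i : (g ^+ k \in cyc d i) = (k == i %[mod d]).
Proof.
rewrite inE genX_neq0 /=.
have /eqP : g ^+ lg (g ^+ k) == g ^+ k by rewrite lgK ?genX_neq0.
move/eqP; rewrite (eq_prim_root_expr gP) => /eqP E.
by rewrite -(modn_dvdm (lg _) dL) E modn_dvdm.
Qed.

Lemma cyc_scale x i k : (x * g ^+ k \in cyc d (i + k)) = (x \in cyc d i).
Proof.
have [->|x0] := eqVneq x 0; first by rewrite mul0r !inE eqxx.
by rewrite -{1}(lgK x0) -exprD mem_cyc eqn_modDr inE x0.
Qed.

(** Multiplication by [g ^+ k] is an additive automorphism that shifts the index of every class by
    [k]. *)
Lemma cyc_count i j k x :
  (ind (cyc d (i + k)) * ind (cyc d (j + k)) : galg int F) (x * g ^+ k)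
  = (ind (cyc d i) * ind (cyc d j) : galg int F) x.
Proof.
rewrite !galgM (reindex (fun z => z * g ^+ k)) /=; last first.
  exists (fun z => z / g ^+ k) => z _; first by rewrite mulfK ?genX_neq0.
  by rewrite divfK ?genX_neq0.
by apply: eq_bigr => z _; rewrite -mulrBl !indE !cyc_scale.
Qed.

Lemma cyc_mod i j : i = j %[mod d] -> cyc d i = cyc d j.
Proof. by move=> ij; apply/setP=> x; rewrite !inE ij. Qed.

Lemma cyc0P x : (x \in cyc d 0) = (x != 0) && [exists z, z ^+ d == x].
Proof.
have [->|x0] := eqVneq x 0; first by rewrite inE eqxx.
rewrite inE x0 mod0n /=; apply/idP/existsP => [/dvdnP[q E]|[z /eqP zx]].
  by exists (g ^+ q); rewrite -exprM -E lgK.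
have z0 : z != 0.
  apply/eqP=> z0; move: zx x0; rewrite z0 expr0n; case: (d) dL => [|? _ <-]; rewrite ?eqxx //.
  by rewrite dvd0n => /eqP L0; have := prim_order_gt0 gP; rewrite L0.
have := mem_cyc (lg z * d) 0; rewrite exprM lgK // zx modnMl mod0n eqxx.
by rewrite inE x0 mod0n.
Qed.

Lemma card_cyc i : (d * #|cyc d i| = L)%N.
Proof.
have cE j : #|cyc d j| = #|cyc d 0|.
  rewrite -(card_imset (mem (cyc d 0)) (mulIf (genX_neq0 j))); apply: eq_card => x.
  apply/idP/imsetP => [xj|[y yC ->]]; last by have := cyc_scale y 0 j; rewrite add0n => ->.
  exists (x / g ^+ j); last by rewrite divfK ?genX_neq0.
  by rewrite -(cyc_scale _ 0 j) divfK ?genX_neq0.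
have d0 : (0 < d)%N by apply: dvdn_gt0 dL; exact: prim_order_gt0 gP.
rewrite cE card_predF -[RHS]sum1_card (partition_big (fun x => inord (lg x %% d) : 'I_d.-1.+1) predT) //=.
transitivity (\sum_(j < d.-1.+1) #|cyc d 0|)%N; first by rewrite sum_nat_const card_ord prednK.
apply: eq_bigr => j _; rewrite -(cE j) -sum1_card; apply: eq_bigl => x.
rewrite !inE; congr (_ && _); have jd : (j < d)%N by rewrite -[X in (_ < X)%N](prednK d0).
by rewrite -val_eqE /= inordK ?(prednK d0) ?ltn_mod // [X in _ == X]modn_small.
Qed.

End Cyclotomy.

Section CyclotomicNumbers.
Variables (F : finFieldType) (g : F).
Local Notation L := (#|F|.-1).
Hypothesis gP : L.-primitive_root g.

(** Two elements of one class differ by a factor [g ^+ (k * d)], which maps every class to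
    itself. *)
Lemma cyc_const d i j r (x : F) : (d %| L)%N -> x \in cyc g d r ->
  (ind (cyc g d i) * ind (cyc g d j) : galg int F) x
  = (ind (cyc g d i) * ind (cyc g d j) : galg int F) (g ^+ r).
Proof.
move=> dL; rewrite inE => /andP[x0 /eqP xr].
have E k s : (ind (cyc g d i) * ind (cyc g d j) : galg int F) (g ^+ (k * d + s))
    = (ind (cyc g d i) * ind (cyc g d j) : galg int F) (g ^+ s).
  rewrite addnC exprD -[RHS](cyc_count gP dL i j (k * d)).
  by congr ((ind _ * ind _ : galg int F) _); apply: cyc_mod; rewrite addnC modnMDl.
have {1}<- : g ^+ lg g x = x by exact: lgK.
by rewrite (divn_eq (lg g x) d) xr E -(E (r %/ d)%N) -divn_eq.
Qed.

Lemma cyc_opp d i x : (d %| L)%N -> -1 \in cyc g d 0 -> x \in cyc g d i -> - x \in cyc g d i.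
Proof.
move=> dL; rewrite inE => /andP[N0 /eqP lN] xi.
have := cyc_scale gP dL x i (lg g (-1)); rewrite lgK // mulrN1 xi.
by rewrite (@cyc_mod _ g d _ i) // -modnDmr lN mod0n addn0.
Qed.

Lemma cyc_disjoint d i j (x : F) :
  x \in cyc g d i -> x \in cyc g d j -> i = j %[mod d].
Proof. by rewrite !inE => /andP[_ /eqP <-] /andP[_ /eqP]. Qed.

Lemma ind_cyc_gen d i k : (d %| L)%N ->
  (ind (cyc g d i) : galg int F) (g ^+ k) = (k == i %[mod d])%:R.
Proof. by move=> dL; rewrite indE (mem_cyc gP dL). Qed.

Lemma ind_cyc_0 d i : (ind (cyc g d i) : galg int F) 0 = 0.
Proof. by rewrite indE inE eqxx. Qed.

Lemma cyc_prod_at0 d i : (d %| L)%N -> -1 \in cyc g d 0 ->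
  (ind (cyc g d i) * ind (cyc g d i) : galg int F) 0 = #|cyc g d i|%:Z.
Proof. by move=> dL N; rewrite indM0 ?setIid // => x; apply: cyc_opp. Qed.

Lemma cyc_prod_at0_neq d i j : (d %| L)%N -> -1 \in cyc g d 0 -> i <> j %[mod d] ->
  (ind (cyc g d i) * ind (cyc g d j) : galg int F) 0 = 0.
Proof.
move=> dL N ij; rewrite indM0 => [|x]; last exact: cyc_opp.
rewrite (_ : _ :&: _ = set0) ?cards0 //; apply/setP=> x; rewrite in_set0 in_setI.
by apply/negP=> /andP[xi xj]; apply/ij/(cyc_disjoint xi xj).
Qed.

Lemma galg_eq_cyc d (f h : galg int F) : (d %| L)%N -> f 0 = h 0 ->
  (forall r x, (r < d)%N -> x \in cyc g d r -> f x = h x) -> f = h.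
Proof.
move=> dL fh0 fh; apply/ffunP=> x; have [->//|x0] := eqVneq x 0.
apply: (fh (lg g x %% d)%N).
  by rewrite ltn_mod (dvdn_gt0 _ dL) // (prim_order_gt0 gP).
by rewrite inE x0 modn_mod eqxx.
Qed.

Section Quadratic.
Hypotheses (L2 : (2 %| L)%N) (N1 : -1 \in cyc g 2 0).
Local Notation s := (ind (cyc g 2 0) : galg int F).
Local Notation t := (ind (cyc g 2 1) : galg int F).

Lemma setT_cyc2 : ind setT = 1 + s + t :> galg int F.
Proof.
apply: (galg_eq_cyc L2) => [|r x r2 xr].
  by rewrite !galgD galg1 !ind_cyc_0 indE inE eqxx.
have x0 : x != 0 by move: xr; rewrite inE => /andP[].
rewrite !galgD galg1 (negPf x0) !indE inE.
have in_cyc i : (x \in cyc g 2 i) = (r == i %[mod 2]).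
  by move: xr; rewrite !inE x0 /= => /eqP ->.
by rewrite !in_cyc; case: r r2 {xr in_cyc} => [|[|]].
Qed.

(** [mu] counts the ways of writing [g] as a sum of two elements of class 0. Both classes have [k]
    elements, so [ind setT] kills [s - t], and [s * s - t * t = (ind setT - 1) * (s - t)] gives
    [a = mu - 1]. Multiplying [s * s] by [ind setT] gives [k = 1 + a + mu], that is [k = 2 * mu]. *)
Lemma quadratic_numbers : exists mu : nat,
  [/\ #|F| = (4 * mu + 1)%N, #|cyc g 2 0| = (2 * mu)%N, #|cyc g 2 1| = (2 * mu)%N,
    s * s = (2 * mu%:Z)%:~R + (mu%:Z - 1)%:~R * s + (mu%:Z)%:~R * t
  & t * t = (2 * mu%:Z)%:~R + (mu%:Z)%:~R * s + (mu%:Z - 1)%:~R * t].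
Proof.
pose mu := #|[set z in cyc g 2 0 | g ^+ 1 - z \in cyc g 2 0]|.
set k := #|cyc g 2 0|; pose a := (s * s) (g ^+ 0).
have bE : (s * s) (g ^+ 1) = mu%:Z by rewrite indM natz.
have kL : (2 * k = L)%N := card_cyc gP L2 0.
have k1 : #|cyc g 2 1| = k by have := card_cyc gP L2 1; lia.
have ssE : s * s = (k%:Z)%:~R + a%:~R * s + (mu%:Z)%:~R * t.
  apply: (galg_eq_cyc L2) => [|r x r2 xr].
    by rewrite cyc_prod_at0 // !galgD !galgZ galg_int !ind_cyc_0 eqxx; lia.
  have x0 : x != 0 by move: xr; rewrite inE => /andP[].
  rewrite (cyc_const _ _ L2 xr) !galgD !galgZ galg_int (negPf x0) !indE.
  have in_cyc i : (x \in cyc g 2 i) = (r == i %[mod 2]).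
    by move: xr; rewrite !inE x0 /= => /eqP ->.
  rewrite !in_cyc; case: r r2 {xr in_cyc} => [|[|//]] _; rewrite /= ?bE -/a; lia.
have ttE : t * t = (k%:Z)%:~R + a%:~R * t + (mu%:Z)%:~R * s.
  have tt x : (t * t) (x * g ^+ 1) = (s * s) x := cyc_count gP L2 0 0 1 x.
  have st x : s x = t (x * g ^+ 1) by rewrite !indE (cyc_scale gP L2 x 0 1).
  have ts x : t x = s (x * g ^+ 1).
    by rewrite !indE -(cyc_scale gP L2 x 1 1) (@cyc_mod _ g 2 (1 + 1) 0).
  apply/ffunP=> x; have g0 := genX_neq0 gP 1.
  have -> : x = x / g ^+ 1 * g ^+ 1 by rewrite divfK.
  move: (x / g ^+ 1) => y; have yg : (y * g ^+ 1 == 0) = (y == 0).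
    by rewrite mulf_eq0 (negPf g0) orbF.
  by rewrite tt ssE !galgD !galgZ !galg_int -st -ts yg.
have JM A : ind setT * ind A = _ := @indTM F A.
have Js : ind setT * s = (k%:Z)%:~R * ind setT :> galg int F by rewrite JM.
have Jt : ind setT * t = (k%:Z)%:~R * ind setT :> galg int F by rewrite JM k1.
have E1 : (a%:~R - (mu%:Z)%:~R) * (s - t) = - (s - t).
  have E : s * s - t * t = (ind setT - 1) * (s - t) by rewrite setT_cyc2; ring.
  by rewrite mulrBl mulrBr Js Jt subrr sub0r mul1r ssE ttE in E; rewrite -E; ring.
have aE : a - mu%:Z = -1.
  move/(congr1 (fun f : galg int F => f (g ^+ 0))): E1.
  rewrite -rmorphB /= galgZ !galgN !galgD !galgN !ind_cyc_gen //=; lia.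
have cE : k%:Z * k%:Z = k%:Z + a * k%:Z + mu%:Z * k%:Z.
  have E : ind setT * (s * s) = ((k%:Z) * k%:Z)%:~R * ind setT :> galg int F.
    by rewrite mulrA Js -mulrA Js mulrA -rmorphM.
  move: E; rewrite ssE !mulrDr [_ * (a%:~R * _)]mulrCA [_ * (mu%:Z%:~R * _)]mulrCA Js Jt.
  move/(congr1 (fun f : galg int F => f 0)).
  rewrite !galgD -!rmorphM /= mulrC !mulrA -!rmorphM /= !galgZ !indE !inE; lia.
have k0 : (0 < k)%N by have := prim_order_gt0 gP; lia.
have kE : k = (2 * mu)%N by nia.
exists mu; split => //; rewrite ?k1 //; first by have := prim_order_gt0 gP; lia.
- by rewrite ssE kE (_ : a = mu%:Z - 1) //; lia.
- by rewrite ttE kE (_ : a = mu%:Z - 1); [rewrite addrAC | lia].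
Qed.

End Quadratic.

Section Cubic.
Hypothesis L3 : (3 %| L)%N.
Local Notation u i := (ind (cyc g 3 i) : galg int F).

Lemma cyc3_N1 : -1 \in cyc g 3 0.
Proof.
rewrite (cyc0P gP L3) oppr_eq0 oner_eq0; apply/existsP; exists (-1).
by rewrite -signr_odd expr1.
Qed.

Lemma in_cyc3 r x i : x \in cyc g 3 r -> (x \in cyc g 3 i) = (r == i %[mod 3]).
Proof. by rewrite !inE => /andP[-> /eqP ->]. Qed.

Lemma setT_cyc3 : ind setT = 1 + u 0 + u 1 + u 2 :> galg int F.
Proof.
apply: (galg_eq_cyc L3) => [|r x r2 xr].
  by rewrite !galgD galg1 !ind_cyc_0 indE inE eqxx.
have x0 : x != 0 by move: xr; rewrite inE => /andP[].
rewrite !galgD galg1 (negPf x0) !indE inE !(in_cyc3 _ xr).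
by case: r r2 {xr} => [|[|[|]]].
Qed.

Lemma cyc3_prod i j (e : int) : (u i * u j) 0 = e ->
  u i * u j = e%:~R + ((u i * u j) (g ^+ 0))%:~R * u 0
    + ((u i * u j) (g ^+ 1))%:~R * u 1 + ((u i * u j) (g ^+ 2))%:~R * u 2.
Proof.
move=> eE; apply: (galg_eq_cyc L3) => [|r x r2 xr].
  by rewrite eE !galgD !galgZ galg_int !ind_cyc_0 eqxx; lia.
have x0 : x != 0 by move: xr; rewrite inE => /andP[].
rewrite (cyc_const _ _ L3 xr) !galgD !galgZ galg_int (negPf x0) !indE !(in_cyc3 _ xr).
by case: r r2 {xr} => [|[|[|]]] //= _; lia.
Qed.

Lemma cyc3_shift i j k l m (e a b c : int) :
  u i * u j = e%:~R + a%:~R * u k + b%:~R * u l + c%:~R * u m ->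
  u (i + 1)%N * u (j + 1)%N = e%:~R + a%:~R * u (k + 1)%N + b%:~R * u (l + 1)%N
    + c%:~R * u (m + 1)%N.
Proof.
move=> E; apply/ffunP=> x; have g0 := genX_neq0 gP 1.
have -> : x = x / g ^+ 1 * g ^+ 1 by rewrite divfK.
move: (x / g ^+ 1) => y; have yg : (y * g ^+ 1 == 0) = (y == 0).
  by rewrite mulf_eq0 (negPf g0) orbF.
rewrite (cyc_count gP L3 i j 1) E !galgD !galgZ !galg_int yg.
by rewrite !indE !(cyc_scale gP L3).
Qed.

(* D - 1, B and C are the cyclotomic numbers (0,0), (0,1) and (0,2) of order 3; the quadratic
   relation between B, C and D is associativity of u 0 * u 0 * u 1. *)
Lemma cubic_numbers : exists f B C D : nat,
  [/\ #|F| = (3 * f + 1)%N, forall i, #|cyc g 3 i| = f, f = (B + C + D)%N,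
     (D + D * (B + C) + B * C = B ^ 2 + C ^ 2 + D ^ 2)%N
   & [/\ u 0 * u 0 = f%:Z%:~R + (D%:Z - 1)%:~R * u 0 + B%:Z%:~R * u 1 + C%:Z%:~R * u 2,
         u 1 * u 1 = f%:Z%:~R + (D%:Z - 1)%:~R * u 1 + B%:Z%:~R * u 2 + C%:Z%:~R * u 0,
         u 2 * u 2 = f%:Z%:~R + (D%:Z - 1)%:~R * u 2 + B%:Z%:~R * u 0 + C%:Z%:~R * u 1,
         u 0 * u 1 = B%:Z%:~R * u 0 + C%:Z%:~R * u 1 + D%:Z%:~R * u 2
       & u 1 * u 2 = B%:Z%:~R * u 1 + C%:Z%:~R * u 2 + D%:Z%:~R * u 0 /\
         u 2 * u 0 = B%:Z%:~R * u 2 + C%:Z%:~R * u 0 + D%:Z%:~R * u 1]].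
Proof.
have N1 := cyc3_N1; set f := #|cyc g 3 0|.
have fE i : #|cyc g 3 i| = f by have := card_cyc gP L3 i; have := card_cyc gP L3 0; lia.
have u3 : u 3 = u 0 by rewrite (@cyc_mod _ g 3 3 0).
pose M i j k := #|[set z in cyc g 3 i | g ^+ k - z \in cyc g 3 j]|.
have ME i j k : (u i * u j) (g ^+ k) = (M i j k)%:Z by rewrite indM natz.
have := cyc3_prod (cyc_prod_at0 0 L3 N1); rewrite !ME fE.
set A := M 0 0 0%N; set B := M 0 0 1%N; set C := M 0 0 2%N => E00.
have E11 : u 1 * u 1 = f%:Z%:~R + A%:Z%:~R * u 1 + B%:Z%:~R * u 2 + C%:Z%:~R * u 0.
  by rewrite -u3; exact: (cyc3_shift E00).
have E22 : u 2 * u 2 = f%:Z%:~R + A%:Z%:~R * u 2 + B%:Z%:~R * u 0 + C%:Z%:~R * u 1.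
  by have := cyc3_shift E11; rewrite !addn1 u3.
have n01 : 0 <> 1 %[mod 3] by [].
have := cyc3_prod (cyc_prod_at0_neq L3 N1 n01); rewrite !ME.
set al := M 0%N 1%N 0%N; set be := M 0%N 1%N 1%N; set D := M 0%N 1%N 2 => E01.
have E12 : u 1 * u 2 = 0%:~R + al%:Z%:~R * u 1 + be%:Z%:~R * u 2 + D%:Z%:~R * u 0.
  by have := cyc3_shift E01; rewrite !addn1 u3.
have E20 : u 2 * u 0 = 0%:~R + al%:Z%:~R * u 2 + be%:Z%:~R * u 0 + D%:Z%:~R * u 1.
  by have := cyc3_shift E12; rewrite !addn1 u3.
have f0 : (0 < f)%N by have := card_cyc gP L3 0; have := prim_order_gt0 gP; rewrite -/f; lia.
have uu0 i : (u i * u i) 0 = f%:Z by rewrite cyc_prod_at0 ?fE.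
have uv0 i j : i <> j %[mod 3] -> (u i * u j) 0 = 0 by apply: cyc_prod_at0_neq.
have ev x (f1 f2 : galg int F) : f1 = f2 -> f1 x = f2 x by move=> ->.
(* Associativity is read at 0 first: there [u i * u j] is [f] for equal classes and 0 otherwise, so
   only two terms survive, and [f] cancels. *)
have alB : al = B.
  have : al%:Z%:~R * (u 0 * u 0) + be%:Z%:~R * (u 0 * u 1) + D%:Z%:~R * (u 0 * u 2)
      = f%:Z%:~R * u 1 + A%:Z%:~R * (u 0 * u 1) + B%:Z%:~R * (u 1 * u 1)
      + C%:Z%:~R * (u 2 * u 1).
    by transitivity (u 0 * (u 0 * u 1)); [rewrite [in RHS]E01; ring|rewrite mulrA [in LHS]E00; ring].
  move/(ev 0); rewrite !galgD !galgZ !uu0 !uv0 // ind_cyc_0; nia.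
have beC : be = C.
  have : al%:Z%:~R * (u 0 * u 1) + be%:Z%:~R * (u 1 * u 1) + D%:Z%:~R * (u 1 * u 2)
      = f%:Z%:~R * u 0 + A%:Z%:~R * (u 0 * u 1) + B%:Z%:~R * (u 0 * u 2)
      + C%:Z%:~R * (u 0 * u 0).
    by transitivity (u 0 * u 1 * u 1); [rewrite [in RHS]E01; ring|rewrite -mulrA [in LHS]E11; ring].
  move/(ev 0); rewrite !galgD !galgZ !uu0 !uv0 // ind_cyc_0; nia.
rewrite alB beC {alB beC al be} in E01 E12 E20.
(* The row sums come from [u 0] times the all-one function: its values at [g ^+ 0] and [g ^+ 1] say
   that [A + B + C + 1 = f] and [B + C + D = f]. *)
have rowE : u 0 * u 0 + u 0 * u 1 + u 2 * u 0 + u 0 = f%:Z%:~R * ind setT.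
  by rewrite -indTM setT_cyc3; ring.
rewrite E00 E01 E20 in rowE.
have AE : A%:Z = D%:Z - 1.
  have := ev (g ^+ 0) _ _ rowE; have := ev (g ^+ 1) _ _ rowE.
  rewrite !galgD !galgZ !galg_int !ind_cyc_gen // !indE !inE !(negPf (genX_neq0 gP _)) /=; lia.
have fBCD : f = (B + C + D)%N.
  have := ev (g ^+ 1) _ _ rowE.
  rewrite !galgD !galgZ !galg_int !ind_cyc_gen // !indE !inE !(negPf (genX_neq0 gP _)) /=; lia.
have rel : (D + D * (B + C) + B * C = B ^ 2 + C ^ 2 + D ^ 2)%N.
  have : B%:Z%:~R * (u 0 * u 0) + C%:Z%:~R * (u 0 * u 1) + D%:Z%:~R * (u 2 * u 0)
      = f%:Z%:~R * u 1 + A%:Z%:~R * (u 0 * u 1) + B%:Z%:~R * (u 1 * u 1)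
      + C%:Z%:~R * (u 1 * u 2).
    by transitivity (u 0 * (u 0 * u 1)); [rewrite [in RHS]E01; ring|rewrite mulrA [in LHS]E00; ring].
  rewrite E00 E01 E20 E11 E12 => /(ev (g ^+ 1)).
  rewrite !galgD !galgZ !galgD !galgZ !galg_int !ind_cyc_gen // !(negPf (genX_neq0 gP _)) /= AE fBCD.
  nia.
exists f, B, C, D; split=> //.
  by have := card_cyc gP L3 0; have := prim_order_gt0 gP; rewrite -/f; lia.
by rewrite -AE; split=> //; [move: E01|move: E12 E20]; rewrite !add0r.
Qed.
End Cubic.
End CyclotomicNumbers.

(** * The form X^2 + 27 Y^2 and the primes t^2 + 3 and t^2 + 12 *)

Section CubicFormArithmetic.
Implicit Types (B C D t p : nat).

Definition cubic_rel B C D := (D + D * (B + C) + B * C = B ^ 2 + C ^ 2 + D ^ 2)%N.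

Lemma nat_sqr (z : int) : exists t, (t ^ 2)%N%:Z = z ^+ 2.
Proof. by exists `|z|%N; rewrite -[RHS]gez0_abs ?sqr_ge0 // abszX. Qed.

Lemma abs_le_sqr p (w : int) : (p <= `|w|)%N -> p%:Z ^+ 2 <= w ^+ 2.
Proof. by case: w => w /=; rewrite ?NegzE /=; nia. Qed.

Lemma cubic_relC B C D : cubic_rel B C D -> cubic_rel C B D.
Proof. by rewrite /cubic_rel [(C + B)%N]addnC [(C * B)%N]mulnC [(C ^ 2 + _)%N]addnC. Qed.

(** With [d = B - C] the relation collapses to [C = d ^+ 2], so that [B = d ^+ 2 + d] and the total
    is [(3 * d + 1) ^+ 2 + 3]. *)
Lemma cubic_rel_plus3 B C D : cubic_rel B C D -> D = B.+1 ->
  exists t, (3 * (B + C + D) + 1 = t ^ 2 + 3)%N.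
Proof.
rewrite /cubic_rel => rel DE; pose d : int := B%:Z - C%:Z.
have CE : C%:Z = d ^+ 2 by rewrite /d; nia.
have [t tE] := nat_sqr (3 * d + 1); exists t; rewrite /d in CE tE; nia.
Qed.

(** With [d = D - C] the relation collapses to [C = d ^+ 2 + 1], and the total is
    [(3 * d + 1) ^+ 2 + 12]. *)
Lemma cubic_rel_plus12 B C D : cubic_rel B C D -> B = D.+1 ->
  exists t, (3 * (B + C + D) + 1 = t ^ 2 + 12)%N.
Proof.
rewrite /cubic_rel => rel BE; pose d : int := D%:Z - C%:Z.
have CE : C%:Z = d ^+ 2 + 1 by rewrite /d; nia.
have [t tE] := nat_sqr (3 * d + 1); exists t; rewrite /d in CE tE; nia.
Qed.

(** This excludes the third coincidence: for a prime [p] the numbers [B] and [C] differ, since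
    otherwise [p = (3 * d - 1) ^+ 2] with [d = D - B]. *)
Lemma cubic_rel_square B C D : cubic_rel B C D -> B = C ->
  exists t, (3 * (B + C + D) + 1 = t ^ 2)%N.
Proof.
rewrite /cubic_rel => rel BC; pose d : int := D%:Z - B%:Z.
have DE : D%:Z = d ^+ 2 by rewrite /d; nia.
have [t tE] := nat_sqr (3 * d - 1); exists t; rewrite /d in DE tE; nia.
Qed.

Lemma square_not_prime t : ~~ prime (t ^ 2).
Proof.
apply/negP=> pr; have t1 := prime_gt1 pr; have /primeP[_ /(_ t)] := pr.
by rewrite -mulnn dvdn_mulr // => /(_ isT)/orP[]/eqP; nia.
Qed.

(* p divides (x y' - x' y) (x y' + x' y), and the multiplicativity of X^2 + 27 Y^2 makes a
   factor divisible by p vanish. *)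
Lemma prime_form27_uniq p (x y x' y' : int) : prime p ->
  x ^+ 2 + 27 * y ^+ 2 = 4 * p%:Z -> x' ^+ 2 + 27 * y' ^+ 2 = 4 * p%:Z ->
  y ^+ 2 = y' ^+ 2.
Proof.
move=> p_pr E E'; have p0 := prime_gt0 p_pr.
have key (z : int) : z ^+ 2 = y' ^+ 2 -> (p %| `|(x * z - x' * y)%R|)%N -> y ^+ 2 = y' ^+ 2.
  move=> zE dv; have xz : x * z = x' * y.
    apply/eqP; rewrite -subr_eq0; apply: contraLR isT => nz.
    have le : (p <= `|(x * z - x' * y)%R|)%N by apply: dvdn_leq => //; rewrite absz_gt0.
    have le2 : p%:Z ^+ 2 <= (x * z - x' * y) ^+ 2.
      exact: abs_le_sqr.
    have id : (x * x' + 27 * z * y) ^+ 2 + 27 * (x * z - x' * y) ^+ 2 = 16 * p%:Z ^+ 2.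
      transitivity ((x ^+ 2 + 27 * y ^+ 2) * (x' ^+ 2 + 27 * z ^+ 2)); first by ring.
      by rewrite zE E E'; ring.
    have := sqr_ge0 (x * x' + 27 * z * y); have : 0 < p%:Z ^+ 2 by rewrite exprn_gt0.
    move: id le2; move: ((x * x' + _) ^+ 2) ((x * z - _) ^+ 2) (p%:Z ^+ 2) => u v w.
    by clear; lia.
  have : z ^+ 2 * (4 * p%:Z) = y ^+ 2 * (4 * p%:Z).
    rewrite -{1}E -E' -zE; transitivity ((x * z) ^+ 2 + 27 * y ^+ 2 * z ^+ 2); first by ring.
    by rewrite xz; ring.
  by rewrite -zE; move/mulIf => -> //; lia.
have : (p %| `|(x * y' - x' * y)%R| * `|(x * y' + x' * y)%R|)%N.
  rewrite -abszM; have -> : (x * y' - x' * y) * (x * y' + x' * y) = 4 * p%:Z * (y' ^+ 2 - y ^+ 2).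
    transitivity (x ^+ 2 * y' ^+ 2 - x' ^+ 2 * y ^+ 2); first by ring.
    have -> : x ^+ 2 = 4 * p%:Z - 27 * y ^+ 2 by rewrite -E; ring.
    by have -> : x' ^+ 2 = 4 * p%:Z - 27 * y' ^+ 2 by [rewrite -E'; ring]; ring.
  by rewrite !abszM -mulnA dvdn_mull // dvdn_mulr.
rewrite Euclid_dvdM // => /orP[]; first exact: key.
move=> dv; apply: (key (- y')); first by rewrite sqrrN.
by rewrite mulrN -opprD abszN.
Qed.

(* 4 p = L^2 + 27 M^2 with L = 6 D - 3 (B + C) - 2 and M = C - B. *)
Lemma cubic_rel_form B C D : cubic_rel B C D ->
  (6 * D%:Z - 3 * (B%:Z + C%:Z) - 2) ^+ 2 + 27 * (C%:Z - B%:Z) ^+ 2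
  = 4 * (3 * (B + C + D) + 1)%N%:Z.
Proof. by rewrite /cubic_rel; nia. Qed.

Lemma sqr_eq_int (a b : int) : a ^+ 2 = b ^+ 2 -> a = b \/ a = - b.
Proof. by move/eqP; rewrite eqf_sqr => /orP[]/eqP; [left|right]. Qed.

(** As [p] is 1 modulo 3, [t] is prime to 3, and the sign of the root is chosen so that it becomes 1
    modulo 3. *)
Lemma sqrt1_mod3 p t a : (p = t ^ 2 + 3 * a)%N -> (3 %| p.-1)%N -> (0 < p)%N ->
  exists d : int, (t%:Z) ^+ 2 = (3 * d + 1) ^+ 2.
Proof.
move=> pt p3 p0; have t3 : (t %% 3 = 0 \/ t %% 3 = 1 \/ t %% 3 = 2)%N.
  by have := ltn_pmod t (isT : 0 < 3)%N; lia.
have tE := divn_eq t 3; case: t3 => [|[]] r; rewrite r in tE.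
- by case/dvdnP: p3 => q; move: tE pt p0; move: (t %/ 3)%N => w -> ; nia.
- by exists (t %/ 3)%N%:Z; rewrite {1}tE; nia.
- by exists (- (t %/ 3)%N%:Z - 1); rewrite {1}tE; nia.
Qed.

(** [t] supplies the representation that [cubic_rel_form] would give for [C = d ^+ 2],
    [B = d ^+ 2 + d] and [D = B.+1]. By uniqueness its squares are those of the actual [B], [C],
    [D]. Both first coordinates are 1 modulo 3, which fixes that sign; the free sign of [C - B]
    accounts for the two conclusions. *)
Lemma plus3_cubic_rel B C D p t : prime p -> (p = 3 * (B + C + D) + 1)%N ->
  cubic_rel B C D -> (p = t ^ 2 + 3)%N -> D = B.+1 \/ D = C.+1.
Proof.
move=> p_pr pE rel pt; have form := cubic_rel_form rel; rewrite -pE in form.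
have [||d dE] := @sqrt1_mod3 p t 1 pt; [by rewrite pE addn1 dvdn_mulr|exact: prime_gt0|].
have form' : (3 * d + 4) ^+ 2 + 27 * d ^+ 2 = 4 * p%:Z.
  by rewrite pt; clear -dE; lia.
have yE := prime_form27_uniq p_pr form form'; rewrite yE -form' in form.
have /sqr_eq_int xE := addIr _ form.
by case/sqr_eq_int: yE => yE; case: xE => xE; clear -xE yE; lia.
Qed.

(** As for [t ^ 2 + 3], with the representation belonging to [D = d ^+ 2 + d + 1], [B = D.+1] and
    [C = d ^+ 2 + 1]. *)
Lemma plus12_cubic_rel B C D p t : prime p -> (p = 3 * (B + C + D) + 1)%N ->
  cubic_rel B C D -> (p = t ^ 2 + 12)%N -> B = D.+1 \/ C = D.+1.
Proof.
move=> p_pr pE rel pt; have form := cubic_rel_form rel; rewrite -pE in form.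
have [||d dE] := @sqrt1_mod3 p t 4 pt; [by rewrite pE addn1 dvdn_mulr|exact: prime_gt0|].
have form' : (3 * d - 5) ^+ 2 + 27 * (d + 1) ^+ 2 = 4 * p%:Z.
  by rewrite pt; clear -dE; lia.
have yE := prime_form27_uniq p_pr form form'; rewrite yE -form' in form.
have /sqr_eq_int xE := addIr _ form.
by case/sqr_eq_int: yE => yE; case: xE => xE; clear -xE yE; lia.
Qed.
End CubicFormArithmetic.

(** * S-rings on subgroups and quotients *)

Section SubAndQuotient.
Variables (n : nat) (n_gt1 : (1 < n)%N) (C : eqType) (c : 'Z_n -> C) (Sc : Sring c).

(** One map for both directions: for [l] dividing [k] it is the reduction homomorphism, and for [k]
    dividing [l] a section of it through least representatives. *)
Definition Zred k l (x : 'Z_k) : 'Z_l := (x : nat)%:R.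

Lemma Zred_nat k l a : (1 < k)%N -> (1 < l)%N -> (l %| k)%N -> Zred l (a%:R : 'Z_k) = a%:R.
Proof.
move=> k1 l1 lk; rewrite /Zred Zn_val //; apply/eqP; rewrite Zn_eq //.
by rewrite modn_dvdm.
Qed.

Lemma ZredD k l (x y : 'Z_k) : (1 < k)%N -> (1 < l)%N -> (l %| k)%N ->
  Zred l (x + y) = Zred l x + Zred l y.
Proof.
by move=> k1 l1 lk; rewrite [x]Zn_natE [y]Zn_natE -natrD !Zred_nat // natrD.
Qed.

Lemma ZredN k l (x : 'Z_k) : (1 < k)%N -> (1 < l)%N -> (l %| k)%N ->
  Zred l (- x) = - Zred l x.
Proof.
move=> k1 l1 lk; apply/eqP; rewrite -addr_eq0 -ZredD // addNr.
by rewrite -[0 : 'Z_k]/(0%:R) Zred_nat.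
Qed.

Lemma Zred_lift k l (x : 'Z_l) : (1 < k)%N -> (1 < l)%N -> (l %| k)%N ->
  Zred l (Zred k x) = x.
Proof. by move=> k1 l1 lk; rewrite {2}/Zred Zred_nat // -Zn_natE. Qed.

Lemma Zred_eq0 l (x : 'Z_n) : (1 < l)%N -> (l %| n)%N ->
  (Zred l x == 0) = (x \in multiples n l).
Proof. by move=> l1 ln; rewrite /Zred Zn_eq0 // inE. Qed.

Section Subgroup.
Variables (u m : nat) (u_gt1 : (1 < u)%N) (nE : n = (m * u)%N).
Hypothesis cU : cset c (multiples n m).

(* The isomorphism of Z_u onto the subgroup of multiples of m. *)
Definition subZ (x : 'Z_u) : 'Z_n := (m * x)%:R.

Lemma subZ_nat a : subZ a%:R = (m * a)%:R.
Proof.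
by rewrite /subZ Zn_val //; apply/eqP; rewrite Zn_eq // nE -!muln_modr modn_mod.
Qed.

Lemma subZD x y : subZ (x + y) = subZ x + subZ y.
Proof. by rewrite [x]Zn_natE [y]Zn_natE -natrD !subZ_nat mulnDr natrD. Qed.

Lemma subZN x : subZ (- x) = - subZ x.
Proof.
apply/eqP; rewrite -addr_eq0 -subZD addNr -[0 : 'Z_u]/(0%:R) subZ_nat muln0.
by rewrite eqxx.
Qed.

Lemma m_gt0 : (0 < m)%N.
Proof. by have := n_gt0 n_gt1; rewrite [X in (_ < X)%N]nE; case: m. Qed.

Lemma subZ_inj : injective subZ.
Proof.
move=> x y /eqP; rewrite /subZ Zn_eq // nE -!muln_modr !eqn_pmul2l ?m_gt0 //.
by rewrite !modn_small ?Zn_lt // => /eqP xy; exact: val_inj.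
Qed.

Lemma subZK (x : 'Z_u) : ((subZ x : nat) %/ m)%:R = x.
Proof.
rewrite /subZ Zn_val // nE -muln_modr mulKn ?m_gt0 //.
by rewrite modn_small ?Zn_lt // -Zn_natE.
Qed.

Lemma subZ_mem x : subZ x \in multiples n m.
Proof. by rewrite mem_multiples ?dvdn_mulr // nE dvdn_mulr. Qed.

Lemma subZ_surj y : y \in multiples n m -> exists x, y = subZ x.
Proof.
rewrite inE => my; exists ((y %/ m)%:R); rewrite subZ_nat mulnC divnK //.
exact: Zn_natE.
Qed.

Definition galg_sub (f : galg int 'Z_u) : galg int 'Z_n :=
  [ffun y : 'Z_n => if y \in multiples n m then f ((y %/ m)%:R) else 0].

Lemma galg_subE f x : galg_sub f (subZ x) = f x.
Proof. by rewrite ffunE subZ_mem subZK. Qed.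

Lemma galg_sub_out f y : y \notin multiples n m -> galg_sub f y = 0.
Proof. by move/negPf=> yU; rewrite ffunE yU. Qed.

Lemma galg_subM f g : galg_sub (f * g) = galg_sub f * galg_sub g.
Proof.
apply/ffunP=> y; case: (boolP (y \in multiples n m)) => [/subZ_surj[x ->]|yU].
  rewrite galg_subE !galgM [RHS](bigID (fun z => z \in multiples n m)) /=.
  rewrite [X in _ = _ + X]big1 ?addr0; last by move=> z zU; rewrite galg_sub_out ?mul0r.
  rewrite [RHS](reindex_onto subZ (fun y : 'Z_n => (y %/ m)%:R)) /=; last first.
    by move=> z /subZ_surj[w ->]; rewrite subZK.
  apply: eq_big => z; last by rewrite -subZN -subZD !galg_subE.
  by rewrite subZ_mem subZK eqxx.
have sU : is_subgroup (multiples n m) by apply: multiples_subg; rewrite // nE dvdn_mulr.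
rewrite galg_sub_out // galgM big1 // => z _.
case: (boolP (z \in multiples n m)) => zU; last by rewrite galg_sub_out ?mul0r.
by rewrite [X in _ * X]galg_sub_out ?mulr0 // (subgDr _ sU) // subgN.
Qed.

Lemma galg_subD f g : galg_sub (f + g) = galg_sub f + galg_sub g.
Proof.
by apply/ffunP=> y; rewrite galgD !ffunE; case: ifP => _; rewrite ?galgD ?addr0.
Qed.

Lemma galg_subZ a f : galg_sub (a%:~R * f) = a%:~R * galg_sub f.
Proof.
apply/ffunP=> y; rewrite galgZ; case: (boolP (y \in multiples n m)) => [/subZ_surj[x ->]|yU].
  by rewrite !galg_subE galgZ.
by rewrite !galg_sub_out // mulr0.
Qed.

Lemma subZ0 : subZ 0 = 0.
Proof. by rewrite /subZ muln0. Qed.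

Lemma galg_sub1 : galg_sub 1 = 1.
Proof.
apply/ffunP=> y; rewrite galg1; case: (boolP (y \in multiples n m)) => [/subZ_surj[x ->]|yU].
  by rewrite galg_subE galg1 -subZ0 (inj_eq subZ_inj).
by rewrite galg_sub_out //; case: eqP => // y0; rewrite y0 inE dvdn0 in yU.
Qed.

Lemma galg_sub_ind A : galg_sub (ind A) = ind [set subZ x | x in A].
Proof.
apply/ffunP=> y; rewrite indE; case: (boolP (y \in multiples n m)) => [/subZ_surj[x ->]|yU].
  by rewrite galg_subE indE (mem_imset _ _ subZ_inj).
rewrite galg_sub_out //; case: imsetP => // -[x _ yx].
by rewrite yx subZ_mem in yU.
Qed.

(** Extension by zero embeds the group ring of the subgroup, and it sends colour functions to colour
    functions because the subgroup is a union of colours. *)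
Lemma Sring_sub : Sring (c \o subZ).
Proof.
split.
- move=> x y; rewrite !inE => xy; case: Sc => c0 _ _.
  by have := c0 _ _ xy; rewrite !inE -subZ0 !(inj_eq subZ_inj).
- by move=> x y xy; rewrite /= !subZN; case: Sc => _ cN _; exact: cN.
move=> f g cf cg.
have ext_c (h : galg int 'Z_u) : cconst (c \o subZ) h -> cconst c (galg_sub h).
  move=> ch y y' yy'; have := cU yy'; case yU: (y \in _) => /esym y'U; last first.
    by rewrite !galg_sub_out ?yU ?y'U.
  have [x yE] := subZ_surj yU; have [x' yE'] := subZ_surj y'U.
  by rewrite yE yE' !galg_subE; apply: ch; rewrite /= -yE -yE'.
move=> x y xy; rewrite -!galg_subE galg_subM; case: Sc => _ _ cM.
by apply: (cM _ _ (ext_c f cf) (ext_c g cg)).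
Qed.

End Subgroup.

Section Quotient.
Variables (m : nat) (m_gt1 : (1 < m)%N) (mn : (m %| n)%N).
Hypothesis cH : cset c (multiples n m).
Hypothesis cinv : forall x g, x \notin multiples n m -> g \in multiples n m -> c (x + g) = c x.
Local Notation pr := (@Zred n m).
Local Notation lift := (@Zred m n).

Lemma lift_class x : x \notin multiples n m -> c (lift (pr x)) = c x.
Proof.
move=> xH; rewrite -(@cinv x (lift (pr x) - x)) //; first by rewrite addrC subrK.
rewrite -Zred_eq0 // ZredD // ZredN // Zred_lift // subrr eqxx; exact: isT.
Qed.

Lemma lift_mem x : (lift x \in multiples n m) = (x == 0).
Proof. by rewrite -Zred_eq0 // Zred_lift. Qed.

Definition galg_quo (f : galg int 'Z_m) : galg int 'Z_n := [ffun y : 'Z_n => f (pr y)].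

Lemma galg_quoE f y : galg_quo f y = f (pr y). Proof. exact: ffunE. Qed.

(** Every term of the convolution on the quotient lifts to [#|H|] terms, one for each element of a
    coset. *)
Lemma galg_quoM f g :
  galg_quo f * galg_quo g = (#|multiples n m|%:Z)%:~R * galg_quo (f * g).
Proof.
apply/ffunP=> x; rewrite galgZ galg_quoE !galgM (partition_big pr predT) //= mulr_sumr.
apply: eq_bigr => z _.
rewrite -natz -sum1_card natr_sum mulr_suml (reindex (fun w => w + lift z)) /=; last first.
  by exists (fun w => w - lift z) => w _; rewrite ?addrK ?subrK.
apply: eq_big => w.
  by rewrite ZredD // Zred_lift // -subr_eq0 addrK Zred_eq0.
by move/eqP=> wz; rewrite !galg_quoE wz ZredD // ZredN // wz mul1r.
Qed.

Lemma galg_quoD f g : galg_quo (f + g) = galg_quo f + galg_quo g.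
Proof. by apply/ffunP=> y; rewrite galgD !galg_quoE galgD. Qed.

Lemma galg_quoZ a f : galg_quo (a%:~R * f) = a%:~R * galg_quo f.
Proof. by apply/ffunP=> y; rewrite galgZ !galg_quoE galgZ. Qed.

Lemma galg_quo1 : galg_quo 1 = ind (multiples n m).
Proof. by apply/ffunP=> y; rewrite galg_quoE galg1 indE Zred_eq0. Qed.

Lemma galg_quo_ind A : galg_quo (ind A) = ind [set y | pr y \in A].
Proof. by apply/ffunP=> y; rewrite galg_quoE !indE inE. Qed.

(** By [cinv] the pullback of a colour function is a colour function. Its convolutions are pullbacks
    up to the factor [#|H|], which cancels over [int]. *)
Lemma Sring_quotient : Sring (c \o lift).
Proof.
have cx0 : forall x y, c (lift x) = c (lift y) -> (x == 0) = (y == 0).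
  by move=> x y xy; rewrite -!lift_mem (cH xy).
split.
- by move=> x y xy; rewrite !inE; apply: cx0.
- move=> x y xy /=; have [x0|x0] := boolP (x == 0).
    by have := cx0 _ _ xy; rewrite x0 => /esym/eqP ->; rewrite (eqP x0).
  have y0 : y != 0 by rewrite -(cx0 _ _ xy).
  case: Sc => _ cN _; have := cN _ _ xy.
  have E z : z != 0 -> c (- lift z) = c (lift (- z)).
    move=> z0; have prE : pr (- lift z) = - z by rewrite (@ZredN n m) // Zred_lift.
    by rewrite -prE lift_class // subgN ?lift_mem //; exact: multiples_subg.
  by rewrite !E.
move=> f g cf cg.
have ext_c (h : galg int 'Z_m) : cconst (c \o lift) h -> cconst c (galg_quo h).
  move=> ch y y' yy'; rewrite !galg_quoE; apply: ch => /=.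
  have := cH yy'; case yU: (y \in _) => /esym y'U; last first.
    by rewrite !lift_class ?yU ?y'U.
  by rewrite -Zred_eq0 // in yU; rewrite -Zred_eq0 // in y'U; rewrite (eqP yU) (eqP y'U).
case: Sc => _ _ cM x y xy; have := cM _ _ (ext_c f cf) (ext_c g cg) _ _ xy.
have h0 : (0 < #|multiples n m|)%N.
  by rewrite card_gt0; apply/set0Pn; exists 0; rewrite inE dvdn0.
rewrite galg_quoM !galgZ !galg_quoE !Zred_lift // => /mulfI; apply.
by case: #|_| h0.
Qed.

End Quotient.
End SubAndQuotient.
Arguments subZ n u m x : clear implicits.
Arguments galg_sub n u m f : clear implicits.
Arguments galg_quo n m f : clear implicits.
Arguments Zred {k} l x.

(** * Colourings of a finite field that are permuted by multiplication *)

Section PrimeColours.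
Variables (F : finFieldType) (g : F).
Local Notation L := (#|F|.-1).
Variables (gP : L.-primitive_root g) (C : eqType) (c : F -> C).
Hypothesis cmul : forall u x y, u != 0 -> c x = c y -> c (x * u) = c (y * u).

Lemma cmulI u x y : u != 0 -> c (x * u) = c (y * u) -> c x = c y.
Proof.
by move=> u0 /(cmul (_ : u^-1 != 0)); rewrite !mulfK ?invr_eq0 //; apply.
Qed.

Let K := [set x | (x != 0) && (c x == c 1)].

Lemma card_colour u : u != 0 -> #|[set x | (x != 0) && (c x == c u)]| = #|K|.
Proof.
move=> u0; rewrite -(card_imset (mem K) (mulIf u0)); apply: eq_card => x.
apply/idP/imsetP; rewrite inE.
  move=> /andP[x0 /eqP xu]; exists (x / u); last by rewrite divfK.
  rewrite inE mulf_neq0 ?invr_eq0 //=; apply/eqP/(@cmulI u) => //.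
  by rewrite mul1r divfK.
case=> y; rewrite inE => /andP[y0 /eqP /(cmul u0) yE] ->.
by rewrite mulf_neq0 // yE mul1r eqxx.
Qed.

(** The colour class [K] of 1 contains the group of [d]-th powers and has the same number of
    elements, so it equals that group; two nonzero elements share a colour when their quotient is in
    [K]. *)
Lemma colour_powers d : (d * #|K| = L)%N -> (forall x, x != 0 -> c (x ^+ d) = c 1) ->
  (d %| L)%N /\ forall x y, x != 0 -> y != 0 -> (c x == c y) = (lg g x == lg g y %[mod d]).
Proof.
move=> dK cd; have dL : (d %| L)%N by rewrite -dK dvdn_mulr.
split=> // x y x0 y0.
have KE : K = cyc g d 0.
  apply/eqP; rewrite eq_sym eqEcard; apply/andP; split.
    apply/subsetP=> z; rewrite (cyc0P gP dL) inE => /andP[z0 /existsP[w /eqP wz]].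
    rewrite z0 -wz cd ?eqxx //; apply: contraNneq z0 => w0; rewrite -wz w0 expr0n.
    by case: (d) dL => // ; rewrite dvd0n => /eqP L0; have := prim_order_gt0 gP; rewrite L0.
  have d0 : (0 < d)%N by apply: dvdn_gt0 dL; exact: prim_order_gt0 gP.
  by rewrite -(leq_pmul2l d0) dK (card_cyc gP dL).
have -> : (c x == c y) = (x / y \in K).
  rewrite inE mulf_neq0 ?invr_eq0 //=; apply/eqP/eqP => [/(cmul (_ : y^-1 != 0))|E].
    by rewrite divff // invr_eq0 => ->.
  by apply: (@cmulI y^-1); rewrite ?invr_eq0 // divff.
have := cyc_scale gP dL (x / y) 0 (lg g y); rewrite KE => <-.
by rewrite lgK // divfK // add0n inE x0.
Qed.

(** If [x] does not have the colour of 1, then multiplication by [x] moves both colours, and so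
    brings [x] to the colour of 1: squares have the colour of 1. *)
Lemma two_colours x1 x2 : x1 != 0 -> x2 != 0 -> c x1 != c x2 ->
  (forall x, x != 0 -> c x = c x1 \/ c x = c x2) ->
  (2 %| L)%N /\ forall x y, x != 0 -> y != 0 -> (c x == c y) = (lg g x == lg g y %[mod 2]).
Proof.
move=> x10 x20 n12 all2; apply: colour_powers => [|x x0].
  rewrite mul2n -addnn -{1}(card_colour x10) -(card_colour x20) -cardsUI.
  rewrite [X in (_ + X)%N](_ : _ = 0%N) ?addn0.
    rewrite card_predF; apply: eq_card => x; rewrite !inE -andb_orr.
    by case: eqP => //= /eqP /all2[] ->; rewrite eqxx ?orbT.
  apply/eqP; rewrite cards_eq0; apply/eqP/setP=> x; rewrite !inE.
  apply/negP=> /andP[/andP[_ /eqP ->] /andP[_]]; exact/negP.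
have [E|n] := eqVneq (c x) (c 1); first by rewrite expr2 -E -[in RHS](mul1r x); apply: cmul.
have n2 : c (x ^+ 2) <> c x.
  by rewrite expr2 -[in RHS](mul1r x) => /(cmulI x0) E; rewrite E eqxx in n.
have x20' := expf_neq0 2 x0; have o0 := oner_neq0 F.
case: (all2 x x0) => Ex; case: (all2 1 o0) => E1; case: (all2 _ x20') => E2 //;
  by [rewrite E1 E2|case: n2; rewrite Ex E2|rewrite Ex E1 eqxx in n].
Qed.

(** Cubes have the colour of 1: an [x] of another colour has its square in the third colour and its
    cube back in that of 1, every other possibility being excluded by cancellation. *)
Lemma three_colours x1 x2 x3 : x1 != 0 -> x2 != 0 -> x3 != 0 ->
  c x1 != c x2 -> c x1 != c x3 -> c x2 != c x3 ->
  (forall x, x != 0 -> [\/ c x = c x1, c x = c x2 | c x = c x3]) ->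
  (3 %| L)%N /\ forall x y, x != 0 -> y != 0 -> (c x == c y) = (lg g x == lg g y %[mod 3]).
Proof.
move=> x10 x20 x30 n12 n13 n23 all3; apply: colour_powers => [|x x0].
  have -> : (3 * #|K| = #|K| + #|K| + #|K|)%N by lia.
  rewrite -{1}(card_colour x10) -{1}(card_colour x20) -(card_colour x30).
  rewrite -cardsUI [X in (_ + X + _)%N](_ : _ = 0%N) ?addn0; last first.
    apply/eqP; rewrite cards_eq0; apply/eqP/setP=> x; rewrite !inE.
    by apply/negP=> /andP[/andP[_ /eqP ->] /andP[_]]; exact/negP.
  rewrite -cardsUI [X in (_ + X)%N](_ : _ = 0%N) ?addn0; last first.
    apply/eqP; rewrite cards_eq0; apply/eqP/setP=> x; rewrite !inE -andb_orr.
    by apply/negP=> /andP[/andP[_ /orP[]/eqP ->] /andP[_]]; exact/negP.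
  rewrite card_predF; apply: eq_card => x; rewrite !inE -!andb_orr.
  by case: eqP => //= /eqP /all3[] ->; rewrite eqxx ?orbT.
have o0 := oner_neq0 F.
have [E|n] := eqVneq (c x) (c 1).
  have x2E : c (x * x) = c 1 by rewrite -[RHS]E -[in RHS](mul1r x); apply: cmul.
  by rewrite !exprS expr0 mulr1 mulrA -[RHS]E -[in RHS](mul1r x); apply: cmul.
(* The colours are renamed after 1, [x] and a representative [y] of the remaining one, so that a
   single case is left. *)
have [y [y0 y1 yx all]] : exists y, [/\ y != 0, c y <> c 1, c y <> c x &
    forall z, z != 0 -> [\/ c z = c 1, c z = c x | c z = c y]].
  move/eqP: n12 => n12; move/eqP: n13 => n13; move/eqP: n23 => n23.
  have [n21 n31 n32] : [/\ c x2 <> c x1, c x3 <> c x1 & c x3 <> c x2].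
    by split; apply: nesym.
  have third y : y != 0 -> c y <> c 1 -> c y <> c x ->
     (forall z, z != 0 -> [\/ c z = c 1, c z = c x | c z = c y]) ->
     exists y, [/\ y != 0, c y <> c 1, c y <> c x &
        forall z, z != 0 -> [\/ c z = c 1, c z = c x | c z = c y]].
    by move=> *; exists y.
  case: (all3 x x0) => Ex; case: (all3 1 o0) => E1; rewrite ?Ex ?E1 ?eqxx // in n third *;
    by [apply: (third x1) => // z /all3[] ->; by [constructor 1|constructor 2|constructor 3]
       |apply: (third x2) => // z /all3[] ->; by [constructor 1|constructor 2|constructor 3]
       |apply: (third x3) => // z /all3[] ->; by [constructor 1|constructor 2|constructor 3]].
have n1 : c x <> c 1 by apply/eqP.
have c1 z w : z != 0 -> c (z * w) = c w -> w != 0 -> c z = c 1.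
  by move=> z0 E w0; apply: (cmulI w0); rewrite mul1r.
have xx : c (x * x) = c y.
  case: (all (x * x)) => //; rewrite ?mulf_neq0 //; last by move/c1 => E; case: n1; apply: E.
  move=> E2; case: (all (x * y)); rewrite ?mulf_neq0 // => E.
  - by case: yx; apply: (cmulI x0); rewrite E2 mulrC.
  - by case: y1; apply: (@c1 y x) => //; rewrite mulrC.
  - by case: n1; apply: (@c1 x y).
rewrite !exprS expr0 mulr1; case: (all (x * (x * x))); rewrite ?mulf_neq0 // => E.
- by case: y1; rewrite -xx; apply: (@c1 _ x); rewrite ?mulf_neq0 // mulrC.
- by case: n1; apply: (@c1 x (x * x)); rewrite ?mulf_neq0 // xx.
Qed.

End PrimeColours.

(** The numerical end of [index_eq_prime]: [n = k * p * h], [a] is the size of the colour, [d] that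
    of its part off the multiples of [k], and [t] its count in a coset. The equations give
    [a = (k * p - 1) * t] and [d = (k * p - p) * t], so [d] exceeds half of [a] as [k > 1]; then
    [a + h.-1 * d] is larger than [a * h / 2], an upper bound for [a * t]. *)
Lemma index_arith (p k h a d t : nat) : (1 < p -> 2 * t <= h -> 0 < a -> 1 < k -> 1 < h ->
  a * h = (k * p * h - h) * t -> d * h = (k * p * h - p * h) * t ->
  a + h.-1 * d <= a * t -> False)%N.
Proof.
move=> p1 tle a0 k1 h1 E1 E2 E3; have h0 : (0 < h)%N by exact: ltnW.
have aE : (a = (k * p - 1) * t)%N.
  by apply/eqP; rewrite -(eqn_pmul2r h0) E1 [eqbRHS]mulnAC [((k * p - 1) * h)%N]mulnBl mul1n.
have dE : (d = (k * p - p) * t)%N.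
  by apply/eqP; rewrite -(eqn_pmul2r h0) E2 [eqbRHS]mulnAC [((k * p - p) * h)%N]mulnBl.
have t0 : (0 < t)%N by case: (t) aE a0 => //; rewrite muln0 => ->.
have N2 : (2 * p <= k * p)%N by rewrite leq_mul2r k1 orbT.
have [r rE] : exists r, (k * p = p + r /\ p <= r)%N by exists (k * p - p)%N; lia.
case: rE => rE pr; rewrite rE in aE dE.
have dE' : d = (r * t)%N by rewrite dE addKn.
have [N NE] : exists N, (p + r = N.+1)%N by exists (p + r).-1; lia.
rewrite NE subn1 /= in aE.
have E4 : (N + h.-1 * r <= N * t)%N.
  by rewrite -(leq_pmul2r t0); move: E3; rewrite aE dE' mulnDl -!mulnA.
have E5 : (2 * (N * t) <= N * h)%N by rewrite mulnCA leq_mul2l tle orbT.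
have [h' hE] : exists h', h = h'.+1 by exists h.-1; lia.
rewrite hE /= in E4 E5; have E6 : (h' * N <= h' * (2 * r))%N.
  by rewrite leq_mul2l; apply/orP; right; lia.
by move: E5 E4 E6; rewrite mulnS [(h' * (2 * r))%N]mulnCA [(N * h')%N]mulnC; lia.
Qed.

(** * Classification of the symmetric S-rings of rank 4 *)

Section NoTrivialRadical.
Variables (n : nat) (n_gt1 : (1 < n)%N) (C : eqType) (c : 'Z_n -> C) (Sc : Sring c).
Local Notation R := 'Z_n.
Implicit Types (x y w g : R).

Hypothesis csym : forall x, c (- x) = c x.
Variables (m h : nat) (nE : n = (m * h)%N) (m_gt1 : (1 < m)%N) (h_gt1 : (1 < h)%N).
Local Notation H := (multiples n m).
Hypothesis cH : cset c H.
Hypothesis uniqH : forall l, (l %| n)%N -> cset c (multiples n l) -> [\/ l = 1%N, l = m | l = n].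
Hypothesis H1 : forall x y, x \in H -> y \in H -> x != 0 -> y != 0 -> c x = c y.

Let mn : (m %| n)%N. Proof. by rewrite nE dvdn_mulr. Qed.
Let sH : is_subgroup H. Proof. exact: multiples_subg. Qed.
Let cardH : #|H| = h.
Proof. by rewrite card_multiples // nE mulKn // ltnW. Qed.

Section OneColour.
Variables (y z : R) (yH : y \notin H).
Hypothesis col : forall x, x \notin H -> c x = c y \/ c x = c z.
Local Notation X := (cclass c y).
Hypothesis radX : forall g, g \in crad X -> g = 0.

Let cX : cset c X. Proof. exact: cclass_cset. Qed.

Let XH x : x \in X -> x \notin H.
Proof. by rewrite inE => /eqP xy; rewrite (cH xy). Qed.

(* The number of elements of X in a coset of H other than H, which is independent of the
   coset because the two colours outside H fill it up. *)
Let v x := #|[set w in X | x - w \in H]|.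
Let s := v y.

(** [v] is invariant under translation by [H] and constant on colours. If it took different values
    at [y] and [z], it would tell the two colours apart, so translation by [m] would preserve [X],
    against [radX]. *)
Lemma coset_count_const x : x \notin H -> v x = s.
Proof.
have cv := cset_count Sc cX cH.
case/col=> [xy|xz]; first exact: (cv _ _ xy).
suff vzy : v z = s by rewrite -vzy; exact: (cv _ _ xz).
apply/eqP/negPn/negP=> /eqP vzy.
have : (m%:R : R) \in crad X.
  have mH : (m%:R : R) \in H by rewrite mem_multiples.
  apply: crad_sub => w wX; rewrite inE; case: (col (x := w + m%:R)) => [|->|E].
  - by rewrite subgDr // XH.
  - by [].
  - case: vzy; have -> : v z = v (w + m%:R) by symmetry; exact: (cv _ _ E).
    have -> : s = v w by symmetry; apply: (cv _ _); move: wX; rewrite inE => /eqP.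
    rewrite /v; apply: eq_card => t.
    have E2 : (w + m%:R - t \in H) = (w - t \in H).
      by rewrite addrAC (subgDr _ sH mH).
    by rewrite in_set E2 in_set.
move/radX/eqP; rewrite Zn_eq0 // nE => /dvdn_leq; have m0 := ltnW m_gt1 => /(_ m0).
by rewrite -{2}(muln1 m) leq_pmul2l // leqNgt h_gt1.
Qed.

(** Double count of the pairs of [x] in [Q] and [w] in [X] lying in one coset of [H]: each [x]
    contributes [s], and each [w] in [Q] contributes the whole coset. *)
Lemma class_count (Q : {set R}) : (forall x g, g \in H -> (x + g \in Q) = (x \in Q)) ->
  (forall x, x \in Q -> x \notin H) -> (#|X :&: Q| * h = #|Q| * s)%N.
Proof.
move=> Qinv QH; rewrite -[RHS]sum_nat_const.
under [RHS]eq_bigr => x xQ do rewrite -(coset_count_const (QH x xQ)) /v -sum1_card.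
rewrite [RHS](exchange_big_dep (mem X)) /=; last by move=> x w _; rewrite inE => /andP[].
rewrite -[LHS]sum_nat_const [LHS]big_mkcond [RHS]big_mkcond /=; apply: eq_bigr => w _.
rewrite in_setI; case: (w \in X) / boolP => wX //=.
rewrite sum1_card; case: ifP => wQ.
  rewrite -cardH -(card_imset (mem H) (addrI w)); apply: eq_card => x.
  apply/imsetP/idP => [[g gH ->]|].
    by rewrite unfold_in /= Qinv // wQ inE wX addrAC subrr add0r.
  rewrite unfold_in /= inE => /and3P[xQ _ xw]; exists (x - w) => //.
  by rewrite addrC subrK.
apply/esym/eq_card0 => x; rewrite unfold_in /= inE; apply/negP=> /and3P[xQ _ xw].
by move: wQ; rewrite -(Qinv w (x - w)) // addrC subrK xQ.
Qed.

Let h_gt0 : (0 < h)%N. Proof. exact: ltnW. Qed.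
Let HQ x g : g \in H -> (x + g \in ~: H) = (x \in ~: H).
Proof. by move=> gH; rewrite !in_setC (subgDr _ sH gH). Qed.
Let nH x : x \in ~: H -> x \notin H. Proof. by rewrite in_setC. Qed.

Lemma class_size : (#|X| * h = (n - h) * s)%N.
Proof.
have cardHC : #|~: H| = (n - h)%N by rewrite cardsCs setCK Zn_card // cardH.
have := class_count HQ nH; rewrite cardHC => <-.
congr (_ * _)%N; apply: eq_card => x; rewrite in_setI in_setC.
by case: (boolP (x \in X)) => // /XH ->.
Qed.

Lemma lambda_total : (\sum_(g in H) #|[set w in X | (w - g)%R \in X]| = #|X| * s)%N.
Proof.
rewrite sum_lambda -sum_nat_const; apply: eq_bigr => w wX.
rewrite -(coset_count_const (XH wX)) /v.
have inj : injective (fun g : R => w - g) by move=> g g' /addrI/oppr_inj.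
rewrite -(card_imset _ inj); apply: eq_card => t; apply/idP/imsetP => [|[g]].
  rewrite in_set => /andP[tH wt]; exists (w - t); last by rewrite opprB addrC subrK.
  by rewrite in_set wt opprB addrC subrK.
by rewrite in_set => /andP[gX wg] ->; rewrite in_set wg opprB addrC subrK gX.
Qed.

(** By [H1] all nonzero elements of [H] have the same number of representations as differences in
    [X], so a bound at one of them holds at all [h.-1] of them. *)
Lemma lambda_bound g k : g \in H -> g != 0 -> (k <= #|[set w in X | (w - g)%R \in X]|)%N ->
  (#|X| + h.-1 * k <= #|X| * s)%N.
Proof.
move=> gH g0 kg; rewrite -lambda_total (bigD1 0) /=; last by case: sH.
have -> : #|[set w in X | w - 0 \in X]| = #|X|.
  by apply: eq_card => w; rewrite in_set subr0 andbb.
rewrite leq_add2l; have -> : h.-1 = #|H :\ 0|.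
  by have := cardsD1 0 H; rewrite cardH; case: sH => -> _; rewrite add1n => ->.
rewrite -sum_nat_const; rewrite [X in (_ <= X)%N](eq_bigl (mem (H :\ 0))).
  apply: leq_sum => g'; rewrite in_setD1 => /andP[g'0 g'H].
  by rewrite (cset_lambda Sc cX (H1 g'H gH g'0 g0)).
by move=> g' /=; rewrite in_setD1 andbC.
Qed.

Section PrimeDivisor.
Variables (p : nat) (p_pr : prime p) (pn : (p %| n)%N).
Local Notation P := (multiples n (n %/ p)).
Let p_gt0 : (0 < p)%N. Proof. exact: prime_gt0. Qed.
Let npn : (n %/ p %| n)%N. Proof. exact: divn_dvdl. Qed.

Lemma core_subH : ccore c (multiples n p) \subset H.
Proof.
have [r rn rE] := subg_multiples n_gt1 (ccore_subg n_gt1 Sc (multiples_subg n_gt1 pn)).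
rewrite rE multiples_sub //; have cr : cset c (multiples n r).
  by rewrite -rE; exact: ccore_cset.
case: (uniqH rn cr) => rr; rewrite rr ?dvdnn //.
have := ccore_sub c (multiples n p); rewrite rE multiples_sub // rr dvdn1 => /eqP p1.
by move: p_pr; rewrite p1.
Qed.

Lemma class_Pinv w g : w \in X -> w *+ p \notin H -> g \in P -> w + g \in X.
Proof.
move=> wX wp gP; rewrite (schur_coset n_gt1 Sc p_pr pn cX) //.
by apply: contra wp; apply/subsetP/core_subH.
Qed.

(** If [p] did not divide [m], multiplication by [p] would keep the elements of [X] outside [H], and
    Schur's argument would make [X] invariant under [P]. *)
Lemma prime_dvd_index : (p %| m)%N.
Proof.
apply/negPn/negP=> pm; have : ((n %/ p)%:R : R) \in crad X.
  apply: crad_sub => w wX; apply: class_Pinv; rewrite ?mem_multiples //.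
  have := XH wX; rewrite [w]Zn_natE -[_ *+ p]mulr_natr -natrM !mem_multiples // Gauss_dvdl //.
  by rewrite coprime_sym prime_coprime.
move/radX/eqP; rewrite Zn_eq0 // => /dvdn_leq.
have np0 : (0 < n %/ p)%N by rewrite divn_gt0 // dvdn_leq // n_gt0.
by rewrite np0 => /(_ isT); rewrite leqNgt ltn_Pdiv ?prime_gt1 ?n_gt0.
Qed.

Hypothesis ph : (p %| h)%N.

Let PH : P \subset H.
Proof.
have [k kE] := dvdnP ph; rewrite multiples_sub // nE kE mulnA mulnK //.
by rewrite dvdn_mulr.
Qed.

Lemma P_nonzero : exists2 g, g \in P & g != 0.
Proof.
exists ((n %/ p)%:R); first by rewrite mem_multiples.
rewrite Zn_eq0 //; apply/negP=> /dvdn_leq.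
have np0 : (0 < n %/ p)%N by rewrite divn_gt0 // dvdn_leq // n_gt0.
by rewrite np0 => /(_ isT); rewrite leqNgt ltn_Pdiv ?prime_gt1 ?n_gt0.
Qed.

(* If m = k p with k > 1, translation by the subgroup of order p preserves X off the multiples
   of k, so that the differences in H occur too often unless s > h / 2. *)
Lemma index_eq_prime : (2 * s <= h)%N -> m = p.
Proof.
move=> sle; apply/eqP/negPn/negP=> mp; have pm := prime_dvd_index.
have [k kE] := dvdnP pm; have k1 : (1 < k)%N.
  case: k kE => [|[|//]] kE; first by move: m_gt1; rewrite kE.
  by rewrite kE mul1n eqxx in mp.
have kn : (k %| n)%N by rewrite nE kE -mulnA dvdn_mulr.
have mpk : (m %/ p = k)%N by rewrite kE mulnK.
have sK := multiples_subg n_gt1 kn.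
have HK : H \subset multiples n k by rewrite multiples_sub // kE dvdn_mulr.
have KQ x g : g \in H -> (x + g \in ~: multiples n k) = (x \in ~: multiples n k).
  by move=> gH; rewrite !in_setC (subgDr _ sK) //; apply: (subsetP HK).
have nK x : x \in ~: multiples n k -> x \notin H.
  by rewrite in_setC; apply: contra; exact: (subsetP HK).
have cardK : #|~: multiples n k| = (n - p * h)%N.
  by rewrite cardsCs setCK Zn_card // card_multiples // nE kE -mulnA mulKn // ltnW.
have [g gP g0] := P_nonzero; have gH := subsetP PH g gP.
have lam : (#|X :&: ~: multiples n k| <= #|[set w in X | (w - g)%R \in X]|)%N.
  apply: subset_leq_card; apply/subsetP=> w; rewrite in_setI in_setC => /andP[wX wK].
  rewrite in_set wX class_Pinv ?mulrn_mem ?mpk // (subgN _ (multiples_subg n_gt1 npn)) //.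
have := lambda_bound gH g0 lam; have := class_count KQ nK; have := class_size.
have y0 : (0 < #|X|)%N by rewrite card_gt0; apply/set0Pn; exists y; rewrite inE.
rewrite cardK; move: sle y0 k1 h_gt1; have := prime_gt1 p_pr.
move: #|X| #|X :&: _| s => a d t p1 tle a0 k1 h1 E1 E2 E3.
rewrite nE kE in E1 E2.
exact: (index_arith p1 tle a0 k1 h1 E1 E2 E3).
Qed.

End PrimeDivisor.

Section PrimeIndex.
Variables (p : nat) (p_pr : prime p) (mp : m = p) (ph : (p %| h)%N).
Let pn : (p %| n)%N. Proof. by rewrite -mp. Qed.
Local Notation P := (multiples n (n %/ p)).
Let p_gt0 : (0 < p)%N. Proof. exact: prime_gt0. Qed.
Let npn : (n %/ p %| n)%N. Proof. exact: divn_dvdl. Qed.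

(** Every prime divisor of [n] divides the index [m], which is the prime [p]; so a common prime
    divisor of [x] and [n] is [p], and puts [x] in [H]. *)
Lemma notin_unit x : x \notin H -> x \is a GRing.unit.
Proof.
move=> xH; rewrite [x]Zn_natE unitZpE // coprime_sym.
apply/negPn/negP=> nco; have [q q_pr qg] : exists2 q, prime q & (q %| gcdn x n)%N.
  exists (pdiv (gcdn x n)); last exact: pdiv_dvd.
  apply: pdiv_prime; rewrite ltn_neqAle eq_sym gcdn_gt0 (n_gt0 n_gt1) orbT andbT.
  exact: nco.
move: qg; rewrite dvdn_gcd => /andP[qx qn].
have := prime_dvd_index q_pr qn; rewrite mp dvdn_prime2 // => /eqP qp.
by case/negP: xH; rewrite inE mp -qp.
Qed.

(** A unit permutes the two colours outside [H], so its square fixes both. *)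
Lemma unit_orbit w u : w \notin H -> u \is a GRing.unit -> c (w * u * u) = c w.
Proof.
move=> wH uU; have cu := cmult_unit n_gt1 Sc uU.
have uI a b : c (a * u) = c (b * u) -> c a = c b.
  have vU : u^-1 \is a GRing.unit by rewrite unitrV.
  by move/(cmult_unit n_gt1 Sc vU); rewrite !mulrK.
have nHu a : a \notin H -> a * u \notin H.
  by move=> aH; apply: contra aH => /(subg_mul u^-1 sH); rewrite mulrK.
have [E|/eqP nE'] := eqVneq (c (w * u)) (c w); first by rewrite -[RHS]E; apply: cu.
have nE2 : c (w * u * u) <> c (w * u) by move/uI.
by case: (col wH) => E1; case: (col (nHu _ wH)) => E2;
   case: (col (nHu _ (nHu _ wH))) => E3; rewrite ?E1 ?E2 ?E3 // in nE' nE2 *.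
Qed.

Let P_zero g : g \in P -> g *+ p = 0.
Proof. by rewrite -Zn_mulrn_eq0 // => /eqP. Qed.

(* An index p subgroup leaves only units outside, and multiplication by squares of units
   preserves the two colours; for odd p these squares include translations by P. *)
Lemma no_odd_p_group : ~~ odd p.
Proof.
apply/negP=> po; have [g gP g0] := P_nonzero p_pr pn.
case/eqP: g0; apply: radX; apply: crad_sub => w wX.
have wH := XH wX; have wU := notin_unit wH.
(* [v0] is half of [g / w], the inverse of 2 modulo the odd [p] being [p.+1./2]. It lies in [P],
   whose elements are multiples of [h], and [n] divides [h * h]; hence [v0 * v0 = 0], and
   [w * (1 + v0) * (1 + v0)] is [w + g]. *)
pose v0 : R := g / w * (p.+1./2)%:R.
have v0P : v0 \in P by do 2 apply: (subg_mul _ (multiples_subg n_gt1 npn)).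
have v2 : v0 * v0 = 0.
  move: v0P; rewrite inE => /dvdnP[a aE]; rewrite [v0]Zn_natE aE -natrM.
  apply/eqP; rewrite Zn_eq0 // mulnACA.
  apply: dvdn_mull.
  have -> : (n %/ p = h)%N by rewrite nE mp mulKn.
  by rewrite [X in (X %| _)%N]nE mp dvdn_mul.
have v02 : v0 * 2%:R = g / w.
  have -> : v0 * 2%:R = g / w * p.+1%:R.
    transitivity (g / w * ((p.+1)./2%:R * 2%:R)); first by rewrite /v0 mulrA.
    by rewrite -natrM muln2 even_halfK //= po.
  by rewrite mulr_natr mulrS -mulrnAl P_zero // mul0r addr0.
have uU : 1 + v0 \is a GRing.unit.
  apply/unitrP; exists (1 - v0); split.
    by transitivity (1 - v0 * v0); [ring|rewrite v2 subr0].
  by transitivity (1 - v0 * v0); [ring|rewrite v2 subr0].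
rewrite inE; have -> : w + g = w * (1 + v0) * (1 + v0).
  have -> : w * (1 + v0) * (1 + v0) = w + w * (v0 * 2%:R) + w * (v0 * v0) by ring.
  by rewrite v2 v02 mulr0 addr0 mulrC divrK.
by rewrite unit_orbit //; move: wX; rewrite inE.
Qed.

(** For [p = 2] the unit [1 + h] acts on the elements outside [H] as translation by [h]. Since [h]
    is not in the radical, this translation takes [X] off itself, and [h] is not a difference in
    [X]. But [y + y], the difference of [y] and [- y], is such a difference and has the colour of
    [h]. *)
Lemma no_p_group : False.
Proof.
have p2 : p = 2%N by case: (even_prime p_pr) => // po; have := no_odd_p_group; rewrite po.
have h0 : (h%:R : R) != 0.
  rewrite Zn_eq0 // nE; apply/negP=> /dvdn_leq; rewrite h_gt0 => /(_ isT).
  by rewrite leqNgt ltn_Pmull.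
have hH : (h%:R : R) \in H by rewrite mem_multiples // mp.
have hw w : w \notin H -> w * (1 + h%:R) = w + h%:R.
  move=> wH; rewrite mulrDr mulr1; congr (_ + _).
  have wo : odd w by move: wH; rewrite inE mp p2 dvdn2 negbK.
  have -> : w = 1 + (w./2 * 2)%:R.
    by rewrite muln2 -[1]/(1%:R) -natrD -[1%N]/(nat_of_bool true) -wo odd_double_half -Zn_natE.
  have /eqP E : (((w./2 * 2) * h)%:R : R) == 0.
    by rewrite Zn_eq0 // [X in (X %| _)%N]nE mp p2 -mulnA dvdn_mull.
  by rewrite mulrDl mul1r -natrM E addr0.
have uU : (1 + h%:R : R) \is a GRing.unit.
  apply: notin_unit; rewrite (subgDr _ sH hH) -[1]/(1%:R) mem_multiples //.
  by rewrite dvdn1 mp p2.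
have cu := cmult_unit n_gt1 Sc uU.
have shift w : w \in X -> c (w + h%:R) <> c w.
  move=> wX; have wy : c w = c y by move: wX; rewrite inE => /eqP.
  rewrite -hw ?XH // => E; case/eqP: h0; apply: radX; apply: crad_sub => t tX.
  have ty : c t = c w by rewrite wy; move: tX; rewrite inE => /eqP.
  by rewrite inE -hw ?XH // (cu _ _ ty) E wy.
have yX : y \in X by rewrite inE.
have yU := notin_unit yH; have y20 : y + y != 0.
  apply/eqP=> E; have : (2%:R : R) = 0.
    by apply: (mulrI yU); rewrite mulr0 mulr_natr mulr2n.
  move/eqP; rewrite Zn_eq0 // => /(dvdn_leq (isT : (0 < 2)%N)); rewrite [X in (X <= _)%N]nE mp p2.
  by rewrite leqNgt ltn_Pmulr.
have y2H : y + y \in H.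
  by rewrite -mulr2n [y]Zn_natE -[_ *+ 2]mulr_natr -natrM mem_multiples // mp p2 dvdn_mull.
have := cset_lambda Sc cX (H1 y2H hH y20 h0).
rewrite (_ : [set z in X | z - h%:R \in X] = set0) ?cards0; last first.
  apply/setP=> w; rewrite in_set0 in_set; apply/negP=> /andP[wX wh].
  by apply: (shift _ wh); rewrite subrK; move: wX wh; rewrite !inE => /eqP -> /eqP ->.
apply/eqP; rewrite -lt0n card_gt0; apply/set0Pn; exists y.
by rewrite in_set yX opprD addrA subrr sub0r inE csym eqxx.
Qed.

End PrimeIndex.
End OneColour.

(* The counts s of the two colours add up to h, so one of them is at most h / 2. *)
Theorem no_trivial_radical y z : y \notin H -> c y <> c z ->
  (forall x, x \notin H -> c x = c y \/ c x = c z) ->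
  (forall g, g \in crad (cclass c y) -> g = 0) ->
  (forall g, g \in crad (cclass c z) -> g = 0) -> z \notin H -> False.
Proof.
move=> yH yz col rady radz zH.
have colz x : x \notin H -> c x = c z \/ c x = c y by move/col=> []; [right|left].
pose v a b := #|[set w in cclass c a | (b - w)%R \in H]|.
have vz : v z y = v z z by exact: (coset_count_const zH colz radz yH).
have sle : (v y y + v z z <= h)%N.
  rewrite -vz -cardH -(card_imset (mem H) (addrI y)) -cardsUI.
  rewrite [X in (_ + X <= _)%N](_ : _ = 0%N) ?addn0; last first.
    apply/eqP; rewrite cards_eq0; apply/eqP/setP=> w; rewrite in_set0 in_setI !in_set.
    by apply/negP=> /andP[/andP[/eqP E1 _] /andP[/eqP E2 _]]; apply: yz; rewrite -E1 -E2.
  apply: subset_leq_card; apply/subsetP=> w; rewrite in_setU.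
  have key : y - w \in H -> w \in [set y + g | g in H].
    move=> yw; apply/imsetP; exists (w - y); last by rewrite addrC subrK.
    by rewrite -(subgN _ sH) opprB.
  by case/orP; rewrite in_set => /andP[_ /key].
have p_pr : prime (pdiv h) by exact: pdiv_prime.
have ph := pdiv_dvd h; have pn : (pdiv h %| n)%N by rewrite nE dvdn_mull.
case: (leqP (2 * v y y) h) => le.
  have mp := index_eq_prime yH col rady p_pr pn ph le.
  exact: (no_p_group yH col rady p_pr mp ph).
have le' : (2 * v z z <= h)%N by lia.
have mp := index_eq_prime zH colz radz p_pr pn ph le'.
exact: (no_p_group zH colz radz p_pr mp ph).
Qed.

End NoTrivialRadical.

Section FpColours.
Variables (p : nat) (p_pr : prime p) (C : eqType).

Lemma pdiv_gt1 : (1 < pdiv p)%N. Proof. by rewrite pdiv_id ?prime_gt1. Qed.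

Lemma Fp_cmul (c : 'F_p -> C) : @Sring (pdiv p) C c ->
  forall u x y : 'F_p, u != 0 -> c x = c y -> c (x * u) = c (y * u).
Proof.
move=> Sc u x y u0; apply: (cmult_unit pdiv_gt1 Sc (u := u)).
by rewrite -unitfE in u0.
Qed.

End FpColours.

(** * The five types of symmetric S-rings of rank 4 *)

Section Rank4.
Variables (n : nat) (n_gt1 : (1 < n)%N) (C : eqType) (c : 'Z_n -> C) (Sc : Sring c).
Local Notation R := 'Z_n.
Hypothesis csym : forall x, c (- x) = c x.
Variables x1 x2 x3 : R.
Hypotheses (x1n0 : x1 != 0) (x2n0 : x2 != 0) (x3n0 : x3 != 0).
Hypotheses (c12 : c x1 != c x2) (c13 : c x1 != c x3) (c23 : c x2 != c x3).
Hypothesis c_all : forall x, x != 0 -> [\/ c x = c x1, c x = c x2 | c x = c x3].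

Lemma three_reps a1 a2 a3 : a1 != 0 -> a2 != 0 -> a3 != 0 ->
  c a1 != c a2 -> c a1 != c a3 -> c a2 != c a3 ->
  forall x, x != 0 -> [\/ c x = c a1, c x = c a2 | c x = c a3].
Proof.
move=> a10 a20 a30 d12 d13 d23 x x0.
pose s := [:: c a1; c a2; c a3]; pose t := [:: c x1; c x2; c x3].
have us : uniq s by rewrite /= !inE negb_or d12 d13 d23.
have tP y : y != 0 -> c y \in t.
  by move/c_all => [] ->; rewrite !inE eqxx ?orbT.
have st : {subset s <= t} by move=> y /[!inE] /or3P[]/eqP ->; [have := tP a1 a10|have := tP a2 a20|have := tP a3 a30]; rewrite !inE.
have [_ E] := uniq_min_size us st (leqnn _).
by have := tP x x0; rewrite -E !inE => /or3P[]/eqP ->; [constructor 1|constructor 2|constructor 3].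
Qed.

Lemma c_zero x y : c x = c y -> (x == 0) = (y == 0).
Proof. by case: Sc => c0 _ _ /c0; rewrite !inE. Qed.

(** The tensor product of two trivial S-rings. The subgroups meet in 0 by coprimality, so the four
    membership patterns are the four colours. *)
Definition cTensor h k := [/\ n = (h * k)%N, coprime h k, (1 < h)%N, (1 < k)%N &
  forall x y, (c x == c y) = ((x \in multiples n h) == (y \in multiples n h))
                          && ((x \in multiples n k) == (y \in multiples n k))].

(** The iterated wreath product of three trivial S-rings, with one colour for each layer between
    consecutive subgroups. *)
Definition cChain l m h := [/\ n = (l * m * h)%N, (1 < l)%N, (1 < m)%N, (1 < h)%N &
  forall x y, (c x == c y) = [&& (x == 0) == (y == 0),
     (x \in multiples n (l * m)) == (y \in multiples n (l * m)) &
     (x \in multiples n l) == (y \in multiples n l)]].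

(* The moduli are written pdiv p because 'F_p unfolds to 'Z_(pdiv p). *)
Definition cPaleySub l p := [/\ n = (l * pdiv p)%N, (1 < l)%N, prime p, (2 %| #|'F_p|.-1)%N &
  [/\ cset c (multiples n l), forall x y, x \notin multiples n l -> y \notin multiples n l -> c x = c y &
   forall g : 'F_p, (#|'F_p|.-1).-primitive_root g -> forall x y : 'F_p, x != 0 -> y != 0 ->
     (c (subZ n (pdiv p) l x) == c (subZ n (pdiv p) l y)) = (lg g x == lg g y %[mod 2])]].

(** The wreath product with the quadratic residues on the quotient. Quantifying over all generators
    is sound, as the parity of the logarithm is the quadratic character for each of them. *)
Definition cPaleyQuo h p := [/\ n = (pdiv p * h)%N, (1 < h)%N, prime p, (2 %| #|'F_p|.-1)%N &
  [/\ cset c (multiples n (pdiv p)),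
   forall x y, x \in multiples n (pdiv p) -> y \in multiples n (pdiv p) -> x != 0 -> y != 0 -> c x = c y &
   forall g : 'F_p, (#|'F_p|.-1).-primitive_root g -> forall x y, x \notin multiples n (pdiv p) ->
     y \notin multiples n (pdiv p) ->
     (c x == c y) = (lg g (Zred (pdiv p) x : 'F_p) == lg g (Zred (pdiv p) y : 'F_p) %[mod 2])]].

Definition cCubic p := [/\ n = (1 * pdiv p)%N, prime p, (3 %| #|'F_p|.-1)%N &
   forall g : 'F_p, (#|'F_p|.-1).-primitive_root g -> forall x y : 'F_p, x != 0 -> y != 0 ->
     (c (subZ n (pdiv p) 1 x) == c (subZ n (pdiv p) 1 y)) = (lg g x == lg g y %[mod 3])].

Lemma rank4_prime : prime n -> cCubic n.
Proof.
move=> n_pr; have nE : n = (1 * pdiv n)%N by rewrite mul1n pdiv_id.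
have p1 := pdiv_gt1 n_pr.
have cT : cset c (multiples n 1) by rewrite multiples1 => x y _; rewrite !inE.
have SF := Sring_sub n_gt1 Sc p1 nE cT.
have key (g : 'F_n) : (#|'F_n|.-1).-primitive_root g -> (3 %| #|'F_n|.-1)%N /\
    forall x y : 'F_n, x != 0 -> y != 0 ->
     (c (subZ n (pdiv n) 1 x) == c (subZ n (pdiv n) 1 y)) = (lg g x == lg g y %[mod 3]).
  move=> gP.
  have sur x : exists y : 'F_n, x = subZ n (pdiv n) 1 y.
    by apply: (subZ_surj n_gt1 p1 nE); rewrite multiples1 inE.
  have sub0 : subZ n (pdiv n) 1 0 = 0 by rewrite /subZ muln0.
  have [y1 E1] := sur x1; have [y2 E2] := sur x2; have [y3 E3] := sur x3.
  have nz (y : 'F_n) x : x = subZ n (pdiv n) 1 y -> x != 0 -> y != 0.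
    by move=> ->; apply: contraNneq => ->; rewrite sub0.
  apply: (@three_colours _ g gP _ (c \o subZ n (pdiv n) 1) _ y1 y2 y3).
  - exact: (Fp_cmul n_pr SF).
  - exact: nz E1 x1n0.
  - exact: nz E2 x2n0.
  - exact: nz E3 x3n0.
  - by rewrite /= -E1 -E2.
  - by rewrite /= -E1 -E3.
  - by rewrite /= -E2 -E3.
  move=> y y0; rewrite /= -E1 -E2 -E3; apply: c_all.
  by rewrite -sub0 (inj_eq (subZ_inj n_gt1 p1 nE)).
have [g gP] := finField_primitive 'F_n.
split=> //; first by have [] := key g gP.
by move=> g' /key[].
Qed.

Section OuterMono.
Variables (l u : nat) (nE : n = (l * u)%N) (l_gt1 : (1 < l)%N) (u_gt1 : (1 < u)%N).
Local Notation U := (multiples n l).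
Hypotheses (cU : cset c U) (mono : forall x y, x \notin U -> y \notin U -> c x = c y).
Let ln : (l %| n)%N. Proof. by rewrite nE dvdn_mulr. Qed.
Let one_notin : 1 \notin U.
Proof. by rewrite -[1]/(1%:R) mem_multiples // dvdn1 neq_ltn l_gt1 orbT. Qed.

Lemma two_inside : exists a b, [/\ a \in U, b \in U, c a != c b, a != 0 /\ b != 0 &
  forall x, x \in U -> x != 0 -> c x = c a \/ c x = c b].
Proof.
have one0 : (1 : R) != 0 by exact: oner_neq0.
have inU x : c x != c 1 -> x \in U.
  by apply: contraR => xU; rewrite (mono xU one_notin).
have nU x : x \in U -> c x <> c 1.
  by move=> xU E; move: one_notin; rewrite -(cU E) xU.
case: (c_all one0) => E.
- exists x2, x3; split; rewrite ?inU ?E // 1?eq_sym // => x xU x0.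
  by case: (c_all x0) => // Ex; [case: (nU x xU); rewrite Ex|left|right].
- exists x1, x3; split; rewrite ?inU ?E // 1?eq_sym // => x xU x0.
  by case: (c_all x0) => // Ex; [left|case: (nU x xU); rewrite Ex|right].
- exists x1, x2; split; rewrite ?inU ?E // => x xU x0.
  by case: (c_all x0) => // Ex; [left|right|case: (nU x xU); rewrite Ex].
Qed.

(** One colour is used up outside [U], which leaves two nonzero ones inside. If the S-ring on [U]
    has a proper subgroup, that subgroup is the lower member of the chain. Otherwise [U] has prime
    order by [cprim_prime], and the two colours are the quadratic classes. *)
Lemma rank4_outer_mono : (exists m h, cChain l m h) \/ exists p, cPaleySub l p.
Proof.
have SU := Sring_sub n_gt1 Sc u_gt1 nE cU.
have [a [b [aU bU ab [a0 b0] abP]]] := two_inside.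
have sub0 : subZ n u l 0 = 0 by rewrite /subZ muln0.
have nz (y : 'Z_u) x : x = subZ n u l y -> x != 0 -> y != 0.
  by move=> ->; apply: contraNneq => ->; rewrite sub0.
have [a' aE] := subZ_surj n_gt1 u_gt1 nE aU; have [b' bE] := subZ_surj n_gt1 u_gt1 nE bU.
case: (cprimP u_gt1 (c \o subZ n u l)) => [pc|[m [/andP[m1 mu] mdu cm]]]; last first.
  left; have [h hE] := dvdnP mdu; exists m, h.
  have nE' : n = (l * m * h)%N by rewrite nE hE -mulnA [(m * h)%N]mulnC.
  have h1 : (1 < h)%N by move: mu; rewrite hE; case: (h) => [|[|]] //; rewrite mul1n ltnn.
  have lmn : (l * m %| n)%N by rewrite nE' dvdn_mulr.
  have HU : multiples n (l * m) \subset U by rewrite multiples_sub // dvdn_mulr.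
  have subm (y : 'Z_u) : (subZ n u l y \in multiples n (l * m)) = (y \in multiples u m).
    rewrite mem_multiples // dvdn_pmul2l ?inE //; exact: ltnW.
  have cH : cset c (multiples n (l * m)).
    move=> x y xy; case xU: (x \in U); last first.
      have /negP xH : x \notin multiples n (l * m).
        by apply/negP=> /(subsetP HU); rewrite xU.
      have /negP yH : y \notin multiples n (l * m).
        by apply/negP=> /(subsetP HU); rewrite -(cU xy) xU.
      by apply/idP/idP.
    have yU : y \in U by rewrite -(cU xy).
    have [x' xE] := subZ_surj n_gt1 u_gt1 nE xU; have [y' yE] := subZ_surj n_gt1 u_gt1 nE yU.
    by rewrite xE yE !subm; apply: cm; rewrite /= -xE -yE.
  split=> //.
  have r1 : ((l * m)%:R : R) != 0.
    rewrite Zn_eq0 // nE' -[X in (_ %| X)%N]muln1 dvdn_pmul2l ?muln_gt0 ?(ltnW l_gt1) ?(ltnW m1) //.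
    by rewrite dvdn1 neq_ltn h1 orbT.
  have r1H : ((l * m)%:R : R) \in multiples n (l * m) by rewrite mem_multiples.
  have r2U : (l%:R : R) \in U by rewrite mem_multiples.
  have r2H : (l%:R : R) \notin multiples n (l * m).
    rewrite mem_multiples // -[X in (_ %| X)%N]muln1 dvdn_pmul2l ?(ltnW l_gt1) //.
    by rewrite dvdn1 neq_ltn m1 orbT.
  have ne0 x (M : {set R}) : is_subgroup M -> x \notin M -> x != 0.
    by case=> M0 _; apply: contraNneq => ->.
  have r20 := ne0 _ _ (multiples_subg n_gt1 lmn) r2H.
  have r30 := ne0 _ _ (multiples_subg n_gt1 ln) one_notin.
  have all3 := three_reps r1 r20 r30.
  have n1H : 1 \notin multiples n (l * m) by apply: contra one_notin; apply: (subsetP HU).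
  have d12 : c (l * m)%:R != c l%:R by apply: contraNneq r2H => /cH <-.
  have d13 : c (l * m)%:R != c 1 by apply: contraNneq n1H => /cH <-.
  have d23 : c l%:R != c 1 by apply: contraNneq one_notin => /cU <-.
  have {}all3 := all3 d12 d13 d23.
  have type x : x != 0 -> c x = if x \in multiples n (l * m) then c (l * m)%:R else
       if x \in U then c l%:R else c 1.
    case/all3 => E; rewrite E (cH _ _ E) (cU E) ?r1H ?(negPf r2H) ?(negPf n1H) ?r2U //.
    by rewrite (negPf one_notin).
  move=> x y; apply/eqP/and3P => [xy|[/eqP xy0 /eqP xyH /eqP xyU]].
    by rewrite (c_zero xy) (cH _ _ xy) (cU xy) !eqxx.
  have [x0|x0] := eqVneq x 0.
    by move: xy0; rewrite x0 eqxx => /esym/eqP ->.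
  have y0 : y != 0 by rewrite -xy0.
  by rewrite (type x x0) (type y y0) xyH xyU.
right; have u_pr : prime u.
  apply: (cprim_prime u_gt1 SU pc (nz _ _ aE a0) (nz _ _ bE b0)).
  by rewrite /= -aE -bE; apply/eqP.
have pu : pdiv u = u by exact: pdiv_id.
(* Replacing [u] by the equal number [pdiv u] changes the type of the elements, so the data are
   stated for all [v = u] and then taken at [pdiv u], where they live in ['F_u]. *)
have : forall v, v = u -> @Sring v C (c \o subZ n v l) -> 
  [/\ forall y : 'Z_v, y != 0 -> c (subZ n v l y) = c a \/ c (subZ n v l y) = c b,
    exists2 a' : 'Z_v, a = subZ n v l a' & a' != 0 & exists2 b' : 'Z_v, b = subZ n v l b' & b' != 0].
  move=> v ->  _; split.
  - move=> y y0; apply: abP; first exact: (subZ_mem n_gt1 nE).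
    by rewrite -sub0 (inj_eq (subZ_inj n_gt1 u_gt1 nE)).
  - by exists a' => //; apply: nz aE a0.
  - by exists b' => //; apply: nz bE b0.
have SU' : @Sring (pdiv u) C (c \o subZ n (pdiv u) l) by rewrite pu.
move=> /(_ _ pu SU')[allF [aF aFE aF0] [bF bFE bF0]].
have key (g : 'F_u) : (#|'F_u|.-1).-primitive_root g -> (2 %| #|'F_u|.-1)%N /\
    forall x y : 'F_u, x != 0 -> y != 0 ->
     (c (subZ n (pdiv u) l x) == c (subZ n (pdiv u) l y)) = (lg g x == lg g y %[mod 2]).
  move=> gP; apply: (@two_colours _ g gP _ (c \o subZ n (pdiv u) l) _ aF bF) => //.
  - exact: (Fp_cmul u_pr SU').
  - by rewrite /= -aFE -bFE.
  - by move=> y y0; rewrite /= -aFE -bFE; apply: allF.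
have [g gP] := finField_primitive 'F_u.
have [k2 _] := key g gP.
exists u; split=> //; first by rewrite [LHS]nE pu.
split=> // g' /key[_ gE].
exact: gE.
Qed.

End OuterMono.

Definition split_outside l := exists y z, [/\ y \notin multiples n l, z \notin multiples n l & c y <> c z].

(** Two of the three nonzero colours occur outside the subgroup, so only one is left inside. *)
Lemma inner_mono l : cset c (multiples n l) -> split_outside l ->
  forall x y, x \in multiples n l -> y \in multiples n l -> x != 0 -> y != 0 -> c x = c y.
Proof.
move=> cl [a [b [al bl ab]]] x y xl yl x0 y0.
have ne0 w : w \notin multiples n l -> w != 0 by apply: contraNneq => ->; rewrite inE dvdn0.
have ne w w' : w \in multiples n l -> w' \notin multiples n l -> c w != c w'.
  by move=> wl; apply: contraNneq => /cl <-.
have [] := three_reps x0 (ne0 _ al) (ne0 _ bl) (ne _ _ xl al) (ne _ _ xl bl) (introN eqP ab) y0 => //.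
- by move/eqP; rewrite (negPf (ne _ _ yl al)).
- by move/eqP; rewrite (negPf (ne _ _ yl bl)).
Qed.

Lemma outside_two l y z x : y \notin multiples n l -> z \notin multiples n l -> c y <> c z ->
  (l %| n)%N -> (l < n)%N -> (0 < l)%N -> cset c (multiples n l) ->
  x \notin multiples n l -> c x = c y \/ c x = c z.
Proof.
move=> yl zl yz ln lltn l0 cl xl.
have ne0 w : w \notin multiples n l -> w != 0 by apply: contraNneq => ->; rewrite inE dvdn0.
have lM : (l%:R : R) \in multiples n l by rewrite mem_multiples.
have l0' : (l%:R : R) != 0.
  by rewrite Zn_eq0 //; apply/negP=> /(dvdn_leq l0); rewrite leqNgt lltn.
have ne w w' : w \in multiples n l -> w' \notin multiples n l -> c w != c w'.
  by move=> wl; apply: contraNneq => /cl <-.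
have [] := three_reps l0' (ne0 _ yl) (ne0 _ zl) (ne _ _ lM yl) (ne _ _ lM zl) (introN eqP yz) (ne0 _ xl);
  [|by left|by right].
by move=> E; have := ne _ _ lM xl; rewrite E eqxx.
Qed.

Section TwoSubgroups.
Variables h k : nat.
Hypotheses (hn : (h %| n)%N) (kn : (k %| n)%N) (h_gt1 : (1 < h)%N) (k_gt1 : (1 < k)%N).
Hypotheses (hltn : (h < n)%N) (kltn : (k < n)%N) (hk : h <> k).
Hypotheses (ch : cset c (multiples n h)) (ck : cset c (multiples n k)).
Hypothesis spl : forall l, (1 < l)%N -> (l < n)%N -> (l %| n)%N -> cset c (multiples n l) -> split_outside l.

(** The nonzero elements of the first subgroup share one colour; if one of them lies in the second
    subgroup, a union of colours, all of them do. *)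
Lemma same_colour_same_subgroup l l' x : (l %| n)%N -> (l' %| n)%N ->
  cset c (multiples n l) -> cset c (multiples n l') ->
  (1 < l < n)%N -> x != 0 -> x \in multiples n l -> x \in multiples n l' -> (l' %| l)%N.
Proof.
move=> ln l'n cl cl' /andP[l1 lltn] x0 xl xl'.
rewrite -(multiples_sub n_gt1) //; apply/subsetP=> y yl.
have [->|y0] := eqVneq y 0; first by rewrite inE dvdn0.
by rewrite (cl' y x) //; apply: (inner_mono cl (spl l1 lltn ln cl)).
Qed.

(** A common nonzero element would make the two subgroups equal, so they meet in 0. Once [h] and [k]
    are coprime, [h * k] divides [n], and being in both subgroups it vanishes modulo [n]. *)
Lemma rank4_two_subgroups : cTensor h k.
Proof.
have h0 := ltnW h_gt1; have k0 := ltnW k_gt1.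
have hM : (h%:R : R) \in multiples n h by rewrite mem_multiples.
have kM : (k%:R : R) \in multiples n k by rewrite mem_multiples.
have nz l : (0 < l)%N -> (l < n)%N -> (l%:R : R) != 0.
  by move=> l0 ll; rewrite Zn_eq0 //; apply/negP=> /(dvdn_leq l0); rewrite leqNgt ll.
have same x : x \in multiples n h -> x \in multiples n k -> x = 0.
  move=> xh xk; apply/eqP/negPn/negP=> x0; apply: hk; apply/eqP; rewrite eqn_dvd.
  rewrite (same_colour_same_subgroup kn hn ck ch _ x0) ?k_gt1 //.
  by rewrite (same_colour_same_subgroup hn kn ch ck _ x0) ?h_gt1.
(* The core of the multiples of the gcd contains both subgroups. If the gcd exceeded 1 this core
   would be proper, hence with a single nonzero colour; then [h] and [k] would share a colour, and
   [h] would lie in both subgroups. *)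
have co : coprime h k.
  have dn : (gcdn h k %| n)%N by apply: dvdn_trans hn; exact: dvdn_gcdl.
  have [d' d'n dE] := subg_multiples n_gt1 (ccore_subg n_gt1 Sc (multiples_subg n_gt1 dn)).
  have hd : multiples n h \subset ccore c (multiples n (gcdn h k)).
    by apply: ccore_max => //; rewrite multiples_sub // dvdn_gcdl.
  have kd : multiples n k \subset ccore c (multiples n (gcdn h k)).
    by apply: ccore_max => //; rewrite multiples_sub // dvdn_gcdr.
  have cd : cset c (multiples n d') by rewrite -dE; exact: ccore_cset.
  rewrite dE !multiples_sub // in hd kd.
  have := ccore_sub c (multiples n (gcdn h k)); rewrite dE multiples_sub // => dd'.
  apply/negPn/negP=> nco; have d1 : (1 < d')%N.
    rewrite (leq_trans _ (dvdn_leq _ dd')) ?(dvdn_gt0 _ d'n) ?n_gt0 //.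
    by rewrite ltn_neqAle eq_sym gcdn_gt0 h0 andbT; exact: nco.
  have d'lt : (d' < n)%N by apply: leq_ltn_trans (dvdn_leq h0 hd) hltn.
  have sd := spl d1 d'lt d'n cd.
  have hd' : (h%:R : R) \in multiples n d' by rewrite mem_multiples.
  have kd' : (k%:R : R) \in multiples n d' by rewrite mem_multiples.
  have E := inner_mono cd sd hd' kd' (nz h h0 hltn) (nz k k0 kltn).
  have hk' : (h%:R : R) \in multiples n k by rewrite (ck E).
  by have := nz h h0 hltn; rewrite (same _ hM hk') eqxx.
have hkn : (h * k %| n)%N by rewrite Gauss_dvd // hn.
have nE : n = (h * k)%N.
  have /eqP : ((h * k)%:R : R) = 0.
    by apply: same; rewrite mem_multiples //; [apply: dvdn_mulr|apply: dvdn_mull].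
  by rewrite Zn_eq0 // => nhk; apply/eqP; rewrite eqn_dvd nhk hkn.
split=> // x y; apply/eqP/andP => [xy|[/eqP xyh /eqP xyk]].
  by rewrite (ch xy) (ck xy) !eqxx.
have one_h : 1 \notin multiples n h by rewrite -[1]/(1%:R) mem_multiples // dvdn1 neq_ltn h_gt1 orbT.
have one_k : 1 \notin multiples n k by rewrite -[1]/(1%:R) mem_multiples // dvdn1 neq_ltn k_gt1 orbT.
have kh : (k%:R : R) \notin multiples n h.
  by apply: contra (nz k k0 kltn) => kh; rewrite (same _ kh kM).
have hk' : (h%:R : R) \notin multiples n k.
  by apply: contra (nz h h0 hltn) => hkk; rewrite (same _ hM hkk).
have d12 : c h%:R != c k%:R by apply: contraNneq kh => /ch <-.
have d13 : c h%:R != c 1 by apply: contraNneq one_h => /ch <-.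
have d23 : c k%:R != c 1 by apply: contraNneq one_k => /ck <-.
have all3 := three_reps (nz h h0 hltn) (nz k k0 kltn) (oner_neq0 _) d12 d13 d23.
have type w : w != 0 -> c w = if w \in multiples n h then c h%:R else
     if w \in multiples n k then c k%:R else c 1.
  case/all3 => E; rewrite E (ch E) (ck E) ?hM ?(negPf kh) ?(negPf one_h) ?kM //.
  by rewrite (negPf one_k).
have z0 w : (w == 0) = (w \in multiples n h) && (w \in multiples n k).
  apply/eqP/andP => [->|[]]; first by rewrite !inE dvdn0.
  exact: same.
have [x0|x0] := eqVneq x 0.
  by have /eqP -> : y == 0; [rewrite z0 -xyh -xyk -z0 x0|rewrite x0].
have y0 : y != 0 by rewrite z0 -xyh -xyk -z0.
by rewrite (type x x0) (type y y0) xyh xyk.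
Qed.
End TwoSubgroups.

Section UniqueSubgroup.
Variables m h : nat.
Hypotheses (nE : n = (m * h)%N) (m_gt1 : (1 < m)%N) (h_gt1 : (1 < h)%N).
Local Notation H := (multiples n m).
Hypotheses (cH : cset c H) (spl : split_outside m).
Hypothesis uniqH : forall l, (l %| n)%N -> cset c (multiples n l) -> [\/ l = 1%N, l = m | l = n].
Let mn : (m %| n)%N. Proof. by rewrite nE dvdn_mulr. Qed.
Let sH : is_subgroup H. Proof. exact: multiples_subg. Qed.
Let mltn : (m < n)%N. Proof. by rewrite [X in (_ < X)%N]nE ltn_Pmulr // ltnW. Qed.

(** The radical of a colour is a colour subgroup, so it is 0, [H] or everything; in the last case
    [y] would have the colour of 0. If it is [H], both this colour and its complement outside [H],
    the other colour, are unions of cosets. *)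
Lemma crad_cases y z : y \notin H -> z \notin H -> c y <> c z ->
  (forall g, g \in crad (cclass c y) -> g = 0) \/
  (forall x g, x \notin H -> g \in H -> c (x + g) = c x).
Proof.
move=> yH zH yz; set X := cclass c y.
have cX : cset c X by exact: cclass_cset.
have [r rn rE] := subg_multiples n_gt1 (crad_subg n_gt1 X).
have cr : cset c (multiples n r) by rewrite -rE; exact: (crad_cset n_gt1 Sc cX).
case: (uniqH rn cr) => r_eq; last first.
- by left=> g; rewrite rE r_eq multiplesn // inE => /eqP.
- right=> x g xH gH; have /cradP gX : g \in crad X by rewrite rE r_eq.
  have := gX x; rewrite !inE.
  have xgH : x + g \notin H by rewrite (subgDr _ sH gH).
  have two w : w \notin H -> c w = c y \/ c w = c z.
    by apply: outside_two => //; exact: ltnW.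
  have zy : (c z == c y) = false by apply/eqP/nesym.
  by case: (two x xH) => ->; case: (two _ xgH) => ->; rewrite ?eqxx ?zy.
- have /cradP/(_ y) : - y \in crad X by rewrite rE r_eq multiples1 inE.
  rewrite subrr cclass_id inE => /eqP/cH; rewrite (negPf yH).
  by case: sH => ->.
Qed.

Lemma rank4_unique_subgroup : exists h p, cPaleyQuo h p.
Proof.
have [y [z [yH zH yz]]] := spl.
have two w : w \notin H -> c w = c y \/ c w = c z.
  by apply: outside_two => //; exact: ltnW.
have zy : c z <> c y by exact: nesym.
have H1 := inner_mono cH spl.
have cinv : forall x g, x \notin H -> g \in H -> c (x + g) = c x.
  case: (crad_cases yH zH yz) => // rady; case: (crad_cases zH yH zy) => // radz.
  by case: (no_trivial_radical n_gt1 Sc csym nE m_gt1 h_gt1 cH uniqH H1 yH yz two rady radz zH).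
have SQ := Sring_quotient n_gt1 Sc m_gt1 mn cH cinv.
have liftE x : x \notin H -> c (Zred n (Zred m x)) = c x by apply: lift_class.
have liftE' x x' : c x = c x' -> c (Zred n (Zred m x)) = c (Zred n (Zred m x')).
  move=> xx'; case xH: (x \in H); last first.
    by rewrite !liftE -?(cH xx') ?xH.
  have x'H : x' \in H by rewrite -(cH xx').
  by move: xH x'H; rewrite -!Zred_eq0 // => /eqP -> /eqP ->.
have redn0 x : x \notin H -> Zred m x != 0 by rewrite -Zred_eq0.
(* A proper colour subgroup of the quotient would pull back to a second proper colour subgroup,
   strictly containing [H]. *)
have m_pr : prime m.
  case: (cprimP m_gt1 (c \o Zred n)) => [pc|[l [/andP[l1 lm] lmd cl]]].
    apply: (cprim_prime m_gt1 SQ pc (redn0 _ yH) (redn0 _ zH)).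
    by rewrite /= !liftE.
  have ln : (l %| n)%N by apply: dvdn_trans mn.
  have memE x : (x \in multiples n l) = (Zred m x \in multiples m l).
    by rewrite [x in LHS]Zn_natE /Zred !mem_multiples.
  have cl' : cset c (multiples n l).
    by move=> x x' /liftE' xx'; rewrite !memE; apply: cl.
  case: (uniqH ln cl') => E; rewrite E ?ltnn // in l1 lm.
  by have := ltn_trans lm mltn; rewrite ltnn.
have pm : pdiv m = m by exact: pdiv_id.
have : forall v, v = m -> [/\ @Sring v C (c \o Zred n),
    cset c (multiples n v),
    forall x, x \notin multiples n v -> c (Zred n (Zred v x)) = c x,
    forall x, (Zred v x == 0) = (x \in multiples n v)
    & forall w : 'Z_v, w != 0 -> c (Zred n w) = c y \/ c (Zred n w) = c z].
  move=> v ->; split=> // [x|w w0]; first exact: Zred_eq0.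
  by apply: two; rewrite lift_mem.
move=> /(_ _ pm)[SF cF lF z0F twoF].
have yF : y \notin multiples n (pdiv m) by rewrite pm.
have zF : z \notin multiples n (pdiv m) by rewrite pm.
have key (g : 'F_m) : (#|'F_m|.-1).-primitive_root g -> (2 %| #|'F_m|.-1)%N /\
    forall x y : 'F_m, x != 0 -> y != 0 ->
     (c (Zred n x) == c (Zred n y)) = (lg g x == lg g y %[mod 2]).
  move=> gP; apply: (@two_colours _ g gP _ (c \o Zred n) _ (Zred _ y) (Zred _ z)).
  - exact: (Fp_cmul m_pr SF).
  - by rewrite z0F.
  - by rewrite z0F.
  - by rewrite /= !lF //; apply/eqP.
  - by move=> w w0; rewrite /= !lF //; apply: twoF.
have [g gP] := finField_primitive 'F_m.
have [k2 _] := key g gP.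
exists h, m; split=> //; first by rewrite [LHS]nE pm.
split=> //; first by rewrite pm.
by move=> g' /key[_ gE] x x' xH x'H; rewrite -gE ?z0F //= !lF.
Qed.
End UniqueSubgroup.

(** The order of the cases matters. A proper colour subgroup with a single colour outside is treated
    first; after that every proper colour subgroup has one nonzero colour inside and two outside, as
    the cases of two subgroups and of one subgroup require. *)
Theorem rank4_classification :
  cCubic n \/ (exists h k, cTensor h k) \/ (exists l m h, cChain l m h) \/
  (exists l p, cPaleySub l p) \/ (exists h p, cPaleyQuo h p).
Proof.
case: (cprimP n_gt1 c) => [pc|[m [/andP[m1 mltn] mn cm]]].
  left; apply: rank4_prime; apply: (cprim_prime n_gt1 Sc pc x1n0 x2n0).
  exact/eqP.
right; pose split_b l := [exists y : R, exists z : R,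
  [&& y \notin multiples n l, z \notin multiples n l & c y != c z]].
have splP l : reflect (split_outside l) (split_b l).
  apply: (iffP existsP) => [[y /existsP[z /and3P[yl zl /eqP yz]]]|[y [z [yl zl yz]]]].
    by exists y, z.
  by exists y; apply/existsP; exists z; rewrite yl zl; apply/eqP.
case: (boolP [exists l : 'I_n, [&& (1 < l)%N, (l %| n)%N, csetb c (multiples n l) & ~~ split_b l]]).
  case/existsP=> l /and4P[l1 ln /csetP cl nsp].
  have [u uE] := dvdnP ln; have nE : n = (l * u)%N by rewrite mulnC.
  have u1 : (1 < u)%N.
    have := ltn_ord l; rewrite [X in (_ < X)%N -> _]uE.
    by case: (u) => [|[|//]]; rewrite ?mul0n ?mul1n ?ltnn.
  have mono x y : x \notin multiples n l -> y \notin multiples n l -> c x = c y.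
    move=> xl yl; apply/eqP; move/existsPn: nsp => /(_ x)/existsPn/(_ y).
    by rewrite xl yl negbK.
  case: (rank4_outer_mono nE l1 u1 cl mono) => [[m' [h' E]]|[p E]].
    by right; left; exists l, m', h'.
  by right; right; left; exists l, p.
move/existsPn=> nsp; have spl l : (1 < l)%N -> (l < n)%N -> (l %| n)%N ->
    cset c (multiples n l) -> split_outside l.
  move=> l1 ll ln /csetP cl; apply/splP; have := nsp (Ordinal ll).
  by rewrite /= l1 ln cl /= negbK.
case: (boolP [exists l : 'I_n, [&& (1 < l)%N, (l %| n)%N, csetb c (multiples n l) & val l != m]]).
  case/existsP=> l /and4P[l1 ln /csetP cl lm]; left; exists l, m.
  by apply: rank4_two_subgroups => //; apply/eqP.
move/existsPn=> uq; right; right; right.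
have [h hE] := dvdnP mn; have nE : n = (m * h)%N by rewrite mulnC.
have h1 : (1 < h)%N.
  have := mltn; rewrite [X in (_ < X)%N -> _]hE.
  by case: (h) => [|[|//]]; rewrite ?mul0n ?mul1n ?ltnn.
apply: (rank4_unique_subgroup nE m1 h1 cm (spl m m1 mltn mn cm)) => l ln cl.
have := dvdn_leq (n_gt0 n_gt1) ln; rewrite leq_eqVlt => /orP[/eqP|ll]; first by constructor 3.
have := dvdn_gt0 (n_gt0 n_gt1) ln; rewrite leq_eqVlt => /orP[/eqP <-|l1]; first by constructor 1.
constructor 2; apply/eqP; have := uq (Ordinal ll); rewrite /= l1 ln /=.
by move/csetP: cl => -> /=; rewrite negbK.
Qed.

End Rank4.

(** * S-rings spanned by a few indicators *)

Section ColourSpan.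
Variables (n : nat) (C : eqType) (c : 'Z_n -> C).
Local Notation A := (galg int 'Z_n).

Lemma cconstD (f g : A) : cconst c f -> cconst c g -> cconst c (f + g : A).
Proof. by move=> cf cg x y xy; rewrite !galgD (cf _ _ xy) (cg _ _ xy). Qed.

Lemma cconstZ (a : int) (f : A) : cconst c f -> cconst c (a%:~R * f : A).
Proof. by move=> cf x y xy; rewrite !galgZ (cf _ _ xy). Qed.

Lemma cconst_int (a : int) : cset c [set 0] -> cconst c (a%:~R : A).
Proof. by move=> c0 x y /c0; rewrite !inE !galg_int => ->. Qed.

(** By bilinearity, closure under convolution has to be checked only on products of the spanning
    functions. *)
Lemma Sring_span (B1 B2 B3 : A) : cset c [set 0] -> cconst c (fun x => c (- x)) ->
  (forall f : A, cconst c f -> exists a1 a2 a3 a4 : int,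
     f = a1%:~R + a2%:~R * B1 + a3%:~R * B2 + a4%:~R * B3) ->
  cconst c B1 -> cconst c B2 -> cconst c B3 ->
  cconst c (B1 * B1 : A) -> cconst c (B2 * B2 : A) -> cconst c (B3 * B3 : A) ->
  cconst c (B1 * B2 : A) -> cconst c (B1 * B3 : A) -> cconst c (B2 * B3 : A) -> Sring c.
Proof.
move=> c0 cN sp c1 c2 c3 c11 c22 c33 c12 c13 c23; split=> // f g /sp[a1 [a2 [a3 [a4 ->]]]].
move=> /sp[b1 [b2 [b3 [b4 ->]]]].
have -> : (a1%:~R + a2%:~R * B1 + a3%:~R * B2 + a4%:~R * B3)
        * (b1%:~R + b2%:~R * B1 + b3%:~R * B2 + b4%:~R * B3)
  = (a1 * b1)%:~R + (a1 * b2 + a2 * b1)%:~R * B1 + (a1 * b3 + a3 * b1)%:~R * B2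
    + (a1 * b4 + a4 * b1)%:~R * B3 + (a2 * b2)%:~R * (B1 * B1) + (a3 * b3)%:~R * (B2 * B2)
    + (a4 * b4)%:~R * (B3 * B3) + (a2 * b3 + a3 * b2)%:~R * (B1 * B2)
    + (a2 * b4 + a4 * b2)%:~R * (B1 * B3) + (a3 * b4 + a4 * b3)%:~R * (B2 * B3) :> A.
  ring.
by do 9![apply: cconstD; last exact: cconstZ]; apply: cconst_int.
Qed.

End ColourSpan.

Section SubgroupIndicators.
Variables (n : nat) (n_gt1 : (1 < n)%N).
Local Notation R := 'Z_n.
Local Notation A := (galg int R).
Implicit Types (H K M U S : {set R}).

Lemma ind_subgM H U : is_subgroup H -> is_subgroup U -> H \subset U ->
  ind H * ind U = (#|H|%:Z)%:~R * ind U :> A.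
Proof.
move=> sH sU /subsetP HU; apply/ffunP=> x; rewrite indM galgZ indE natz.
case: (boolP (x \in U)) => xU; rewrite ?mulr1 ?mulr0.
  congr (_%:Z); apply: eq_card => z; rewrite inE andbC.
  case: (boolP (z \in H)) => zH; rewrite ?andbF // andbT.
  by rewrite (subgDr _ sU) // subgN // HU.
rewrite (_ : [set _ in _ | _] = set0) ?cards0 //; apply/setP=> z; rewrite !inE.
apply/negP=> /andP[zH]; have zU : - z \in U by rewrite subgN // HU.
by rewrite (subgDr _ sU zU) (negPf xU).
Qed.

Lemma subgT : is_subgroup [set: R]. Proof. by split=> *; rewrite inE. Qed.

Lemma ind_coprimeM h k : n = (h * k)%N -> coprime h k ->
  ind (multiples n h) * ind (multiples n k) = ind [set: R] :> A.
Proof.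
move=> nE co; apply/ffunP=> x; rewrite indM indE inE natz.
have hn : (h %| n)%N by rewrite nE dvdn_mulr.
have kn : (k %| n)%N by rewrite nE dvdn_mull.
have h0 : (0 < h)%N by apply: dvdn_gt0 hn; exact: n_gt0.
have [[a b] /= ab] := coprimeP _ h0 co.
have abE : (a * h)%:R - (b * k)%:R = 1 :> R.
  by rewrite -natrB ?ab //; apply: ltnW; rewrite -subn_gt0 ab.
have sH := multiples_subg n_gt1 hn; have sK := multiples_subg n_gt1 kn.
(* The Bezout relation [a * h - b * k = 1] splits [x] into its only pair of components,
   [(a * h) * x] in the first subgroup and [- (b * k) * x] in the second. *)
rewrite (_ : [set _ in _ | _] = [set (a * h)%:R * x]) ?cards1 //; apply/setP=> z.
rewrite inE in_set1; apply/andP/eqP => [[zh xzk]|->].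
  apply/eqP; rewrite -subr_eq0; set d := z - _.
  have dh : d \in multiples n h.
    case: sH => _; apply=> //; apply: subg_mul (multiples_subg n_gt1 hn) _.
    by rewrite mem_multiples // dvdn_mull.
  have dk : d \in multiples n k.
    have -> : d = - (x - z) - (b * k)%:R * x + (x - ((a * h)%:R * x - (b * k)%:R * x)).
      by rewrite /d; ring.
    rewrite -mulrBl abE mul1r subrr addr0.
    case: sK => _; apply; first by rewrite subgN //; exact: multiples_subg.
    apply: subg_mul (multiples_subg n_gt1 kn) _; by rewrite mem_multiples // dvdn_mull.
  by rewrite [d]Zn_natE Zn_eq0 // [X in (X %| _)%N]nE Gauss_dvd //; move: dh dk; rewrite !inE => -> ->.
split; first by apply: subg_mul => //; rewrite mem_multiples // dvdn_mull.
have -> : x - (a * h)%:R * x = - ((b * k)%:R * x).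
  have xE : x = (a * h)%:R * x - (b * k)%:R * x by rewrite -mulrBl abE mul1r.
  by rewrite {1}xE; ring.
by rewrite subgN //; apply: subg_mul => //; rewrite mem_multiples // dvdn_mull.
Qed.

(** The case [H = U] is allowed: it gives the S-ring of a single subgroup, which bounds the closure
    when membership in [S] depends on that subgroup only. *)
Lemma chain_colour_Sring H U : is_subgroup H -> is_subgroup U -> H \subset U ->
  Sring (fun x => (x == 0, x \in H, x \in U)).
Proof.
move=> sH sU HU; have /subsetP HUP := HU.
have cc M : (M = H \/ M = U \/ M = setT) ->
   cconst (fun x : R => (x == 0, x \in H, x \in U)) (ind M : A).
  by move=> ME x y [_ xH xU]; rewrite !indE; case: ME => [->|[->|->]]; rewrite ?xH ?xU ?inE.
have cH := cc H (or_introl erefl); have cU := cc U (or_intror (or_introl erefl)).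
have cT := cc setT (or_intror (or_intror erefl)).
apply: (@Sring_span _ _ _ (ind H) (ind U) (ind setT)) => //.
- by move=> x y [x0 _ _]; rewrite !inE.
- by move=> x y [x0 xH xU]; rewrite !oppr_eq0 !subgN ?x0 ?xH ?xU.
- move=> f cf.
  pose rep (P : pred R) : int := if [pick x | P x] is Some x then f x else 0.
  have repE (P : pred R) x : P x -> (forall y, P y ->
      (y == 0, y \in H, y \in U) = (x == 0, x \in H, x \in U)) -> rep P = f x.
    by rewrite /rep; case: pickP => [y Py _ E|/(_ x) -> //]; apply: cf; rewrite E.
  pose vT := rep (fun x => x \notin U); pose vU := rep (fun x => (x \in U) && (x \notin H)).
  pose vH := rep (fun x => (x \in H) && (x != 0)).
  (* The subgroups are nested, so the coefficients are the jumps of [f] from one layer to the next,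
     and their sums telescope. *)
  exists (f 0 - vH), (vH - vU), (vU - vT), vT; apply/ffunP=> x.
  rewrite !galgD !galgZ galg_int !indE inE.
  have [->|x0] := eqVneq x 0.
    have [H0 U0] : 0 \in H /\ 0 \in U by case: sH; case: sU.
    by rewrite H0 U0 /=; ring.
  have n0 y M : is_subgroup M -> y \notin M -> (y == 0) = false.
    by case=> M0 _; case: eqP => // -> ; rewrite M0.
  case: (boolP (x \in H)) => xH.
    rewrite (HUP _ xH) /= (_ : vH = f x); first by ring.
    by apply: repE; rewrite ?xH // => y /andP[yH /negPf ->]; rewrite yH (HUP _ yH) (negPf x0) (HUP _ xH).
  case: (boolP (x \in U)) => xU /=.
    rewrite (_ : vU = f x); first by ring.
    apply: repE; rewrite ?xU // => y /andP[yU yH].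
    by rewrite yU (negPf yH) (n0 y H) // (negPf x0) (negPf xH).
  rewrite (_ : vT = f x); first by ring.
  apply: repE => // y yU; have yH : y \notin H by apply: contra yU; exact: HUP.
  by rewrite (n0 y U) // (negPf yU) (negPf yH) (negPf x0) (negPf xH) (negPf xU).
- by rewrite ind_subgM //; apply: cconstZ.
- by rewrite ind_subgM //; apply: cconstZ.
- by rewrite indTM; apply: cconstZ.
- by rewrite ind_subgM //; apply: cconstZ.
- by rewrite mulrC indTM; apply: cconstZ.
- by rewrite mulrC indTM; apply: cconstZ.
Qed.

End SubgroupIndicators.

(** * Counting common neighbours *)

Section CommonNeighbourCounts.
Variables (n : nat) (n_gt1 : (1 < n)%N).
Local Notation R := 'Z_n.
Local Notation A := (galg int R).
Implicit Types (H K U S : {set R}) (x y : R).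

(* For S = - S this is the number of common neighbours of 0 and x in Cay(Z_n, S). *)
Definition cn S x := #|[set z in S | x - z \in S]|.

Lemma cnE S x : (cn S x)%:Z = (ind S * ind S : A) x.
Proof. by rewrite indM natz. Qed.

Lemma ind_setD H U : H \subset U -> ind (U :\: H) = ind U - ind H :> A.
Proof.
move=> /subsetP HU; apply/ffunP=> x; rewrite galgD galgN !indE in_setD.
by case: (boolP (x \in H)) => [/HU ->|] //=; rewrite ?subr0 ?subrr.
Qed.

Lemma ind_setT_sub H : ind (~: H) = ind setT - ind H :> A.
Proof. by rewrite -setTD ind_setD ?subsetT. Qed.

Lemma ind_setU H K : [disjoint H & K] -> ind (H :|: K) = ind H + ind K :> A.
Proof.
move=> HK; apply/ffunP=> x; rewrite galgD !indE in_setU.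
case: (boolP (x \in H)) => [xH|] /=; last by rewrite add0r.
by rewrite (disjointFr HK xH) addr0.
Qed.

Lemma ind_set0 : ind [set 0] = 1 :> A.
Proof. by apply/ffunP=> x; rewrite indE galg1 inE. Qed.

Lemma ind_setD0 H : 0 \in H -> ind (H :\ 0) = ind H - 1 :> A.
Proof. by move=> H0; rewrite ind_setD ?ind_set0 // sub1set. Qed.

Lemma ind_TT : ind setT * ind setT = (n%:Z)%:~R * ind setT :> A.
Proof. by rewrite indTM cardsT Zn_card. Qed.

Section Chain.
Variables H U : {set R}.
Hypotheses (sH : is_subgroup H) (sU : is_subgroup U) (HU : H \subset U).
Let HH : ind H * ind H = (#|H|%:Z)%:~R * ind H :> A. Proof. exact: ind_subgM. Qed.
Let UU : ind U * ind U = (#|U|%:Z)%:~R * ind U :> A. Proof. exact: ind_subgM. Qed.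
Let HUm : ind H * ind U = (#|H|%:Z)%:~R * ind U :> A. Proof. exact: ind_subgM. Qed.

(** Nested subgroup indicators multiply to multiples of the larger one, so the square expands
    linearly. The value on the middle layer agrees with the value 0 outside [U] exactly when the
    index of [H] in [U] is 2. *)
Lemma cn_chain_mid x :
  (cn (U :\: H) x)%:Z = (#|U|%:Z - 2 * #|H|%:Z) * (x \in U)%:R + #|H|%:Z * (x \in H)%:R.
Proof.
rewrite cnE ind_setD //; have -> : (ind U - ind H) * (ind U - ind H)
    = (#|U|%:Z - 2 * #|H|%:Z)%:~R * ind U + (#|H|%:Z)%:~R * ind H :> A.
  transitivity (ind U * ind U - 2%:R * (ind H * ind U) + ind H * ind H : A); first by ring.
  by rewrite UU HUm HH; ring.
by rewrite galgD !galgZ !indE.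
Qed.

Lemma cn_chain_ends x :
  (cn (~: U :|: (H :\ 0)) x)%:Z = (n%:Z - 2 * #|U|%:Z + 2 * #|H|%:Z - 2)
     + (#|U|%:Z - 2 * #|H|%:Z + 2) * (x \in U)%:R + (#|H|%:Z - 2) * (x \in H)%:R + (x == 0)%:R.
Proof.
have dis : [disjoint ~: U & H :\ 0].
  rewrite disjoint_sym disjoints_subset setCK; apply: subset_trans HU.
  exact: subsetDl.
rewrite cnE ind_setU // ind_setT_sub ind_setD0; last by case: sH.
have -> : (ind setT - ind U + (ind H - 1)) * (ind setT - ind U + (ind H - 1))
    = (n%:Z - 2 * #|U|%:Z + 2 * #|H|%:Z - 2)%:~R * ind setT
     + (#|U|%:Z - 2 * #|H|%:Z + 2)%:~R * ind U + (#|H|%:Z - 2)%:~R * ind H + 1 :> A.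
  transitivity (ind setT * ind setT + ind U * ind U + ind H * ind H + 1
    - 2%:R * (ind setT * ind U) + 2%:R * (ind setT * ind H) - 2%:R * ind setT
    - 2%:R * (ind H * ind U) + 2%:R * ind U - 2%:R * ind H : A); first by ring.
  by rewrite ind_TT UU HUm HH !indTM; ring.
by rewrite !galgD !galgZ galg1 !indE inE mulr1.
Qed.
End Chain.

Section Tensor.
Variables h k : nat.
Hypotheses (nE : n = (h * k)%N) (co : coprime h k).
Local Notation H := (multiples n h).
Local Notation K := (multiples n k).
Let hn : (h %| n)%N. Proof. by rewrite nE dvdn_mulr. Qed.
Let kn : (k %| n)%N. Proof. by rewrite nE dvdn_mull. Qed.
Let h0 : (0 < h)%N. Proof. by apply: dvdn_gt0 hn; exact: n_gt0. Qed.
Let k0 : (0 < k)%N. Proof. by apply: dvdn_gt0 kn; exact: n_gt0. Qed.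
Let cH : #|H| = k. Proof. by rewrite card_multiples // nE mulKn. Qed.
Let cK : #|K| = h. Proof. by rewrite card_multiples // nE mulnK. Qed.
Let HH : ind H * ind H = (k%:Z)%:~R * ind H :> A.
Proof. by have sH := multiples_subg n_gt1 hn; rewrite ind_subgM // cH. Qed.
Let KK : ind K * ind K = (h%:Z)%:~R * ind K :> A.
Proof. by have sK := multiples_subg n_gt1 kn; rewrite ind_subgM // cK. Qed.
Let HK : ind H * ind K = ind setT :> A. Proof. exact: ind_coprimeM. Qed.
Let TH : ind setT * ind H = (k%:Z)%:~R * ind setT :> A.
Proof. by rewrite indTM cH. Qed.
Let TK : ind setT * ind K = (h%:Z)%:~R * ind setT :> A.
Proof. by rewrite indTM cK. Qed.

Lemma multiplesI0 x : (x \in H) && (x \in K) = (x == 0).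
Proof.
rewrite !inE -Gauss_dvd // -nE {2}[x]Zn_natE Zn_eq0 //.
Qed.

Let indHK : ind (H :|: K) = ind H + ind K - 1 :> A.
Proof.
apply/ffunP=> x; rewrite !galgD galgN galg1 !indE in_setU -multiplesI0.
by case: (x \in H); case: (x \in K).
Qed.

(** The nonzero values are [(h - 1) * (k - 2)] on [H], [(h - 2) * (k - 1)] on [K] and
    [(h - 2) * (k - 2)] elsewhere; two of them agree only if [h = k], [k = 2] or [h = 2]. *)
Lemma cn_tensor_generic x : (cn (~: (H :|: K)) x)%:Z = ((h%:Z - 2) * (k%:Z - 2))
    + (k%:Z - 2) * (x \in H)%:R + (h%:Z - 2) * (x \in K)%:R + (x == 0)%:R.
Proof.
rewrite cnE ind_setT_sub indHK.
have -> : (ind setT - (ind H + ind K - 1)) * (ind setT - (ind H + ind K - 1))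
    = ((h%:Z - 2) * (k%:Z - 2))%:~R * ind setT + (k%:Z - 2)%:~R * ind H
     + (h%:Z - 2)%:~R * ind K + 1 :> A.
  transitivity (ind setT * ind setT + ind H * ind H + ind K * ind K + 1
    - 2%:R * (ind setT * ind H) - 2%:R * (ind setT * ind K) + 2%:R * ind setT
    + 2%:R * (ind H * ind K) - 2%:R * ind H - 2%:R * ind K : A); first by ring.
  have nz : n%:Z = h%:Z * k%:Z by rewrite nE PoszM.
  by rewrite ind_TT TH TK HH KK HK [n%:Z]nz; ring.
by rewrite !galgD !galgZ galg1 !indE inE mulr1.
Qed.

(** The rook's graph, with nonzero values [k - 2] on [H], [h - 2] on [K] and 2 elsewhere. This is
    the origin of the factor 4 in the first family. *)
Lemma cn_tensor_rook x : (cn ((H :|: K) :\ 0) x)%:Z = 2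
    + (k%:Z - 4) * (x \in H)%:R + (h%:Z - 4) * (x \in K)%:R + 4 * (x == 0)%:R.
Proof.
rewrite cnE ind_setD0 ?indHK; last by rewrite in_setU !inE dvdn0.
have -> : (ind H + ind K - 1 - 1) * (ind H + ind K - 1 - 1)
    = 2%:~R * ind setT + (k%:Z - 4)%:~R * ind H
     + (h%:Z - 4)%:~R * ind K + 4%:~R * 1 :> A.
  transitivity (ind H * ind H + ind K * ind K + 4%:R
    + 2%:R * (ind H * ind K) - 4%:R * ind H - 4%:R * ind K : A); first by ring.
  by rewrite HH KK HK; ring.
by rewrite !galgD !galgZ galg1 !indE inE !mulr1.
Qed.
End Tensor.

End CommonNeighbourCounts.

Section PaleyCounts.
Variables (n : nat) (n_gt1 : (1 < n)%N) (p : nat) (p_pr : prime p).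
Variables (g : 'F_p) (gP : (#|'F_p|.-1).-primitive_root g).
Hypotheses (L2 : (2 %| #|'F_p|.-1)%N) (N1 : -1 \in cyc g 2 0).
Local Notation A := (galg int 'Z_n).

(** The equation of the Paley graph as a strongly regular graph, the same for residues and
    non-residues. *)
Lemma quadratic_pm r : exists mu : nat, [/\ p = (4 * mu + 1)%N, #|cyc g 2 r| = (2 * mu)%N &
  ind (cyc g 2 r) * ind (cyc g 2 r) = (2 * mu%:Z)%:~R * 1 + (mu%:Z)%:~R * (ind setT - 1)
   + (-1)%:~R * ind (cyc g 2 r) :> galg int 'F_p].
Proof.
have [mu [pE c0 c1 E0 E1]] := quadratic_numbers gP L2 N1.
rewrite card_Fp // in pE; exists mu.
have -> : cyc g 2 r = cyc g 2 (r %% 2) by apply: cyc_mod; rewrite modn_mod.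
have r2 : (r %% 2 < 2)%N by rewrite ltn_mod.
rewrite (setT_cyc2 gP L2); case: (r %% 2)%N r2 => [|[|//]] _; split=> //.
  by rewrite E0; ring.
by rewrite E1; ring.
Qed.

Section PaleyOnSubgroup.
Variables (l : nat) (nE : n = (l * pdiv p)%N) (r : nat).
Local Notation U := (multiples n l).
Local Notation S0 := [set subZ n (pdiv p) l x | x in cyc g 2 r].

Lemma S0_subU : S0 \subset U.
Proof. by apply/subsetP=> _ /imsetP[x _ ->]; exact: (subZ_mem n_gt1 nE). Qed.

Lemma paley_sub_sqr : exists mu : nat, [/\ p = (4 * mu + 1)%N,
  ind U * ind S0 = (2 * mu%:Z)%:~R * ind U :> A,
  ind setT * ind S0 = (2 * mu%:Z)%:~R * ind setT :> A &
  ind S0 * ind S0 = (2 * mu%:Z)%:~R * 1 + (mu%:Z)%:~R * (ind U - 1) + (-1)%:~R * ind S0 :> A].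
Proof.
have [mu [pE cE E]] := quadratic_pm r; exists mu.
have p1 := pdiv_gt1 p_pr.
have subI := @galg_sub_ind n n_gt1 (pdiv p) l p1 nE.
have UE : galg_sub n (pdiv p) l (ind setT) = ind U.
  rewrite subI; congr ind; apply/setP=> y; apply/imsetP/idP => [[x _ ->]|].
    exact: (subZ_mem n_gt1 nE).
  by move=> /(subZ_surj n_gt1 p1 nE)[x ->]; exists x.
have card0 : #|S0| = (2 * mu)%N.
  by rewrite card_imset //; exact: (subZ_inj n_gt1 p1 nE).
split=> //.
- rewrite -UE -subI -(galg_subM n_gt1 p1 nE); rewrite (@indTM 'F_p) cE.
  by rewrite (galg_subZ n_gt1 p1 nE).
- by rewrite indTM card0.
have D := galg_subD; have Z := galg_subZ n_gt1 p1 nE.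
have mE (f : A) : f - 1 = f + (-1)%:~R * 1 by ring.
have mE' (f : galg int 'F_p) : f - 1 = f + (-1)%:~R * 1 by ring.
by rewrite -UE -subI -(galg_subM n_gt1 p1 nE) E mE mE' !D !Z (galg_sub1 n_gt1 p1 nE) D Z (galg_sub1 n_gt1 p1 nE).
Qed.

Let cardU : #|U| = p.
Proof.
have l0 : (0 < l)%N by case: (l) nE n_gt1 => // ->.
by rewrite card_multiples // nE ?dvdn_mulr // mulKn // pdiv_id.
Qed.

(** The values are [mu - 1] on [S0], [mu] on the rest of the subgroup and 0 outside. They coincide
    only for [mu = 1], that is for the pentagon. *)
Lemma cn_paley_inside : exists2 mu : nat, p = (4 * mu + 1)%N &
  forall x, x != 0 -> (cn S0 x)%:Z = mu%:Z * (x \in U)%:R - (x \in S0)%:R.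
Proof.
have [mu [pE _ _ E]] := paley_sub_sqr; exists mu => // x x0.
rewrite cnE E mulr1 !galgD !galgZ !galgD galg_int galgN galg1 !indE (negPf x0) /=; ring.
Qed.

(** Relative to the value outside [U], the counts are [mu] on [S0] and [mu + 1] on the rest of [U]:
    never two equal. *)
Lemma cn_paley_outside : exists2 mu : nat, p = (4 * mu + 1)%N &
  forall x, x != 0 -> (cn (~: U :|: S0) x)%:Z =
     n%:Z - p%:Z - 1 + (mu%:Z + 1) * (x \in U)%:R - (x \in S0)%:R.
Proof.
have [mu [pE US TS E]] := paley_sub_sqr; exists mu => // x x0.
have dis : [disjoint ~: U & S0].
  by rewrite disjoint_sym disjoints_subset setCK; exact: S0_subU.
have ln : (l %| n)%N by rewrite nE dvdn_mulr.
have sU := multiples_subg n_gt1 ln.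
have UU : ind U * ind U = (p%:Z)%:~R * ind U :> A by rewrite ind_subgM // cardU.
have TU : ind setT * ind U = (p%:Z)%:~R * ind setT :> A by rewrite indTM cardU.
rewrite cnE ind_setU // ind_setT_sub.
have -> : (ind setT - ind U + ind S0) * (ind setT - ind U + ind S0)
   = (n%:Z - p%:Z - 1)%:~R * ind setT + (mu%:Z + 1)%:~R * ind U + (mu%:Z)%:~R * 1
     + (-1)%:~R * ind S0 :> A.
  transitivity (ind setT * ind setT + ind U * ind U + ind S0 * ind S0
    - 2%:R * (ind setT * ind U) + 2%:R * (ind setT * ind S0) - 2%:R * (ind U * ind S0) : A).
    by ring.
  have pz : p%:Z = 4 * mu%:Z + 1 by move: pE; clear; lia.
  by rewrite ind_TT // UU TU TS US E pz; ring.
rewrite mulr1 !galgD !galgZ galg_int !indE inE (negPf x0) /=; ring.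
Qed.

End PaleyOnSubgroup.

Section PaleyOnQuotient.
Variables (h : nat) (nE : n = (pdiv p * h)%N) (r : nat).
Local Notation H := (multiples n (pdiv p)).
Local Notation S0 := [set y : 'Z_n | (Zred (pdiv p) y : 'F_p) \in cyc g 2 r].
Let mn : (pdiv p %| n)%N. Proof. by rewrite nE dvdn_mulr. Qed.
Let p0 : (0 < pdiv p)%N. Proof. exact: ltnW (pdiv_gt1 p_pr). Qed.
Let cardH : #|H| = h. Proof. by rewrite card_multiples // nE mulKn. Qed.

Lemma paley_quo_sqr : exists mu : nat, [/\ p = (4 * mu + 1)%N,
  ind H * ind S0 = (h%:Z)%:~R * ind S0 :> A &
  ind S0 * ind S0 = (h%:Z * (2 * mu%:Z))%:~R * ind H + (h%:Z * mu%:Z)%:~R * (ind setT - ind H)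
     + (- h%:Z)%:~R * ind S0 :> A].
Proof.
have [mu [pE cE E]] := quadratic_pm r; exists mu.
have p1 := pdiv_gt1 p_pr.
have M := galg_quoM n_gt1 p1 mn.
have TE : galg_quo n (pdiv p) (ind setT) = ind setT.
  by apply/ffunP=> y; rewrite galg_quoE !indE !inE.
have HE := galg_quo1 p1 mn.
have D := galg_quoD; have Z := @galg_quoZ n (pdiv p).
split=> //.
- by rewrite -HE -galg_quo_ind M cardH mul1r.
have mE (f g' : A) : f - g' = f + (-1)%:~R * g' by ring.
have mE' (f : galg int 'F_p) : f - 1 = f + (-1)%:~R * 1 by ring.
rewrite -galg_quo_ind M cardH E mE mE' !D !Z D Z HE TE; ring.
Qed.

(** The values [h * (mu - 1)], [h * mu] and [2 * h * mu] are distinct, so Paley graphs with empty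
    fibres contribute no family. *)
Lemma cn_paley_blowup : exists2 mu : nat, p = (4 * mu + 1)%N &
  forall x, x != 0 -> (cn S0 x)%:Z =
    h%:Z * (mu%:Z + mu%:Z * (x \in H)%:R - (x \in S0)%:R).
Proof.
have [mu [pE _ E]] := paley_quo_sqr; exists mu => // x x0.
rewrite cnE E !galgD !galgZ !galgD galgN !indE [_ \in setT]inE /=; ring.
Qed.

(** On [S0] the value exceeds the one on the other class by [h - 2], whereas the value on [H] is
    larger than both. A coincidence means fibres of two points. *)
Lemma cn_paley_clique : exists2 mu : nat, p = (4 * mu + 1)%N &
  forall x, x != 0 -> (cn ((H :\ 0) :|: S0) x)%:Z =
    (h%:Z - 2) * (x \in H)%:R + 2 * (h%:Z - 1) * (x \in S0)%:R
    + h%:Z * (mu%:Z + mu%:Z * (x \in H)%:R - (x \in S0)%:R).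
Proof.
have [mu [pE HS E]] := paley_quo_sqr; exists mu => // x x0.
have sH := multiples_subg n_gt1 mn.
have dis : [disjoint H :\ 0 & S0].
  rewrite -setI_eq0; apply/eqP/setP=> y; rewrite in_set0 in_setI in_setD1.
  apply/negP=> /andP[/andP[_ yH]]; rewrite !inE => /andP[/negP[]].
  by rewrite Zred_eq0 // pdiv_gt1.
have HH : ind H * ind H = (h%:Z)%:~R * ind H :> A by rewrite ind_subgM // cardH.
rewrite cnE ind_setU // ind_setD0; last by case: sH.
have -> : (ind H - 1 + ind S0) * (ind H - 1 + ind S0)
   = (h%:Z - 2)%:~R * ind H + 1 + (2 * (h%:Z - 1))%:~R * ind S0
     + ind S0 * ind S0 :> A.
  transitivity (ind H * ind H + 1 - 2%:R * ind H + 2%:R * (ind H * ind S0)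
    - 2%:R * ind S0 + ind S0 * ind S0 : A); first by ring.
  by rewrite HH HS; ring.
rewrite E !galgD !galgZ !galgD galgN galg1 !indE [_ \in setT]inE (negPf x0) /=; ring.
Qed.

End PaleyOnQuotient.
End PaleyCounts.

Section CubicCounts.
Variables (p : nat) (p_pr : prime p) (g : 'F_p) (gP : (#|'F_p|.-1).-primitive_root g).
Hypothesis L3 : (3 %| #|'F_p|.-1)%N.

Lemma cn_sub n (n_gt1 : (1 < n)%N) l (nE : n = (l * pdiv p)%N) (X : {set 'F_p}) (x : 'F_p) :
  cn [set subZ n (pdiv p) l y | y in X] (subZ n (pdiv p) l x) = @cn (pdiv p) X x.
Proof.
have p1 := pdiv_gt1 p_pr.
apply/eqP; rewrite -eqz_nat !cnE -(galg_sub_ind n_gt1 p1 nE) -(galg_subM n_gt1 p1 nE).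
by rewrite (galg_subE n_gt1 p1 nE).
Qed.

Lemma cn_cubic r : exists B C D : nat,
  [/\ p = (3 * (B + C + D) + 1)%N, cubic_rel B C D &
   forall (x : 'F_p) j, (j < 3)%N -> x \in cyc g 3 (j + r) ->
     (@cn (pdiv p) (cyc g 3 r) x)%:Z = nth 0 [:: D%:Z - 1; B%:Z; C%:Z] j /\
     (@cn (pdiv p) (~: cyc g 3 r :\ 0) x)%:Z
       = nth 0 [:: D%:Z - 1; B%:Z; C%:Z] j + (B + C + D)%:Z - 1 + 2 * (j == 0%N)%:R].
Proof.
have [f [B [C [D [pE cE fE rel [E _ _ _ _]]]]]] := cubic_numbers gP L3.
rewrite card_Fp // in pE; exists B, C, D; split=> //; first by rewrite pE fE.
move=> x j j3 xj.
have sqr : (ind (cyc g 3 r) * ind (cyc g 3 r) : galg int 'F_p) x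
    = nth 0 [:: D%:Z - 1; B%:Z; C%:Z] j.
  have xg : x = x / g ^+ r * g ^+ r by rewrite divfK // genX_neq0.
  have := xj; rewrite xg (cyc_scale gP L3) => yj; rewrite -{1 2}[r]add0n.
  rewrite (cyc_count gP L3) E !galgD !galgZ galg_int !indE.
  have y0 : x / g ^+ r != 0 by move: yj; rewrite inE => /andP[].
  rewrite !(in_cyc3 _ yj) (negPf y0).
  by case: j j3 {xj yj} => [|[|[|]]] //= _; ring.
have x0 : x != 0 by move: xj; rewrite inE => /andP[].
split; first by rewrite (cnE (n := pdiv p)) sqr.
have c0 : 0 \notin cyc g 3 r by rewrite inE eqxx.
rewrite (cnE (n := pdiv p)) ind_setD0; last by rewrite in_setC.
rewrite ind_setT_sub.
have cT : ind setT * ind (cyc g 3 r) = (f%:Z)%:~R * ind setT :> galg int 'F_p.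
  by rewrite (@indTM 'F_p) cE.
have TT : ind setT * ind setT = (p%:Z)%:~R * ind setT :> galg int 'F_p.
  by rewrite (@indTM 'F_p) cardsT card_Fp.
have -> : (ind setT - ind (cyc g 3 r) - 1) * (ind setT - ind (cyc g 3 r) - 1)
   = (p%:Z - 2 * f%:Z - 2)%:~R * ind setT + 1 + 2%:~R * ind (cyc g 3 r)
     + ind (cyc g 3 r) * ind (cyc g 3 r) :> galg int 'F_p.
  transitivity (ind setT * ind setT + 1 - 2%:R * (ind setT * ind (cyc g 3 r))
    - 2%:R * ind setT + 2%:R * ind (cyc g 3 r)
    + ind (cyc g 3 r) * ind (cyc g 3 r) : galg int 'F_p); first by ring.
  by rewrite TT cT; ring.
rewrite !galgD !galgZ galg1 sqr !indE [_ \in setT]inE (negPf x0) (in_cyc3 _ xj).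
rewrite -[X in (_ == X %[mod 3])]add0n eqn_modDr mod0n modn_small // pE fE; lia.
Qed.

End CubicCounts.

Section Families.
Variables (n : nat) (S : {set 'Z_n}).

(* The connection sets, up to isomorphism, of the eight families of the theorem. *)
Definition fam1 := exists m, [/\ n = (4 * m)%N, (1 < m)%N, odd m &
  S = (multiples n 4 :|: multiples n m) :\ 0].
Definition fam2 := exists m, [/\ n = (2 * m)%N, (1 < m)%N, odd m &
  S = ~: (multiples n 2 :|: multiples n m)].
Definition fam3 := exists m (g : 'F_5) r, [/\ n = (m * pdiv 5)%N, (1 < m)%N,
  (#|'F_5|.-1).-primitive_root g & S = [set subZ n (pdiv 5) m x | x in cyc g 2 r]].
Definition fam4 := exists l m, [/\ n = (l * 2 * m)%N, (1 < l)%N, (1 < m)%N &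
  S = multiples n l :\: multiples n (l * 2)].
Definition fam5 := exists l m, [/\ n = (l * m * 2)%N, (1 < l)%N, (1 < m)%N &
  S = ~: multiples n l :|: (multiples n (l * m) :\ 0)].
Definition fam6 := exists p (g : 'F_p) r, [/\ n = (pdiv p * 2)%N, prime p, (p %% 4 = 1)%N,
  (#|'F_p|.-1).-primitive_root g &
  S = (multiples n (pdiv p) :\ 0) :|: [set y | (Zred (pdiv p) y : 'F_p) \in cyc g 2 r]].
Definition fam7 := exists p t (g : 'F_p) r, [/\ n = (1 * pdiv p)%N, prime p, p = (t ^ 2 + 3)%N,
  (3 %| p.-1)%N & (#|'F_p|.-1).-primitive_root g /\
  S = [set subZ n (pdiv p) 1 x | x in cyc g 3 r]].
Definition fam8 := exists p t (g : 'F_p) r, [/\ n = (1 * pdiv p)%N, prime p, p = (t ^ 2 + 12)%N,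
  (3 %| p.-1)%N & (#|'F_p|.-1).-primitive_root g /\
  S = [set subZ n (pdiv p) 1 x | x in ~: cyc g 3 r :\ 0]].
End Families.

(** * From the S-ring and the Deza condition to the eight connection sets *)

Section Forward.
Variables (n : nat) (n_gt1 : (1 < n)%N) (C : eqType) (c : 'Z_n -> C) (Sc : Sring c).
Local Notation R := 'Z_n.
Hypothesis csym : forall x, c (- x) = c x.
Variables x1 x2 x3 : R.
Hypotheses (x1n0 : x1 != 0) (x2n0 : x2 != 0) (x3n0 : x3 != 0).
Hypotheses (c12 : c x1 != c x2) (c13 : c x1 != c x3) (c23 : c x2 != c x3).
Hypothesis c_all : forall x, x != 0 -> [\/ c x = c x1, c x = c x2 | c x = c x3].
Variable S : {set R}.
Hypotheses (cS : cset c S) (S0 : 0 \notin S).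
Hypothesis coarsest : forall (D : eqType) (c' : R -> D), Sring c' -> cset c' S ->
  forall x y, c' x = c' y -> c x = c y.
Hypothesis deza : exists a b, forall x, x != 0 -> cn S x = a \/ cn S x = b.

Lemma deza3 x y z : x != 0 -> y != 0 -> z != 0 ->
  [\/ (cn S x)%:Z = (cn S y)%:Z, (cn S x)%:Z = (cn S z)%:Z | (cn S y)%:Z = (cn S z)%:Z].
Proof.
have [a [b ab]] := deza => /ab[] -> /ab[] -> /ab[] ->;
  by [constructor 1|constructor 2|constructor 3].
Qed.

(** The S-ring with colours 0, the rest of [M] and the complement of [M] would contain [S], so by
    [coarsest] the closure would have at most two nonzero colours instead of three. *)
Lemma not_subgroup_set M : is_subgroup M ->
  (forall x y, x != 0 -> y != 0 -> (x \in M) = (y \in M) -> (x \in S) = (y \in S)) -> False.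
Proof.
move=> sM MS; have SM := chain_colour_Sring sM sM (subxx M).
have cM : forall x y, x != 0 -> y != 0 -> (x \in M) = (y \in M) -> c x = c y.
  move=> x y x0 y0 xy; apply: (coarsest SM); last by rewrite xy (negPf x0) (negPf y0).
  move=> u v [uv uvM _]; have [u0|u0] := eqVneq u 0.
    by move: uv; rewrite u0 eqxx => /esym/eqP ->.
  by apply: MS => //; rewrite -uv.
have n12 : (x1 \in M) <> (x2 \in M) by move/(cM _ _ x1n0 x2n0)/eqP; rewrite (negPf c12).
have n13 : (x1 \in M) <> (x3 \in M) by move/(cM _ _ x1n0 x3n0)/eqP; rewrite (negPf c13).
have n23 : (x2 \in M) <> (x3 \in M) by move/(cM _ _ x2n0 x3n0)/eqP; rewrite (negPf c23).
by move: n12 n13 n23; do 3 case: (_ \in M).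
Qed.

Lemma forward_tensor h k : cTensor c h k -> fam1 S \/ fam2 S.
Proof.
move=> [nE co h1 k1 cE].
have hn : (h %| n)%N by rewrite nE dvdn_mulr.
have kn : (k %| n)%N by rewrite nE dvdn_mull.
have h0 := ltnW h1; have k0 := ltnW k1.
have sH := multiples_subg n_gt1 hn; have sK := multiples_subg n_gt1 kn.
have kh : ~~ (h %| k)%N by apply/negP=> hk; move: co; rewrite /coprime (gcdn_idPl hk) => /eqP E; rewrite E in h1.
have hk : ~~ (k %| h)%N by apply/negP=> kh'; move: co; rewrite /coprime (gcdn_idPr kh') => /eqP E; rewrite E in k1.
have hH : (h%:R : R) \in multiples n h by rewrite mem_multiples.
have hK : (h%:R : R) \notin multiples n k by rewrite mem_multiples.
have kK : (k%:R : R) \in multiples n k by rewrite mem_multiples.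
have kH : (k%:R : R) \notin multiples n h by rewrite mem_multiples.
have oH : (1 : R) \notin multiples n h by rewrite -[1]/(1%:R) mem_multiples // dvdn1 neq_ltn h1 orbT.
have oK : (1 : R) \notin multiples n k by rewrite -[1]/(1%:R) mem_multiples // dvdn1 neq_ltn k1 orbT.
have ne0 w M : is_subgroup M -> w \notin M -> w != 0 :> R.
  by case=> M0 _; apply: contraNneq => ->.
have hn0 := ne0 _ _ sK hK; have kn0 := ne0 _ _ sH kH; have on0 := ne0 _ _ sK oK.
have I0 := @multiplesI0 n n_gt1 h k nE co.
have memS x : x != 0 -> (x \in S) = if x \in multiples n h then h%:R \in S else
   if x \in multiples n k then k%:R \in S else 1 \in S.
  move=> x_n0; have := I0 x; rewrite (negPf x_n0).
  case: (boolP (x \in multiples n h)) => xH; case: (boolP (x \in multiples n k)) => xK //= _;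
   by apply: cS; apply/eqP; rewrite cE ?xH ?xK ?(negPf xH) ?(negPf xK) ?hH ?kK ?(negPf hK)
     ?(negPf kH) ?(negPf oH) ?(negPf oK).
have SH f : (forall x, x != 0 -> (x \in S) = f (x \in multiples n h)) -> False.
  by move=> E; apply: (not_subgroup_set sH) => x y x0 y0 xy; rewrite !E // xy.
have SK f : (forall x, x != 0 -> (x \in S) = f (x \in multiples n k)) -> False.
  by move=> E; apply: (not_subgroup_set sK) => x y x0 y0 xy; rewrite !E // xy.
(* Of the eight unions of colours, six depend on membership in only one of the subgroups; there
   remain the union of the two subgroups without 0, and its complement. *)
case bh: (h%:R \in S) memS; case bk: (k%:R \in S); case bo: (1 \in S) => memS.
- by case: (SH (fun=> true)) => x /memS ->; do ?case: ifP.
- have SE : S = (multiples n h :|: multiples n k) :\ 0.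
    apply/setP=> x; rewrite in_setD1 in_setU; have [->|x0] := eqVneq x 0; first by rewrite (negPf S0).
    by rewrite memS //=; do 2 case: (_ \in _).
  have E x (x0 : x != 0) := cn_tensor_rook n_gt1 nE co x.
  have := deza3 hn0 kn0 on0; rewrite SE !E // hH kK (negPf hK) (negPf kH) (negPf oH) (negPf oK).
  rewrite (negPf hn0) (negPf kn0) (negPf on0) => D.
  have h4k4 : (h = 4 \/ k = 4)%N.
    case: D => /= D; last 2 first.
    - by right; clear -D; lia.
    - by left; clear -D; lia.
    have hk_eq : h = k by clear -D; lia.
    by move: hk; rewrite hk_eq dvdnn.
  left; case: h4k4 => E4.
    exists k; split=> //; first by rewrite [LHS]nE E4.
      by move: co; rewrite E4 (_ : 4 = 2 ^ 2)%N // coprime_pexpl // coprime2n.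
    by rewrite E4.
  exists h; split=> //; first by rewrite [LHS]nE E4 mulnC.
    by move: co; rewrite E4 (_ : 4 = 2 ^ 2)%N // coprime_pexpr // coprimen2.
  by rewrite E4 setUC.
- by case: (SK negb) => x x0; rewrite memS //; have := I0 x; rewrite (negPf x0); do 2 case: (_ \in _).
- by case: (SH id) => x /memS ->; do ?case: ifP.
- by case: (SH negb) => x /memS ->; do ?case: ifP.
- by case: (SK id) => x x0; rewrite memS //; have := I0 x; rewrite (negPf x0); do 2 case: (_ \in _).
- have SE : S = ~: (multiples n h :|: multiples n k).
    apply/setP=> x; rewrite in_setC in_setU; have [->|x0] := eqVneq x 0.
      by rewrite (negPf S0) inE dvdn0.
    by rewrite memS //=; do 2 case: (_ \in _).
  have E x (x0 : x != 0) := cn_tensor_generic n_gt1 nE co x.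
  have := deza3 hn0 kn0 on0; rewrite SE !E // hH kK (negPf hK) (negPf kH) (negPf oH) (negPf oK).
  rewrite (negPf hn0) (negPf kn0) (negPf on0) => D.
  have h2k2 : (h = 2 \/ k = 2)%N.
    case: D => /= D; last 2 first.
    - by right; clear -D; lia.
    - by left; clear -D; lia.
    have hk_eq : h = k by clear -D; lia.
    by move: hk; rewrite hk_eq dvdnn.
  right; case: h2k2 => E2.
    exists k; split=> //; first by rewrite [LHS]nE E2.
      by move: co; rewrite E2 coprime2n.
    by rewrite E2.
  exists h; split=> //; first by rewrite [LHS]nE E2 mulnC.
    by move: co; rewrite E2 coprimen2.
  by rewrite E2 setUC.
- by case: (SH (fun=> false)) => x /memS ->; do ?case: ifP.
Qed.

Lemma forward_chain l m h : cChain c l m h -> fam4 S \/ fam5 S.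
Proof.
move=> [nE l1 m1 h1 cE].
have l0 := ltnW l1; have m0 := ltnW m1; have h0 := ltnW h1.
have lmn : (l * m %| n)%N by rewrite nE dvdn_mulr.
have ln : (l %| n)%N by apply: dvdn_trans lmn; rewrite dvdn_mulr.
have sH := multiples_subg n_gt1 lmn; have sU := multiples_subg n_gt1 ln.
have HU : multiples n (l * m) \subset multiples n l by rewrite multiples_sub // dvdn_mulr.
have cardU : #|multiples n l| = (m * h)%N by rewrite card_multiples // nE -mulnA mulKn.
have cardH : #|multiples n (l * m)| = h by rewrite card_multiples // nE mulKn // muln_gt0 l0.
set H := multiples n (l * m) in sH HU cardH cE *; set U := multiples n l in sU HU cardU cE *.
have aH : ((l * m)%:R : R) \in H by rewrite mem_multiples.
have aU := subsetP HU _ aH.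
have a0 : ((l * m)%:R : R) != 0.
  rewrite Zn_eq0 // nE -[X in (_ %| X)%N]muln1 dvdn_pmul2l ?muln_gt0 ?l0 //.
  by rewrite dvdn1 neq_ltn h1 orbT.
have bU : (l%:R : R) \in U by rewrite mem_multiples.
have bH : (l%:R : R) \notin H.
  rewrite mem_multiples // -[X in (_ %| X)%N]muln1 dvdn_pmul2l //.
  by rewrite dvdn1 neq_ltn m1 orbT.
have dU : (1 : R) \notin U by rewrite -[1]/(1%:R) mem_multiples // dvdn1 neq_ltn l1 orbT.
have dH : (1 : R) \notin H by apply: contra dU; apply: (subsetP HU).
have ne0 w M : is_subgroup M -> w \notin M -> w != 0 :> R.
  by case=> M0 _; apply: contraNneq => ->.
have b0 := ne0 _ _ sH bH; have d0 := ne0 _ _ sH dH.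
have HUx x : (x \in H) = true -> x \in U by move/(subsetP HU).
have memS x : x != 0 -> (x \in S) = if x \in H then (l * m)%:R \in S else
   if x \in U then l%:R \in S else 1 \in S.
  move=> x_n0; case xH: (x \in H); last case xU: (x \in U);
   by apply: cS; apply/eqP; rewrite cE ?xH ?xU ?(HUx _ xH) ?aH ?aU ?bU ?(negPf bH) ?(negPf dH)
     ?(negPf dU) (negPf x_n0) ?(negPf a0) ?(negPf b0) ?(negPf d0).
have SH f : (forall x, x != 0 -> (x \in S) = f (x \in H)) -> False.
  by move=> E; apply: (not_subgroup_set sH) => x y x0 y0 xy; rewrite !E // xy.
have SU f : (forall x, x != 0 -> (x \in S) = f (x \in U)) -> False.
  by move=> E; apply: (not_subgroup_set sU) => x y x0 y0 xy; rewrite !E // xy.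
(* Again six unions depend on one member of the chain; what remains is the middle layer, or the two
   outer layers together. *)
case ba: ((l * m)%:R \in S) memS; case bb: (l%:R \in S); case bd: (1 \in S) => memS.
- by case: (SH (fun=> true)) => x /memS ->; do ?case: ifP.
- by case: (SU id) => x /memS ->; case: ifP => [/HUx ->|_] //; case: ifP.
- have SE : S = ~: U :|: (H :\ 0).
    apply/setP=> x; rewrite in_setU in_setC in_setD1; have [->|x0] := eqVneq x 0.
      by rewrite (negPf S0); case: sU => ->.
    by rewrite memS //=; case: ifP => [/HUx ->|_] //; case: ifP.
  have E x (x0 : x != 0) := cn_chain_ends n_gt1 sH sU HU x.
  have := deza3 a0 b0 d0; rewrite SE !E // aH aU bU (negPf bH) (negPf dH) (negPf dU).
  rewrite (negPf a0) (negPf b0) (negPf d0) cardU cardH => D.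
  have nn : n%:Z = l%:Z * m%:Z * h%:Z by rewrite nE !PoszM.
  (* Above the common base the counts are [m * h - h], [m * h - 2 * h + 2] and 0, and for [m > 1]
     only the first two can be equal. *)
  right; have h2 : h = 2%N by clear -D nn l0 m0 h0 l1 m1 h1; case: D => /= D; nia.
  by exists l, m; split=> //; rewrite -h2.
- by case: (SH id) => x /memS ->; do ?case: ifP.
- by case: (SH negb) => x /memS ->; do ?case: ifP.
- have SE : S = U :\: H.
    apply/setP=> x; rewrite in_setD; have [->|x0] := eqVneq x 0.
      by rewrite (negPf S0); case: sH => ->.
    by rewrite memS //=; case: ifP => //=; case: ifP.
  have E x (x0 : x != 0) := cn_chain_mid sH sU HU x.
  have := deza3 a0 b0 d0; rewrite SE !E // aH aU bU (negPf bH) (negPf dH) (negPf dU).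
  rewrite cardU cardH => D.
  (* The counts are [m * h - h], [m * h - 2 * h] and 0, and only the last two can be equal. *)
  left; have m2 : m = 2%N by clear -D l0 m0 h0 l1 m1 h1; case: D => /= D; nia.
  by exists l, h; split=> //; rewrite /H -?m2.
- by case: (SU negb) => x /memS ->; case: ifP => [/HUx ->|_] //; case: ifP.
- by case: (SH (fun=> false)) => x /memS ->; do ?case: ifP.
Qed.

Lemma lg_one p (g : 'F_p) d : (#|'F_p|.-1).-primitive_root g -> (d %| #|'F_p|.-1)%N ->
  lg g 1 = 0 %[mod d].
Proof. by move=> gP dL; apply/eqP; have := mem_cyc gP dL 0 0; rewrite expr0 eqxx inE => /andP[]. Qed.

Lemma lg_gen p (g : 'F_p) d k : (#|'F_p|.-1).-primitive_root g -> (d %| #|'F_p|.-1)%N ->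
  lg g (g ^+ k) = k %[mod d].
Proof. by move=> gP dL; apply/eqP; have := mem_cyc gP dL k k; rewrite eqxx inE => /andP[]. Qed.

Lemma bool_mod2 (b : nat -> bool) : b 0%N != b 1%N -> (forall k, b (k %% 2)%N = b k) ->
  exists r, forall k, b k = (k == r %[mod 2]).
Proof.
move=> b01 bm; exists (~~ b 0%N : nat) => k; rewrite -bm -[in RHS](modn_mod k).
have : (k %% 2 < 2)%N by rewrite ltn_mod.
by case: (k %% 2)%N => [|[|//]] _; move: b01; case: (b 0%N); case: (b 1%N).
Qed.

Lemma forward_paley_sub l p : cPaleySub c l p -> fam3 S.
Proof.
move=> [nE l1 p_pr L2 [cU mono gE]].
have [g gP] := finField_primitive 'F_p; have {}gE := gE g gP.
have p1 := pdiv_gt1 p_pr.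
have ln : (l %| n)%N by rewrite nE dvdn_mulr.
have sU := multiples_subg n_gt1 ln.
pose io := subZ n (pdiv p) l.
have ioU x : io x \in multiples n l by exact: (subZ_mem n_gt1 nE).
have io0 x : (io x == 0) = (x == 0).
  by rewrite -(subZ0 n (pdiv p) l) (inj_eq (subZ_inj n_gt1 p1 nE)).
(* Here the symmetry of the colours is used: -1 has the colour of 1, so it is a square. *)
have N1 : -1 \in cyc g 2 0.
  have n10 : (-1 : 'F_p) != 0 by rewrite oppr_eq0 oner_eq0.
  rewrite inE n10 -(lg_one gP L2) -gE ?oner_eq0 //.
  by rewrite (subZN n_gt1 p1 nE) csym eqxx.
have dU : (1 : R) \notin multiples n l by rewrite -[1]/(1%:R) mem_multiples // dvdn1 neq_ltn l1 orbT.
pose b k := io (g ^+ k) \in S.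
have bm k : b (k %% 2)%N = b k.
  apply: cS; apply/eqP; rewrite gE ?(genX_neq0 gP) //.
  by rewrite !(lg_gen _ gP L2) modn_mod.
have inS x : x != 0 -> (io x \in S) = b (lg g x) by move=> x0; rewrite /b lgK.
have out x : x \notin multiples n l -> (x \in S) = (1 \in S).
  by move=> xU; apply/cS/mono.
have [b01|b01] := eqVneq (b 0%N) (b 1%N).
  case: (not_subgroup_set sU) => x y x0 y0 xyU.
  case: (boolP (x \in multiples n l)) (xyU) => xU /esym yU; last first.
    by rewrite !out ?yU.
  have [u xE] := subZ_surj n_gt1 p1 nE xU; have [v yE] := subZ_surj n_gt1 p1 nE yU.
  have u0 : u != 0 by rewrite -io0 -/(io u) /io -xE.
  have v0 : v != 0 by rewrite -io0 -/(io v) /io -yE.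
  have b1 k : b k = b 0%N.
    by rewrite -bm; case: (k %% 2)%N (ltn_pmod k (isT : 0 < 2)%N) => [|[|]].
  by rewrite xE yE !inS // !b1.
have [r rE] := bool_mod2 b01 bm.
have inS' x : (io x \in S) = (x \in cyc g 2 r).
  have [->|x0] := eqVneq x 0; last by rewrite inS // rE inE x0.
  by rewrite /io subZ0 (negPf S0) inE eqxx.
pose T0 := [set io x | x in cyc g 2 r].
have T0P x : (io x \in T0) = (x \in cyc g 2 r) by rewrite (mem_imset _ _ (subZ_inj n_gt1 p1 nE)).
have T0U x : x \notin multiples n l -> x \notin T0.
  by apply: contra => /imsetP[y _ ->].
have mc k : (g ^+ k \in cyc g 2 r) = (k == r %[mod 2]) by rewrite (mem_cyc gP L2).
have n1 : io (g ^+ r) != 0 by rewrite io0 (genX_neq0 gP).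
have n2 : io (g ^+ r.+1) != 0 by rewrite io0 (genX_neq0 gP).
have n3 : (1 : R) != 0 by exact: oner_neq0.
have i1 : io (g ^+ r) \in T0 by rewrite T0P mc eqxx.
have i2 : io (g ^+ r.+1) \notin T0 by rewrite T0P mc -addn1 -[X in _ == X %[mod _]]addn0 eqn_modDl.
have i3 := T0U _ dU.
have := deza3 n1 n2 n3; case b1: (1 \in S).
  have SE : S = ~: multiples n l :|: T0.
    apply/setP=> x; rewrite in_setU in_setC; case: (boolP (x \in multiples n l)) => xU /=.
      have [u ->] := subZ_surj n_gt1 p1 nE xU.
      by rewrite -/(io u) inS' T0P.
    by rewrite out.
  have [mu pE E] := cn_paley_outside n_gt1 p_pr gP L2 N1 nE r.
  rewrite SE !E // i1 (negPf i2) (negPf i3) !ioU (negPf dU) => D.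
  have mu0 : (0 < mu)%N by move: pE (prime_gt1 p_pr); clear; lia.
  by exfalso; clear -D mu0; case: D => /= D; lia.
have SE : S = T0.
  apply/setP=> x; case: (boolP (x \in multiples n l)) => xU /=.
    have [u ->] := subZ_surj n_gt1 p1 nE xU.
    by rewrite -/(io u) inS' T0P.
  by rewrite out // (negPf (T0U _ xU)).
have [mu pE E] := cn_paley_inside n_gt1 p_pr gP L2 N1 nE r.
rewrite SE !E // i1 (negPf i2) (negPf i3) !ioU (negPf dU) => D.
have p5 : p = 5%N.
  have mu0 : (0 < mu)%N by move: pE (prime_gt1 p_pr); clear; lia.
  by clear -D mu0 pE; case: D => /= D; lia.
(* The type ['F_p] depends on [p], so the equation with 5 is substituted in a statement where the
   modulus is a variable. *)
have fam3_of q (f : 'F_q) : q = 5%N -> n = (l * pdiv q)%N -> (#|'F_q|.-1).-primitive_root f ->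
    fam3 [set subZ n (pdiv q) l x | x in cyc f 2 r].
  by move=> q5; subst q => nE' fP; exists l, f, r.
exact: (fam3_of p g p5 nE gP).
Qed.

Lemma forward_paley_quo h p : cPaleyQuo c h p -> fam6 S.
Proof.
move=> [nE h1 p_pr L2 [cH H1 gE]].
have [g gP] := finField_primitive 'F_p; have {}gE := gE g gP.
have p1 := pdiv_gt1 p_pr.
have pn : (pdiv p %| n)%N by rewrite nE dvdn_mulr.
have sH := multiples_subg n_gt1 pn.
pose pr (x : R) : 'F_p := Zred (pdiv p) x.
pose li (x : 'F_p) : R := Zred n x.
have prli x : pr (li x) = x by exact: Zred_lift.
have pr0 x : (pr x == 0) = (x \in multiples n (pdiv p)) by exact: Zred_eq0.
have liH k : li (g ^+ k) \notin multiples n (pdiv p) by rewrite -pr0 prli (genX_neq0 gP).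
have li0 k : li (g ^+ k) != 0 by apply: contraNneq (liH k) => ->; case: sH.
have N1 : -1 \in cyc g 2 0.
  have n10 : (-1 : 'F_p) != 0 by rewrite oppr_eq0 oner_eq0.
  have prN : pr (- li (g ^+ 0)) = -1.
    by rewrite /pr (@ZredN n (pdiv p)) // -/(pr _) prli expr0.
  have pr1 : pr (li (g ^+ 0)) = 1 by rewrite prli expr0.
  have := gE (- li (g ^+ 0)) (li (g ^+ 0)); rewrite subgN // => /(_ (liH 0%N) (liH 0%N)).
  by rewrite csym eqxx -!/(pr _) prN pr1 inE n10 -(lg_one gP L2) => <-.
pose b k := li (g ^+ k) \in S.
have bm k : b (k %% 2)%N = b k.
  by apply: cS; apply/eqP; rewrite gE // -!/(pr _) !prli !(lg_gen _ gP L2) modn_mod.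
have inS x : x \notin multiples n (pdiv p) -> (x \in S) = b (lg g (pr x)).
  move=> xH; apply: cS; apply/eqP; rewrite gE // -!/(pr _) !prli lgK //.
  by rewrite pr0.
have aH : ((pdiv p)%:R : R) \in multiples n (pdiv p) by rewrite mem_multiples.
have a0 : ((pdiv p)%:R : R) != 0.
  rewrite Zn_eq0 // [X in (X %| _)%N]nE -[X in (_ %| X)%N]muln1 dvdn_pmul2l ?(ltnW p1) //.
  by rewrite dvdn1 neq_ltn h1 orbT.
have inH x : x \in multiples n (pdiv p) -> x != 0 -> (x \in S) = ((pdiv p)%:R \in S).
  by move=> xH x0; apply/cS/H1.
have [b01|b01] := eqVneq (b 0%N) (b 1%N).
  case: (not_subgroup_set sH) => x y x0 y0 xyH.
  case: (boolP (x \in multiples n (pdiv p))) (xyH) => xH /esym yH; first by rewrite !inH.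
  have b1 k : b k = b 0%N.
    by rewrite -bm; case: (k %% 2)%N (ltn_pmod k (isT : 0 < 2)%N) => [|[|]].
  by rewrite !inS ?yH // !b1.
have [r rE] := bool_mod2 b01 bm.
pose T0 := [set y : R | pr y \in cyc g 2 r].
have T0P x : (x \in T0) = (pr x \in cyc g 2 r) by rewrite inE.
have T0H x : x \in multiples n (pdiv p) -> x \notin T0.
  by rewrite -pr0 => /eqP x0; rewrite T0P x0 inE eqxx.
have inS' x : x \notin multiples n (pdiv p) -> (x \in S) = (x \in T0).
  by move=> xH; rewrite inS // rE T0P [RHS]inE pr0 xH.
have mc k : (li (g ^+ k) \in T0) = (k == r %[mod 2]) by rewrite T0P prli (mem_cyc gP L2).
have i1 : li (g ^+ r) \in T0 by rewrite mc eqxx.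
have i2 : li (g ^+ r.+1) \notin T0 by rewrite mc -addn1 -[X in _ == X %[mod _]]addn0 eqn_modDl.
have i3 := T0H _ aH.
have := deza3 (li0 r) (li0 r.+1) a0; case ba: ((pdiv p)%:R \in S); last first.
  have SE : S = T0.
    apply/setP=> x; case: (boolP (x \in multiples n (pdiv p))) => xH; last exact: inS'.
    rewrite (negPf (T0H _ xH)); have [->|x0] := eqVneq x 0; first by rewrite (negPf S0).
    by rewrite inH.
  have [mu pE E] := cn_paley_blowup n_gt1 p_pr gP L2 N1 nE r.
  rewrite SE !E // i1 (negPf i2) (negPf i3) aH !(negPf (liH _)) => D.
  have mu0 : (0 < mu)%N by move: pE (prime_gt1 p_pr); clear; lia.
  exfalso; clear -D mu0 h1; case: D => /= D; nia.
have SE : S = (multiples n (pdiv p) :\ 0) :|: T0.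
  apply/setP=> x; rewrite in_setU in_setD1; have [->|x0] := eqVneq x 0.
    by rewrite (negPf S0) (negPf (T0H _ _)) //; case: sH.
  case: (boolP (x \in multiples n (pdiv p))) => xH /=; last exact: inS'.
  by rewrite inH.
have [mu pE E] := cn_paley_clique n_gt1 p_pr gP L2 N1 nE r.
rewrite SE !E // i1 (negPf i2) (negPf i3) aH !(negPf (liH _)) => D.
have mu0 : (0 < mu)%N by move: pE (prime_gt1 p_pr); clear; lia.
have h2 : h = 2%N by clear -D mu0 h1; case: D => /= D; nia.
exists p, g, r; split=> //; first by rewrite [LHS]nE h2.
by rewrite pE mulnC modnMDl.
Qed.

(** A set of residues modulo 3 that is neither empty nor full is one class or the complement of one
    class; [e] records which, and it separates the last two families. *)
Lemma bool_mod3 (b : nat -> bool) : ~ (b 0 = b 1 /\ b 1 = b 2)%N ->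
  (forall k, b (k %% 3)%N = b k) ->
  exists r e, forall k, b k = (e != (k == r %[mod 3])).
Proof.
move=> nb bm; have key r e : (forall k, (k < 3)%N -> b k = (e != (k == r %[mod 3]))) ->
    exists r e, forall k, b k = (e != (k == r %[mod 3])).
  by move=> E; exists r, e => k; rewrite -bm E ?ltn_mod // modn_mod.
move: nb; case b0: (b 0%N); case b1: (b 1%N); case b2: (b 2%N) => nb;
  try by case: nb.
- by apply: (key 2%N true) => -[|[|[|//]]] _; rewrite ?b0 ?b1 ?b2.
- by apply: (key 1%N true) => -[|[|[|//]]] _; rewrite ?b0 ?b1 ?b2.
- by apply: (key 0%N false) => -[|[|[|//]]] _; rewrite ?b0 ?b1 ?b2.
- by apply: (key 0%N true) => -[|[|[|//]]] _; rewrite ?b0 ?b1 ?b2.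
- by apply: (key 1%N false) => -[|[|[|//]]] _; rewrite ?b0 ?b1 ?b2.
- by apply: (key 2%N false) => -[|[|[|//]]] _; rewrite ?b0 ?b1 ?b2.
Qed.

Lemma forward_cubic p : cCubic c p -> fam7 S \/ fam8 S.
Proof.
move=> [nE p_pr L3 gE].
have [g gP] := finField_primitive 'F_p; have {}gE := gE g gP.
have p1 := pdiv_gt1 p_pr.
pose io := subZ n (pdiv p) 1.
have io0 x : (io x == 0) = (x == 0).
  by rewrite -(subZ0 n (pdiv p) 1) (inj_eq (subZ_inj n_gt1 p1 nE)).
have sur x : exists y, x = io y.
  by apply: (subZ_surj n_gt1 p1 nE); rewrite multiples1 inE.
pose b k := io (g ^+ k) \in S.
have bm k : b (k %% 3)%N = b k.
  apply: cS; apply/eqP; rewrite gE ?(genX_neq0 gP) //.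
  by rewrite !(lg_gen _ gP L3) modn_mod.
have inS x : x != 0 -> (io x \in S) = b (lg g x) by move=> x0; rewrite /b lgK.
have nb : ~ (b 0 = b 1 /\ b 1 = b 2)%N.
  case=> b01 b12; have b1 k : b k = b 0%N.
    rewrite -bm; have : (k %% 3 < 3)%N by rewrite ltn_mod.
    by case: (k %% 3)%N => [|[|[|//]]] _; rewrite ?b01 ?b12.
  have sT : is_subgroup [set: R] by exact: subgT.
  apply: (not_subgroup_set sT) => x y x0 y0 _.
  have [u xE] := sur x; have [v yE] := sur y.
  by rewrite xE yE !inS ?b1 // -io0 -?xE -?yE.
have [r [e rE]] := bool_mod3 nb bm.
have SE x : x != 0 -> (io x \in S) = (e != (x \in cyc g 3 r)).
  by move=> x0; rewrite inS // rE inE x0.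
have [B [C' [D [pE rel E]]]] := cn_cubic p_pr gP L3 r.
have n3 j : io (g ^+ (j + r)) != 0 by rewrite io0 (genX_neq0 gP).
have mc j : g ^+ (j + r) \in cyc g 3 (j + r) by rewrite (mem_cyc gP L3) eqxx.
have p3 : (3 %| p.-1)%N by rewrite pE addn1 dvdn_mulr.
(* With [B = C'] the prime [p] would be a square. The coincidence of counts therefore involves the
   class of [D]. *)
have BC : B <> C'.
  move=> BC; have [t tE] := cubic_rel_square rel BC; move: p_pr.
  by rewrite pE tE (negPf (square_not_prime t)).
have E0 := E _ 0%N isT (mc 0%N); have E1 := E _ 1%N isT (mc 1%N); have E2 := E _ 2%N isT (mc 2%N).
have := deza3 (n3 0%N) (n3 1%N) (n3 2%N); case: e SE rE => SE _.
  have SS : S = [set subZ n (pdiv p) 1 x | x in ~: cyc g 3 r :\ 0].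
    apply/setP=> x; have [y ->] := sur x; rewrite (mem_imset _ _ (subZ_inj n_gt1 p1 nE)).
    rewrite in_setD1 in_setC; have [y0|y0] := eqVneq y 0; last by rewrite SE //; case: (_ \in _).
    by rewrite y0 /io subZ0 (negPf S0).
  rewrite SS !(cn_sub p_pr n_gt1 nE) !(proj2 E0, proj2 E1, proj2 E2) /= => Dz; right.
  have : exists t, p = (t ^ 2 + 12)%N.
    case: Dz => Dz.
    - rewrite pE; apply: (cubic_rel_plus12 rel); clear -Dz; lia.
    (* The relation is symmetric in [B] and [C'], so this coincidence reduces to the previous
       one. *)
    - rewrite pE (_ : B + C' + D = C' + B + D)%N; last by clear; lia.
      apply: (cubic_rel_plus12 (cubic_relC rel)); clear -Dz; lia.
    - by case: BC; clear -Dz; lia.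
  by case=> t tE; exists p, t, g, r.
have SS : S = [set subZ n (pdiv p) 1 x | x in cyc g 3 r].
  apply/setP=> x; have [y ->] := sur x; rewrite (mem_imset _ _ (subZ_inj n_gt1 p1 nE)).
  have [y0|y0] := eqVneq y 0; last by rewrite SE //; case: (_ \in _).
  by rewrite y0 /io subZ0 (negPf S0) inE eqxx.
rewrite SS !(cn_sub p_pr n_gt1 nE) !(proj1 E0, proj1 E1, proj1 E2) /= => Dz; left.
have : exists t, p = (t ^ 2 + 3)%N.
  case: Dz => Dz.
  - rewrite pE; apply: (cubic_rel_plus3 rel); clear -Dz; lia.
  - rewrite pE (_ : B + C' + D = C' + B + D)%N; last by clear; lia.
    apply: (cubic_rel_plus3 (cubic_relC rel)); clear -Dz; lia.
  - by case: BC; clear -Dz; lia.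
by case=> t tE; exists p, t, g, r.
Qed.

Theorem forward_families : fam1 S \/ fam2 S \/ fam3 S \/ fam4 S \/ fam5 S \/ fam6 S \/
  fam7 S \/ fam8 S.
Proof.
case: (rank4_classification n_gt1 Sc csym x1n0 x2n0 x3n0 c12 c13 c23 c_all).
  by move/forward_cubic=> []; tauto.
case=> [[h [k /forward_tensor]]|]; first tauto.
case=> [[l [m [h /forward_chain]]]|]; first tauto.
by case=> [[l [p /forward_paley_sub]]|[h [p /forward_paley_quo]]]; tauto.
Qed.

End Forward.

(** * Cayley graphs and their WL-closures *)

Definition is_cay (T : finType) (e : rel T) n (S : {set 'Z_n}) :=
  exists f : T -> 'Z_n, bijective f /\ forall x y, e x y = (f y - f x \in S).

Section Isomorphisms.
Variables (T1 T2 : finType) (e1 : rel T1) (e2 : rel T2) (n : nat) (S : {set 'Z_n}).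

Lemma cay_iso : is_cay e1 S -> is_cay e2 S -> graph_iso e1 e2.
Proof.
move=> [f1 [bf1 E1]] [f2 [[g2 fK gK] E2]]; exists (g2 \o f1); split.
  by apply: bij_comp bf1; exists f2.
by move=> x y; rewrite E2 /= !gK E1.
Qed.

Lemma iso_cay : graph_iso e1 e2 -> is_cay e2 S -> is_cay e1 S.
Proof.
move=> [f [bf E]] [f2 [bf2 E2]]; exists (f2 \o f); split; first exact: bij_comp.
by move=> x y; rewrite -E E2.
Qed.

End Isomorphisms.

(** With [n.+2] the types ['I_n.+2] and ['Z_n.+2] agree by computation. *)
Lemma cay_circE n (S : {set 'Z_n.+2}) (i j : 'Z_n.+2) : @cay_circ n.+2 S i j = (j - i \in S).
Proof.
apply/existsP/idP => [[s /andP[sS /eqP E]]|jiS].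
  suff -> : j - i = s by [].
  by apply/eqP; rewrite subr_eq; apply/eqP/val_inj; rewrite E.
exists (j - i); rewrite jiS; apply/eqP.
by transitivity (val (j - i + i)); first by rewrite subrK.
Qed.

Section Bridge.
Variables (T : finType) (e : rel T).
Hypotheses (e_sym : symmetric e) (eirr : irreflexive e).

(** At least two vertices are required because ['Z_0] and ['Z_1] have two elements. *)
Lemma circulant_cay : is_circulant e -> (1 < #|T|)%N ->
  exists n (S : {set 'Z_n}), (1 < n)%N /\ is_cay e S.
Proof.
move=> [n [S [n0 _ _ [f [bf E]]]]] T1.
have : #|T| = n by rewrite (bij_eq_card bf) card_ord.
case: n S n0 f bf E => [//|[|n]] S n0 f bf E Tn; first by rewrite Tn in T1.
by exists n.+2, S; split=> //; exists f; split=> // x y; rewrite -E cay_circE.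
Qed.

Section Cay.
Variables (n : nat) (n_gt1 : (1 < n)%N) (S : {set 'Z_n}) (f : T -> 'Z_n) (fi : 'Z_n -> T).
Hypotheses (fK : cancel f fi) (fiK : cancel fi f).
Hypothesis fE : forall x y, e x y = (f y - f x \in S).

Lemma cay_S0 : 0 \notin S.
Proof. by have := eirr (fi 0); rewrite fE subrr => ->. Qed.

Lemma cay_SN x : (- x \in S) = (x \in S).
Proof. by have := e_sym (fi x) (fi 0); rewrite !fE !fiK sub0r subr0. Qed.

Lemma cay_common x y : common_nbrs e x y = cn S (f y - f x).
Proof.
rewrite /common_nbrs /cn -(card_imset _ (can_inj fK)).
rewrite -[RHS](card_imset _ (addrI (f x))); apply: eq_card => w.
apply/imsetP/imsetP => [[z]|[z]].
  rewrite inE !fE => /andP[xz yz] ->; exists (f z - f x); last by rewrite addrC subrK.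
  by rewrite inE xz -cay_SN !opprB addrA subrK.
rewrite inE => /andP[zS dz] ->; exists (fi (f x + z)); last by rewrite fiK.
rewrite inE !fE fiK addrC addKr zS /=.
by move: dz; rewrite -cay_SN !opprB addrA [z + _]addrC.
Qed.

Lemma cay_degree x : #|[set y | e x y]| = #|S|.
Proof.
rewrite -(card_imset _ (can_inj fK)) -[RHS](card_imset _ (addrI (f x))).
apply: eq_card => w; apply/imsetP/imsetP => [[z]|[z zS ->]].
  by rewrite inE fE => xz ->; exists (f z - f x); rewrite // addrC subrK.
by exists (fi (f x + z)); rewrite ?fiK // inE fE fiK addrC addKr.
Qed.

Lemma cay_Deza : is_Deza e <-> exists a b, forall x, x != 0 -> cn S x = a \/ cn S x = b.
Proof.
split=> [[_ [a [b ab]]]|[a [b ab]]].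
  exists a, b => x x0; have := ab (fi 0) (fi x); rewrite cay_common !fiK subr0; apply.
  by rewrite (can_eq fiK) eq_sym.
split; first by exists #|S| => x; exact: cay_degree.
exists a, b => x y xy; rewrite cay_common; apply: ab.
by rewrite subr_eq0 (can_eq fK) eq_sym.
Qed.

End Cay.

Lemma cay_circulant n (S : {set 'Z_n}) : (1 < n)%N -> is_cay e S -> is_circulant e.
Proof.
case: n S => [|[|n]] S // n_gt1 [f [[fi fK fiK] fE]].
exists n.+2, S; split=> //.
- move=> s sS; apply/negP=> /eqP s0; have := cay_S0 fi fE.
  suff -> : 0 = s by rewrite sS.
  exact: val_inj.
- move=> s sS; exists (- s) => //; by rewrite (cay_SN fiK fE).
by exists f; split; [exists fi|move=> x y; rewrite cay_circE fE].
Qed.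

Section Colourings.
Variables (D : eqType) (col : T -> T -> D).

(** Coherent configurations as colourings of ordered pairs. The indices [i] and [j] run over all of
    [D]; colours that do not occur give the count 0. *)
Definition ccol := [/\ forall x y z, col x y = col z z -> x = y,
  forall x y x' y', col x y = col x' y' -> col y x = col y' x' &
  forall i j x y x' y', col x y = col x' y' ->
    #|[set z | (col x z == i) && (col z y == j)]| = #|[set z | (col x' z == i) && (col z y' == j)]|].

Definition colour_partition : {set {set T * T}} :=
  preim_partition (fun p => col p.1 p.2) [set: T * T].

Lemma mem_colour_partition r : r \in colour_partition ->
  exists p, r = [set q | col q.1 q.2 == col p.1 p.2].
Proof.
move=> /imsetP[p _ ->]; exists p; apply/setP=> q.
by rewrite !inE /= eq_sym.
Qed.

Lemma colour_class_in p : [set q | col q.1 q.2 == col p.1 p.2] \in colour_partition.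
Proof.
by apply/imsetP; exists p; rewrite ?inE //; apply/setP=> q; rewrite !inE /= eq_sym.
Qed.

Lemma colour_union (E : {set T * T}) :
  (forall x y x' y', col x y = col x' y' -> ((x, y) \in E) = ((x', y') \in E)) ->
  union_of_classes colour_partition E.
Proof.
move=> EE r /mem_colour_partition[[x y] ->] /=; case: (boolP ((x, y) \in E)) => xyE.
  by apply/orP; left; apply/subsetP=> -[x' y']; rewrite inE /= => /eqP/EE ->.
apply/orP; right; rewrite disjoints_subset; apply/subsetP=> -[x' y'].
by rewrite !inE /= => /eqP/EE; rewrite (negPf xyE) => ->.
Qed.

Lemma ccol_coherent : ccol -> coherent_config colour_partition.
Proof.
move=> [cd cs ci]; split.
- exact: preim_partitionP.
- apply: colour_union => x y x' y' E; rewrite !inE /=; apply/eqP/eqP => xy; rewrite xy in E.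
    exact: (cd _ _ _ (esym E)).
  exact: (cd _ _ _ E).
- move=> r /mem_colour_partition[[x y] ->].
  have -> : transp_set [set q | col q.1 q.2 == col x y] = [set q | col q.1 q.2 == col (y, x).1 (y, x).2].
    by apply/setP=> -[x' y']; rewrite !inE /=; apply/eqP/eqP => /cs.
  exact: colour_class_in.
move=> r s t /mem_colour_partition[[x1 y1] ->] /mem_colour_partition[[x2 y2] ->].
move=> /mem_colour_partition[[x3 y3] ->] a b a' b'; rewrite !inE /= => /eqP E /eqP E'.
have := ci (col x1 y1) (col x2 y2) a b a' b' (etrans E (esym E')).
congr (_ = _); apply: eq_card => z; by rewrite !inE.
Qed.

End Colourings.

Section CoherentP.
Variable P : {set {set T * T}}.
Hypothesis cP : coherent_config P.
Local Notation cl x y := (pblock P (x, y)).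

Lemma cl_mem x y : (x, y) \in cl x y.
Proof. by case: cP => /and3P[/eqP cov _ _] _ _ _; rewrite mem_pblock cov inE. Qed.

Lemma cl_in x y : cl x y \in P.
Proof. by case: cP => /and3P[/eqP cov _ _] _ _ _; apply: pblock_mem; rewrite cov inE. Qed.

Lemma cl_eq r x y : r \in P -> (x, y) \in r -> cl x y = r.
Proof. by case: cP => /and3P[_ tr _] _ _ _; apply: def_pblock. Qed.

Lemma cl_union (E : {set T * T}) x y x' y' : union_of_classes P E ->
  cl x y = cl x' y' -> ((x, y) \in E) = ((x', y') \in E).
Proof.
move=> uE xy; case/orP: (uE _ (cl_in x y)) => [/subsetP sub|dis].
  by rewrite (sub _ (cl_mem x y)) (sub (x', y')) // xy cl_mem.
rewrite (disjointFr dis (cl_mem x y)); apply/esym.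
by rewrite (disjointFr dis) // xy cl_mem.
Qed.

Lemma cl_ccol : ccol (fun x y => cl x y).
Proof.
case: (cP) => _ uD tP iP; split.
- by move=> x y z /(cl_union uD); rewrite !inE eqxx => /eqP.
- move=> x y x' y' xy; have tr u v : (v, u) \in transp_set (cl u v) by rewrite inE cl_mem.
  rewrite (cl_eq (tP _ (cl_in x y)) (tr x y)).
  by rewrite (cl_eq (tP _ (cl_in x' y')) (tr x' y')) xy.
move=> i j x y x' y' xy.
have inE' k u v : (k \in P) -> (cl u v == k) = ((u, v) \in k).
  by move=> kP; apply/eqP/idP => [<-|/(cl_eq kP)]; first exact: cl_mem.
(* The colours [i] and [j] are arbitrary sets of pairs; unless both are classes, the count is 0 for
   every pair. *)
have out u v : #|[set z | (cl u z == i) && (cl z v == j)]| =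
    if (i \in P) && (j \in P) then #|[set z | ((u, z) \in i) && ((z, v) \in j)]| else 0%N.
  case: ifP => [/andP[iP' jP']|nij].
    by apply: eq_card => z; rewrite !inE !inE'.
  apply/eqP; rewrite cards_eq0; apply/eqP/setP=> z; rewrite in_set0 in_set.
  by apply/negP=> /andP[/eqP ui /eqP vj]; rewrite -ui -vj !cl_in in nij.
rewrite !out; case: ifP => // /andP[iP' jP'].
by apply: (iP i j (cl x y)); rewrite ?cl_in ?cl_mem // xy cl_mem.
Qed.

End CoherentP.

Lemma refines_colour (P : {set {set T * T}}) (D : eqType) (col : T -> T -> D) :
  WL_closure e P -> ccol col -> (forall x y x' y', col x y = col x' y' -> e x y = e x' y') ->
  forall x y x' y', col x y = col x' y' -> pblock P (x, y) = pblock P (x', y').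
Proof.
move=> [cP uE mP] cc ce x y x' y' xy.
have cC := ccol_coherent cc.
have uC : union_of_classes (colour_partition col) (edge_set e).
  by apply: colour_union => u v u' v' /ce; rewrite !inE.
have [r rP /subsetP sub] := mP _ cC uC _ (colour_class_in col (x, y)).
rewrite (cl_eq cP rP (sub (x, y) _)) ?(cl_eq cP rP (sub (x', y') _)) // inE //=.
by rewrite -xy.
Qed.

End Bridge.

Section Symmetrization.
Variables (n : nat) (C : finType) (c : 'Z_n -> C).
Hypothesis Sc : Sring c.

(** The functions constant on merged colours are the even colour functions, and the convolution of
    two even functions is even. *)
Lemma Sring_symmetrize : Sring (fun x => [set c x; c (- x)]).
Proof.
case: Sc => c0 cN cM.
have pair x y : [set c x; c (- x)] = [set c y; c (- y)] -> c x = c y \/ c x = c (- y).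
  by move/setP/(_ (c x)); rewrite !inE eqxx => /esym/orP[]/eqP; [left|right].
have lift (V : Type) (F : 'Z_n -> V) : cconst c F -> (forall x, F (- x) = F x) ->
    cconst (fun x => [set c x; c (- x)]) F.
  by move=> cF FN x y /pair[/cF //|/cF ->].
split.
- by apply: lift => // x; rewrite !inE oppr_eq0.
- apply: lift => [x y xy|x]; last by rewrite opprK setUC.
  by rewrite !opprK xy (cN _ _ xy).
move=> F G cF cG.
have low (H : galg int 'Z_n) : cconst (fun x => [set c x; c (- x)]) H -> cconst c H.
  by move=> cH x y xy; apply: cH; rewrite xy (cN _ _ xy).
have even (H : galg int 'Z_n) : cconst (fun x => [set c x; c (- x)]) H -> forall x, H (- x) = H x.
  by move=> cH x; apply: cH; rewrite opprK setUC.
apply: lift; first by apply: cM; apply: low.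
move=> x; rewrite !galgM (reindex (fun z => - z)) /=; last by exists (fun z => - z) => z _; rewrite opprK.
by apply: eq_bigr => z _; rewrite (even F) // -opprD (even G) // opprK.
Qed.

End Symmetrization.

(** * The WL-closure of a circulant graph as a symmetric S-ring *)

Section ForwardBridge.
Variables (T : finType) (e : rel T).
Hypotheses (e_sym : symmetric e) (e_irr : irreflexive e).
Variables (n : nat) (n_gt1 : (1 < n)%N) (S : {set 'Z_n}) (f : T -> 'Z_n) (fi : 'Z_n -> T).
Hypotheses (fK : cancel f fi) (fiK : cancel fi f).
Hypothesis fE : forall x y, e x y = (f y - f x \in S).

Lemma Sring_ccol (D : eqType) (c : 'Z_n -> D) : Sring c -> ccol (fun x y => c (f y - f x)).
Proof.
move=> Sc; case: (Sc) => c0 cN _; split.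
- move=> x y z; rewrite subrr => /c0; rewrite !inE eqxx subr_eq0 => /eqP E.
  by rewrite -(fK x) -E fK.
- by move=> x y x' y' /cN; rewrite !opprB.
move=> i j x y x' y' xy.
have cX k : cset c [set z | c z == k] by move=> u v uv; rewrite !inE uv.
have E u v : #|[set z | (c (f z - f u) == i) && (c (f v - f z) == j)]|
    = #|[set z in [set z | c z == i] | f v - f u - z \in [set z | c z == j]]|.
  rewrite -(card_imset _ (can_inj fK)) -[RHS](card_imset _ (addrI (f u))).
  apply: eq_card => w; apply/imsetP/imsetP => [[z]|[z]].
    rewrite inE => zP ->; exists (f z - f u); last by rewrite addrC subrK.
    by rewrite !inE opprB addrA subrK.
  rewrite !inE => zP ->; exists (fi (f u + z)); last by rewrite fiK.
  rewrite inE fiK [f u + z]addrC addrK opprD addrA [f v - z - f u]addrAC.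
  exact: zP.
by rewrite !E; apply: (cset_count Sc (cX i) (cX j) xy).
Qed.

Variable P : {set {set T * T}}.
Hypotheses (PWL : WL_closure e P) (P4 : #|P| = 4).

Let cP : coherent_config P. Proof. by case: PWL. Qed.
Let c (x : 'Z_n) := pblock P (fi 0, fi x).

(* Translations are automorphisms of e: the colouring by differences is coherent, hence finer
   than the closure. *)
Lemma thin_colour x y : pblock P (x, y) = c (f y - f x).
Proof.
have thin : Sring (fun x : 'Z_n => x).
  by split=> [u v ->|u v ->|F G _ _ u v ->].
apply: (refines_colour PWL (Sring_ccol thin)); last by rewrite !fiK subr0.
by move=> u v u' v' /= E; rewrite !fE E.
Qed.

Lemma closure_coarsest (D : eqType) (c' : 'Z_n -> D) : Sring c' -> cset c' S ->
  forall x y, c' x = c' y -> c x = c y.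
Proof.
move=> Sc' cS x y xy; apply: (refines_colour PWL (Sring_ccol Sc')).
  by move=> u v u' v' /= E; rewrite !fE (cS _ _ E).
by rewrite !fiK !subr0.
Qed.

(** Grouping a convolution by the colours of its two arguments turns the coefficients into
    intersection numbers, which are constant on the classes of the closure. *)
Lemma closure_Sring : Sring c.
Proof.
have [cd cs ci] := cl_ccol cP.
split.
- move=> x y xy; rewrite !inE; apply/eqP/eqP => x0.
    by have /esym := xy; rewrite x0 => /cd /(can_inj fiK).
  by have := xy; rewrite x0 => /cd /(can_inj fiK).
- move=> x y xy; have := cs _ _ _ _ xy; rewrite !thin_colour !fiK !sub0r.
  by [].
move=> F G cF cG.
pose val_of (H : galg int 'Z_n) (i : {set T * T}) := if [pick x | c x == i] is Some x then H x else 0.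
have vE (H : galg int 'Z_n) x : cconst c H -> H x = val_of H (c x).
  by move=> cH; rewrite /val_of; case: pickP => [y /eqP /cH //|/(_ x)]; rewrite eqxx.
have conv x : (F * G) x = \sum_(ij : {set T * T} * {set T * T})
    val_of F ij.1 * val_of G ij.2 *
    #|[set w | (pblock P (fi 0, w) == ij.1) && (pblock P (w, fi x) == ij.2)]|%:R.
  rewrite galgM (partition_big (fun z => (c z, c (x - z))) predT) //=.
  apply: eq_bigr => -[i j] _ /=; rewrite -sum1_card natr_sum mulr_sumr.
  rewrite [RHS](reindex fi) /=; last by exists f => ? _; rewrite ?fK ?fiK.
  apply: eq_big => z; first by rewrite inE !thin_colour !fiK !subr0 xpair_eqE.
  by rewrite xpair_eqE => /andP[/eqP <- /eqP <-]; rewrite -!vE // mulr1.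
move=> x y xy; rewrite !conv; apply: eq_bigr => ij _.
by rewrite (ci ij.1 ij.2 _ _ _ _ xy).
Qed.

Lemma closure_cset : cset c S.
Proof.
move=> x y xy; case: PWL => _ uE _; have := cl_union cP uE xy.
by rewrite !inE /= !fE !fiK !subr0.
Qed.

(** Since [S = - S], the symmetrized S-ring still contains [S]; the closure, being coarsest, does
    not distinguish [x] from [- x]. *)
Lemma closure_symmetric x : c (- x) = c x.
Proof.
apply: (closure_coarsest (Sring_symmetrize closure_Sring)); last by rewrite opprK setUC.
move=> u v /setP/(_ (c u)); rewrite !inE eqxx => /esym/orP[]/eqP E.
  exact: closure_cset.
by rewrite (closure_cset E) (cay_SN e_sym fiK fE).
Qed.

Lemma closure_colours : exists x1 x2 x3, [/\ x1 != 0, x2 != 0, x3 != 0, c x1 != c x2 &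
  [/\ c x1 != c x3, c x2 != c x3 & forall x, x != 0 -> [\/ c x = c x1, c x = c x2 | c x = c x3]]].
Proof.
have PE : P = [set c x | x in [set: 'Z_n]].
  apply/setP=> r; apply/idP/imsetP => [rP|[x _ ->]]; last exact: cl_in.
  have /set0Pn[[x y] xy] : r != set0.
    by case: cP => /and3P[_ _ P0] _ _ _; apply: contraNneq P0 => <-.
  by exists (f y - f x); rewrite // -thin_colour (cl_eq cP rP xy).
pose A := [set c x | x in [set~ 0]].
have A0 : c 0 \notin A.
  apply/imsetP => -[x]; rewrite !inE => x0 E; case/negP: x0.
  by case: closure_Sring => c0 _ _; have := c0 _ _ E; rewrite !inE eqxx => <-.
have A3 : #|A| = 3.
  have : P = c 0 |: A.
    rewrite PE /A -imsetU1 (_ : 0 |: [set~ 0] = setT) //.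
    by apply/setP=> x; rewrite !inE; case: (x == 0).
  by move/(congr1 (fun B : {set {set T * T}} => #|B|)); rewrite /= cardsU1 A0 P4 => -[].
have := enum_uniq (mem A); have := cardE (mem A); rewrite A3.
have memA i : i \in enum A -> exists2 x, x != 0 & c x = i.
  by rewrite mem_enum => /imsetP[x]; rewrite !inE => x0 ->; exists x.
case E: (enum A) => [|i1 [|i2 [|i3 [|]]]] //= _; rewrite !inE negb_or => /andP[/andP[n12 n13] /andP[n23 _]].
have [|x1 x10 E1] := memA i1; first by rewrite E inE eqxx.
have [|x2 x20 E2] := memA i2; first by rewrite E !inE eqxx orbT.
have [|x3 x30 E3] := memA i3; first by rewrite E !inE eqxx !orbT.
exists x1, x2, x3; rewrite E1 E2 E3; split=> //; split=> // x x0.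
have : c x \in enum A by rewrite mem_enum; apply: imset_f; rewrite !inE.
by rewrite E !inE => /or3P[]/eqP; [constructor 1|constructor 2|constructor 3].
Qed.

End ForwardBridge.

Section BackwardBridge.
Variables (T : finType) (e : rel T).
Hypotheses (e_sym : symmetric e) (e_irr : irreflexive e).
Variables (n : nat) (n_gt1 : (1 < n)%N) (S : {set 'Z_n}).
Hypothesis eS : is_cay e S.
Variables (D : eqType) (c : 'Z_n -> D).
Hypotheses (Sc : Sring c) (cS : cset c S).
Variables x1 x2 x3 : 'Z_n.
Hypotheses (x10 : x1 != 0) (x20 : x2 != 0) (x30 : x3 != 0).
Hypothesis c_all : forall x, x != 0 -> [\/ c x = c x1, c x = c x2 | c x = c x3].
Local Notation sep x y := ((x \in S) != (y \in S) \/ cn S x != cn S y).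
Hypotheses (s12 : sep x1 x2) (s13 : sep x1 x3) (s23 : sep x2 x3).
Hypothesis d123 : [\/ cn S x1 = cn S x2, cn S x1 = cn S x3 | cn S x2 = cn S x3].

Lemma cn_const : cconst c (cn S).
Proof. exact: (cset_count Sc cS cS). Qed.

Lemma sep_colour x y : sep x y -> c x != c y.
Proof.
by case; apply: contraNneq => xy; [rewrite (cS xy)|rewrite (cn_const xy)].
Qed.

Lemma determined x y : (x == 0) = (y == 0) -> (x \in S) = (y \in S) -> cn S x = cn S y -> c x = c y.
Proof.
move=> xy0 xyS xyc; have [x_0|x_0] := eqVneq x 0.
  by move: xy0; rewrite x_0 eqxx => /esym/eqP ->.
have y_0 : y != 0 by rewrite -xy0.
have no u v : sep u v -> c x = c u -> c y = c v -> c x = c y.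
  move=> s xu yv; exfalso; move: s.
  by rewrite -(cS xu) -(cS yv) -(cn_const xu) -(cn_const yv) xyS xyc !eqxx; case.
have no' u v : sep u v -> c x = c v -> c y = c u -> c x = c y.
  by move=> s xv yu; apply: (no v u) => //; case: s; rewrite eq_sym; [left|right].
case: (c_all x_0) => Ex; case: (c_all y_0) => Ey;
  by [rewrite Ex Ey|apply: (no _ _ s12)|apply: (no _ _ s13)|apply: (no _ _ s23)
     |apply: (no' _ _ s12)|apply: (no' _ _ s13)|apply: (no' _ _ s23)].
Qed.

(* Both invariants in [determined] are read off any coherent configuration having e as a union
   of classes, so every such configuration refines the colours of c. *)
Theorem backward_bridge : [/\ is_Deza e, is_circulant e & WL_rank_is e 4].
Proof.
split; last 1 first.
- have [f [[fi fK fiK] fE]] := eS.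
  pose col x y := c (f y - f x).
  have cc : ccol col := Sring_ccol fK fiK Sc.
  exists (colour_partition col); split.
    split; first exact: ccol_coherent.
      by apply: colour_union => u v u' v'; rewrite /col !inE /= !fE => /cS.
    move=> Q cQ uQ q qQ.
    have /set0Pn[[x y] xy] : q != set0.
      by case: cQ => /and3P[_ _ Q0] _ _ _; apply: contraNneq Q0 => <-.
    exists [set p | col p.1 p.2 == col (x, y).1 (x, y).2]; first exact: colour_class_in.
    have qE := cl_eq cQ qQ xy.
    apply/subsetP=> -[x' y'] xy'; have qE' := cl_eq cQ qQ xy'.
    have E : pblock Q (x', y') = pblock Q (x, y) by rewrite qE qE'.
    have [_ _ ci] := cl_ccol cQ.
    have eE u v u' v' : pblock Q (u, v) = pblock Q (u', v') -> e u v = e u' v'.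
      by move/(cl_union cQ uQ); rewrite !inE.
    rewrite inE /=; apply/eqP/determined; rewrite -?fE ?(eE _ _ _ _ E) //.
      case: (cQ) => _ uD _ _; have := cl_union cQ uD E; rewrite !inE /=.
      by rewrite !subr_eq0 !(can_eq fK) => E0; rewrite [LHS]eq_sym E0 eq_sym.
    rewrite -!(cay_common e_sym fK fiK fE) /common_nbrs.
    (* Common neighbours are sorted by the classes of the two edges, so their number is a sum of
       intersection numbers of [Q] over the pairs of classes made of edges. *)
    have cnt u v : #|[set z | e u z && e v z]| = (\sum_(ij : {set T * T} * {set T * T}
         | (ij.1 \subset edge_set e) && (ij.2 \subset edge_set e))
        #|[set z | (pblock Q (u, z) == ij.1) && (pblock Q (z, v) == ij.2)]|)%N.
      have inq a b : e a b = (pblock Q (a, b) \subset edge_set e).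
        apply/idP/subsetP => [ab [a' b'] ab'|/(_ (a, b) (cl_mem cQ a b))]; last by rewrite inE.
        by rewrite inE /= (eE _ _ _ _ (cl_eq cQ (cl_in cQ a b) ab')).
      rewrite -sum1_card (partition_big (fun z => (pblock Q (u, z), pblock Q (z, v)))
        (fun ij => (ij.1 \subset edge_set e) && (ij.2 \subset edge_set e))) /=; last first.
        by move=> z; rewrite inE -!inq [e z v]e_sym.
      apply: eq_bigr => -[i j] /= /andP[iE jE]; rewrite sum1_card; apply: eq_card => z.
      rewrite !inE unfold_in /= inE xpair_eqE [e v z]e_sym !inq.
      by case: eqP => [->|]; case: eqP => [->|]; rewrite ?iE ?jE ?andbF.
    by rewrite !cnt; apply: eq_bigr => ij _; apply: ci.
  pose K x : {set T * T} := [set p | col p.1 p.2 == c x].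
  have KI x y : K x = K y -> c x = c y.
    by move/setP/(_ (fi 0, fi x)); rewrite !inE /= /col !fiK subr0 eqxx => /esym/eqP.
  have KP x : K x \in colour_partition col.
    by have := colour_class_in col (fi 0, fi x); rewrite /= /col !fiK subr0.
  have KE : colour_partition col =i [:: K 0; K x1; K x2; K x3].
    move=> r; apply/idP/idP => [/mem_colour_partition[[x y] ->]|].
      rewrite /= /col; have [->|d0] := eqVneq (f y - f x) 0; first by rewrite inE eqxx.
      by case: (c_all d0) => E; rewrite !inE /K /col E eqxx ?orbT.
    by rewrite !inE => /or4P[]/eqP ->.
  rewrite (eq_card KE); apply/card_uniqP => /=.
  have ne x y : c x != c y -> K x != K y by apply: contraNneq => /KI ->.
  have c0 x : x != 0 -> c 0 != c x.
    case: Sc => h _ _; apply: contraNneq => /h; by rewrite !inE eqxx => <-.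
  by rewrite !inE !negb_or !ne ?c0 ?sep_colour.
- have [f [[fi fK fiK] fE]] := eS.
  apply/(cay_Deza e_sym fK fiK fE).
  have [a [b [A1 A2 A3]]] : exists a b, [/\ cn S x1 = a \/ cn S x1 = b,
      cn S x2 = a \/ cn S x2 = b & cn S x3 = a \/ cn S x3 = b].
    by case: d123 => E; [exists (cn S x1), (cn S x3)|exists (cn S x1), (cn S x2)|exists (cn S x1), (cn S x2)];
      rewrite ?E; split; auto.
  by exists a, b => x /c_all[] /cn_const ->.
exact: (cay_circulant e_sym e_irr n_gt1 eS).
Qed.

End BackwardBridge.

(** * The eight families as Cayley graphs *)

Lemma is_cay_inv (T : finType) (e : rel T) n (n_gt1 : (1 < n)%N) (S : {set 'Z_n}) (h : 'Z_n -> T) :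
  injective h -> #|T| = n -> (forall x y, e (h x) (h y) = (y - x \in S)) -> is_cay e S.
Proof.
move=> hi Tn hE; have [|fi hK fiK] := inj_card_bij hi; first by rewrite Tn Zn_card.
exists fi; split; first by exists h.
by move=> x y; rewrite -{1}[x]fiK -{1}[y]fiK hE.
Qed.

Lemma multiples_subE n (n_gt1 : (1 < n)%N) d (x y : 'Z_n) : (d %| n)%N ->
  (y - x \in multiples n d) = (x == y %[mod d]).
Proof.
move=> dn; wlog xy : x y / (x <= y)%N.
  move=> W; case/orP: (leq_total x y) => [/W //|/W E].
  by rewrite -(subgN _ (multiples_subg n_gt1 dn)) opprB E eq_sym.
rewrite {1}[x]Zn_natE {1}[y]Zn_natE -natrB // mem_multiples // eq_sym.
by rewrite eqn_mod_dvd.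
Qed.

Lemma eqn_modM l k x y : (0 < l)%N ->
  (x == y %[mod l * k]) = (x == y %[mod l]) && (x %/ l == y %/ l %[mod k])%N.
Proof.
move=> l0; apply/eqP/andP => [E|[/eqP El /eqP Ek]].
  by rewrite -(modn_dvdm x (dvdn_mulr k (dvdnn l))) E modn_dvdm ?dvdn_mulr // !modn_divl
    [(k * l)%N]mulnC E !eqxx.
have key z : (z %% (l * k) = (z %/ l %% k) * l + z %% l)%N.
  by rewrite {1}(divn_eq (z %% (l * k)) l) modn_dvdm ?dvdn_mulr // modn_divl [(k * l)%N]mulnC.
by rewrite !key El Ek.
Qed.

Section FamilyGraphs.
Variables (n : nat) (n_gt1 : (1 < n)%N).
Local Notation R := 'Z_n.
Implicit Types x y : R.

Definition modI m (m0 : (0 < m)%N) (a : nat) : 'I_m := Ordinal (ltn_pmod a m0).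

Lemma modI_eq m (m0 : (0 < m)%N) a b : (modI m0 a == modI m0 b) = (a == b %[mod m]).
Proof. by []. Qed.

Lemma fam1_cay m : n = (4 * m)%N -> (1 < m)%N -> odd m ->
  is_cay (gcompl (tensor (complete 4) (complete m))) ((multiples n 4 :|: multiples n m) :\ 0).
Proof.
move=> nE m1 mo; have m0 := ltnW m1.
have d4 : (4 %| n)%N by rewrite nE dvdn_mulr.
have dm : (m %| n)%N by rewrite nE dvdn_mull.
have co : coprime 4 m by rewrite (_ : 4 = 2 ^ 2)%N // coprime_pexpl // coprime2n.
pose h x := (modI (isT : 0 < 4)%N x, modI m0 x).
have hE x y : (h x == h y) = (x == y).
  rewrite xpair_eqE !modI_eq -!multiples_subE // multiplesI0 // subr_eq0 eq_sym.
  by [].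
apply: (is_cay_inv n_gt1 (h := h)); last first.
- move=> x y; rewrite /gcompl hE /tensor /complete in_setD1 in_setU subr_eq0 eq_sym.
  rewrite negb_and !negbK -[fst _ == _]/(modI _ x == modI _ y) -[snd _ == _]/(modI _ x == modI _ y).
  by rewrite !modI_eq -!multiples_subE.
- by rewrite card_prod !card_ord nE.
by move=> x y /eqP; rewrite hE => /eqP.
Qed.

Lemma fam2_cay m : n = (2 * m)%N -> (1 < m)%N -> odd m ->
  is_cay (tensor (complete 2) (complete m)) (~: (multiples n 2 :|: multiples n m)).
Proof.
move=> nE m1 mo; have m0 := ltnW m1.
have d2 : (2 %| n)%N by rewrite nE dvdn_mulr.
have dm : (m %| n)%N by rewrite nE dvdn_mull.
have co : coprime 2 m by rewrite coprime2n.
pose h x := (modI (isT : 0 < 2)%N x, modI m0 x).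
apply: (is_cay_inv n_gt1 (h := h)); last first.
- move=> x y; rewrite /tensor /complete in_setC in_setU negb_or.
  rewrite -[fst _ == _]/(modI _ x == modI _ y) -[snd _ == _]/(modI _ x == modI _ y).
  by rewrite !modI_eq -!multiples_subE.
- by rewrite card_prod !card_ord nE.
move=> x y /eqP; rewrite xpair_eqE !modI_eq -!multiples_subE // multiplesI0 // subr_eq0.
by move/eqP.
Qed.

Lemma fam4_cay l m : n = (l * 2 * m)%N -> (1 < l)%N -> (1 < m)%N ->
  is_cay (mcopies l (complete_bip m m)) (multiples n l :\: multiples n (l * 2)).
Proof.
move=> nE l1 m1; have l0 := ltnW l1.
have dl2 : (l * 2 %| n)%N by rewrite nE dvdn_mulr.
have dl : (l %| n)%N by apply: dvdn_trans dl2; rewrite dvdn_mulr.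
have hl x : (x %/ l %/ 2 < m)%N.
  by rewrite -divnMA ltn_divLR ?muln_gt0 ?l0 // mulnC -nE Zn_lt.
(* Mixed radix digits: the residue modulo [l] names the copy, the parity of [x %/ l] the side, and
   the last quotient the vertex on that side. *)
pose h x : 'I_l * ('I_m + 'I_m) :=
  (modI l0 x, if odd (x %/ l) then inr (Ordinal (hl x)) else inl (Ordinal (hl x))).
have id2 x y : (x == y %[mod l * 2]) = (x == y %[mod l]) && (odd (x %/ l) == odd (y %/ l)).
  by rewrite eqn_modM // !modn2; case: (odd _); case: (odd _).
apply: (is_cay_inv n_gt1 (h := h)); last first.
- move=> x y; rewrite /mcopies in_setD !multiples_subE // id2.
  rewrite -[fst _ == _]/(modI _ x == modI _ y) modI_eq /h /=.
  by case: (x == y %[mod l]); case: (odd _); case: (odd _).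
- by rewrite card_prod card_sum !card_ord nE addnn -mul2n mulnA.
move=> x y [] xl; have xy2 : odd (x %/ l) = odd (y %/ l) -> (x %/ l %/ 2 = y %/ l %/ 2)%N -> x = y.
  move=> o2 d2; apply: val_inj => /=.
  rewrite (divn_eq x l) (divn_eq y l) xl; congr (_ * _ + _)%N.
  by rewrite (divn_eq (x %/ l) 2) (divn_eq (y %/ l) 2) !modn2 o2 d2.
by case ox: (odd _); case oy: (odd _) => // -[] d2; apply: xy2; rewrite ?ox ?oy.
Qed.

Lemma fam5_cay l m : n = (l * m * 2)%N -> (1 < l)%N -> (1 < m)%N ->
  is_cay (lexprod (complete l) (mcopies m (complete 2)))
    (~: multiples n l :|: (multiples n (l * m) :\ 0)).
Proof.
move=> nE l1 m1; have l0 := ltnW l1; have m0 := ltnW m1.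
have dlm : (l * m %| n)%N by rewrite nE dvdn_mulr.
have dl : (l %| n)%N by apply: dvdn_trans dlm; rewrite dvdn_mulr.
have hl x : (x %/ l %/ m < 2)%N.
  by rewrite -divnMA ltn_divLR ?muln_gt0 ?l0 // mulnC -nE Zn_lt.
pose h x : 'I_l * ('I_m * 'I_2) := (modI l0 x, (modI m0 (x %/ l), Ordinal (hl x))).
have hE x y : (x == y) = [&& x == y %[mod l], x %/ l == y %/ l %[mod m] &
    x %/ l %/ m == y %/ l %/ m]%N.
  apply/eqP/and3P => [->|[/eqP a /eqP b /eqP d]]; first by rewrite !eqxx.
  apply: val_inj => /=; rewrite (divn_eq x l) (divn_eq y l) a; congr (_ * _ + _)%N.
  by rewrite (divn_eq (x %/ l) m) (divn_eq (y %/ l) m) b d.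
apply: (is_cay_inv n_gt1 (h := h)); last first.
- move=> x y; rewrite in_setU in_setC in_setD1 !multiples_subE // subr_eq0 [y == x]eq_sym hE eqn_modM //.
  have -> : lexprod (complete l) (mcopies m (complete 2)) (h x) (h y) =
      (x != y %[mod l]) || (x == y %[mod l]) &&
      ((x %/ l == y %/ l %[mod m]) && (x %/ l %/ m != y %/ l %/ m))%N by [].
  by case: (x == y %[mod l]); case: (_ == _ %[mod m]); case: (_ == _)%N.
- by rewrite !card_prod !card_ord nE mulnA.
move=> x y /eqP; rewrite !xpair_eqE !modI_eq => E; apply/eqP; rewrite hE; exact: E.
Qed.

Section Paleys.
Variables (p : nat) (p_pr : prime p) (g : 'F_p) (gP : (#|'F_p|.-1).-primitive_root g).

Lemma Fp_lt (a : 'F_p) : (a < p)%N.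
Proof. by have := @Zn_lt (pdiv p) (pdiv_gt1 p_pr) a; rewrite [X in (_ < X)%N -> _]pdiv_id. Qed.

Definition toI (a : 'F_p) : 'I_p := Ordinal (Fp_lt a).

Lemma toI_inj : injective toI.
Proof. by move=> a b [] /val_inj. Qed.

Lemma Fp_nat_eq a b : ((a%:R : 'F_p) == b%:R) = (a == b %[mod p]).
Proof.
have -> : (a == b %[mod p]) = (a == b %[mod pdiv p]) by rewrite pdiv_id.
exact: (@Zn_eq (pdiv p) (pdiv_gt1 p_pr) a b).
Qed.

Lemma gpaleyE d k (a b : 'F_p) : (p.-1 %/ d)%N = k -> (k %| #|'F_p|.-1)%N ->
  gpaley p d (toI a) (toI b) = (a - b \in cyc g k 0).
Proof.
move=> dk kL; rewrite (cyc0P gP kL) /gpaley (inj_eq toI_inj) subr_eq0; congr (_ && _).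
have nat_val (z : 'F_p) : (z : nat)%:R = z by apply: natr_Zp.
have bp : (b <= p)%N by apply: ltnW; exact: Fp_lt.
have subE : ((a + p - b)%N%:R : 'F_p) = a - b.
  rewrite -addnBA // natrD natrB // !nat_val; have := pchar_Fp_0 p_pr.
  by move=> /= ->; rewrite sub0r.
rewrite dk; apply/existsP/existsP => [[w /eqP E]|[z /eqP E]].
  by exists ((w : nat)%:R); rewrite -natrX -subE Fp_nat_eq; apply/eqP.
exists (toI z); apply/eqP; apply/eqP; rewrite -Fp_nat_eq natrX nat_val E subE.
exact: eqxx.
Qed.

Lemma card_Fp_pred : #|'F_p|.-1 = p.-1.
Proof. by rewrite card_Fp. Qed.

Lemma cyc_N1 : (p %% 4 = 1)%N -> (2 %| #|'F_p|.-1)%N /\ -1 \in cyc g 2 0.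
Proof.
move=> p4; have [q pE] : exists q, p = (4 * q + 1)%N.
  by exists (p %/ 4)%N; rewrite {1}(divn_eq p 4) p4 mulnC.
have L4 : #|'F_p|.-1 = (4 * q)%N by rewrite card_Fp_pred // pE addn1.
have L2 : (2 %| #|'F_p|.-1)%N by rewrite L4 -[4%N]/(2 * 2)%N -mulnA dvdn_mulr.
have q0 : (0 < q)%N by case: (q) pE p_pr => // ->.
split=> //; have -> : -1 = g ^+ (2 * q).
  have sq : (g ^+ (2 * q)) ^+ 2 = 1.
    by rewrite -exprM mulnAC -[(2 * 2)%N]/4%N -L4 (prim_expr_order gP).
  move/eqP: sq; rewrite sqrf_eq1 => /orP[/eqP E|/eqP //].
  have /eqP := E; rewrite -(prim_order_dvd gP) L4 dvdn_pmul2r //.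
by rewrite (mem_cyc gP L2) mod0n modnMr.
Qed.

Lemma pred_div k : (k %| p.-1)%N -> (p.-1 %/ (p.-1 %/ k) = k)%N.
Proof.
move=> kp; have p1 := prime_gt1 p_pr; have p0 : (0 < p.-1)%N by rewrite -subn1 subn_gt0.
have k0 : (0 < p.-1 %/ k)%N by rewrite divn_gt0 ?(dvdn_gt0 p0 kp) // dvdn_leq.
by rewrite -{1}(divnK kp) mulKn.
Qed.

(** Multiplication by a power of the generator carries the connection set of class [r] to the group
    of powers on which [gpaley] is built. *)
Definition scaleI k (a : 'F_p) : 'I_p := toI (a * g ^+ k).

Lemma scaleI_eq k a b : (scaleI k a == scaleI k b) = (a == b).
Proof. by rewrite (inj_eq toI_inj) (inj_eq (mulIf (genX_neq0 gP k))). Qed.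

Lemma gpaley_scale k j r a b : (k %| p.-1)%N -> -1 \in cyc g k 0 -> r + j = 0 %[mod k] ->
  gpaley p (p.-1 %/ k) (scaleI j a) (scaleI j b) = (b - a \in cyc g k r).
Proof.
move=> kp N1 rj; have kL : (k %| #|'F_p|.-1)%N by rewrite card_Fp_pred.
rewrite (gpaleyE _ _ (pred_div kp) kL) -mulrBl -(cyc_mod g rj) (cyc_scale gP kL).
by apply/idP/idP => /(cyc_opp gP kL N1); rewrite opprB.
Qed.

Lemma fam6_cay r : n = (pdiv p * 2)%N -> (p %% 4 = 1)%N ->
  is_cay (lexprod (paley p) (complete 2))
    ((multiples n (pdiv p) :\ 0) :|: [set y : 'Z_n | (Zred (pdiv p) y : 'F_p) \in cyc g 2 r]).
Proof.
move=> nE p4; have [L2 N1] := cyc_N1 p4; have p1 := pdiv_gt1 p_pr.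
have pp : pdiv p = p by exact: pdiv_id.
have pn : (pdiv p %| n)%N by rewrite nE dvdn_mulr.
have hl (x : 'Z_n) : (x %/ p < 2)%N.
  by rewrite ltn_divLR ?prime_gt0 // mulnC -[X in (X * _)%N]pp -nE Zn_lt.
pose pr (x : 'Z_n) : 'F_p := Zred (pdiv p) x.
pose h x : 'I_p * 'I_2 := (scaleI r (pr x), Ordinal (hl x)).
have prB x y : pr y - pr x = pr (y - x) by rewrite /pr ZredD // ZredN.
have pr_eq x y : (pr x == pr y) = (y - x \in multiples n (pdiv p)).
  by rewrite -Zred_eq0 // -/(pr _) -prB subr_eq0 eq_sym.
have eqE x y : (x == y) = (pr x == pr y) && (x %/ p == y %/ p)%N.
  apply/eqP/andP => [->|[]]; first by rewrite !eqxx.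
  rewrite pr_eq multiples_subE // pp => /eqP xm /eqP xd.
  by apply: val_inj => /=; rewrite (divn_eq x p) (divn_eq y p) xm xd.
apply: (is_cay_inv n_gt1 (h := h)); last first.
- move=> x y; have -> : lexprod (paley p) (complete 2) (h x) (h y) =
      gpaley p (p.-1 %/ 2) (scaleI r (pr x)) (scaleI r (pr y)) ||
      ((scaleI r (pr x) == scaleI r (pr y)) && (x %/ p != y %/ p))%N by [].
  have p2 : (2 %| p.-1)%N by rewrite -card_Fp_pred.
  have rr : (r + r = 0 %[mod 2])%N by rewrite addnn -muln2 modnMl.
  have TE z : (z \in [set y : 'Z_n | (Zred (pdiv p) y : 'F_p) \in cyc g 2 r]) = (pr z \in cyc g 2 r).
    by rewrite inE.
  rewrite (gpaley_scale _ _ p2 N1 rr) scaleI_eq in_setU in_setD1 TE -prB orbC.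
  by congr (_ || _); rewrite subr_eq0 [y == x]eq_sym eqE -pr_eq; case: (pr x == pr y) => //=; rewrite andbT.
- by rewrite card_prod !card_ord nE pp.
move=> x y /eqP; rewrite xpair_eqE scaleI_eq => E; apply/eqP; rewrite eqE; exact: E.
Qed.

Lemma sub1Z_mem (X : {set 'F_p}) (x : 'Z_n) : n = (1 * pdiv p)%N ->
  (x \in [set subZ n (pdiv p) 1 y | y in X]) = ((Zred (pdiv p) x : 'F_p) \in X).
Proof.
move=> nE; have p1 := pdiv_gt1 p_pr.
have pn : (pdiv p %| n)%N by rewrite nE mul1n.
have xT : x \in multiples n 1 by rewrite multiples1 inE.
have [y ->] := subZ_surj n_gt1 p1 nE xT.
have -> : Zred (pdiv p) (subZ n (pdiv p) 1 y) = y.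
  by rewrite /subZ mul1n (Zred_nat _ n_gt1) // -Zn_natE.
by rewrite (mem_imset _ _ (subZ_inj n_gt1 p1 nE)).
Qed.

Lemma cubic_cay_aux r : n = (1 * pdiv p)%N -> (3 %| p.-1)%N ->
  exists h : 'Z_n -> 'I_p, [/\ injective h, #|'I_p| = n,
    (forall x y, (h x == h y) = ((Zred (pdiv p) (y - x) : 'F_p) == 0)) &
    forall x y, gpaley p (p.-1 %/ 3) (h x) (h y) = ((Zred (pdiv p) (y - x) : 'F_p) \in cyc g 3 r)].
Proof.
move=> nE p3; have p1 := pdiv_gt1 p_pr; have pn : (pdiv p %| n)%N by rewrite nE mul1n.
have L3 : (3 %| #|'F_p|.-1)%N by rewrite card_Fp_pred.
pose pr (x : 'Z_n) : 'F_p := Zred (pdiv p) x.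
have prB x y : pr y - pr x = pr (y - x) by rewrite /pr ZredD // ZredN.
have hE x y : (scaleI (2 * r) (pr x) == scaleI (2 * r) (pr y)) = (pr (y - x) == 0).
  by rewrite scaleI_eq -prB subr_eq0 eq_sym.
(* The exponent is [2 * r] because [r + 2 * r] vanishes modulo 3. *)
exists (fun x => scaleI (2 * r) (pr x)); split=> //.
- have m0 : multiples n (pdiv p) = [set 0] by rewrite (_ : pdiv p = n) ?multiplesn // [RHS]nE mul1n.
  by move=> x y /eqP; rewrite hE Zred_eq0 // m0 inE subr_eq0 => /eqP.
- by rewrite card_ord nE mul1n pdiv_id.
move=> x y; rewrite -/(pr _) -prB; apply: gpaley_scale => //; first exact: cyc3_N1.
by rewrite -{1}[r]mul1n -mulnDl modnMr.
Qed.

Lemma fam7_cay r : n = (1 * pdiv p)%N -> (3 %| p.-1)%N ->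
  is_cay (gpaley p (p.-1 %/ 3)) [set subZ n (pdiv p) 1 x | x in cyc g 3 r].
Proof.
move=> nE p3; have [h [hi hc hE gE]] := cubic_cay_aux r nE p3.
by apply: (is_cay_inv n_gt1 hi hc) => x y; rewrite gE sub1Z_mem.
Qed.

Lemma fam8_cay r : n = (1 * pdiv p)%N -> (3 %| p.-1)%N ->
  is_cay (gcompl (gpaley p (p.-1 %/ 3))) [set subZ n (pdiv p) 1 x | x in ~: cyc g 3 r :\ 0].
Proof.
move=> nE p3; have [h [hi hc hE gE]] := cubic_cay_aux r nE p3.
by apply: (is_cay_inv n_gt1 hi hc) => x y; rewrite /gcompl gE hE sub1Z_mem // in_setD1 in_setC.
Qed.

End Paleys.

Let pr5 : prime 5 := isT.

Lemma cycle5E (a b : 'F_5) :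
  cycle_graph 5 (toI pr5 a) (toI pr5 b) = (b - a \in [set 1; -1]).
Proof.
have -> : cycle_graph 5 (toI pr5 a) (toI pr5 b) = (b == a + 1) || (a == b + 1) by [].
have -> : (b == a + 1) = (b - a == 1) by rewrite subr_eq addrC.
have -> : (a == b + 1) = (b - a == -1) by rewrite [RHS]subr_eq [-1 + a]addrC [RHS]eq_sym [RHS]subr_eq.
by rewrite in_set2.
Qed.

Section Pentagons.
Variables (g : 'F_5) (gP : (#|'F_5|.-1).-primitive_root g).

Lemma squares_F5 : cyc g 2 0 = [set 1; -1].
Proof.
have [L2 N1] := cyc_N1 pr5 gP (erefl _).
apply/eqP; rewrite eq_sym eqEcard; apply/andP; split.
  apply/subsetP=> x; rewrite in_set2 => /orP[]/eqP -> //.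
  by have := mem_cyc gP L2 0 0; rewrite expr0 eqxx.
have := card_cyc gP L2 0; rewrite card_Fp // => E.
by rewrite -(leq_pmul2l (isT : 0 < 2)%N) E cards2.
Qed.

Lemma fam3_cay m r : n = (m * pdiv 5)%N -> (1 < m)%N ->
  is_cay (mcopies m (cycle_graph 5)) [set subZ n (pdiv 5) m x | x in cyc g 2 r].
Proof.
move=> nE m1; have m0 := ltnW m1; have p1 := pdiv_gt1 pr5.
have [L2 N1] := cyc_N1 pr5 gP (erefl _).
have mn : (m %| n)%N by rewrite nE dvdn_mulr.
pose q (x : R) : 'F_5 := (x %/ m)%:R.
pose h x : 'I_m * 'I_5 := (modI m0 x, scaleI pr5 g r (q x)).
have qE x y : x = y %[mod m] -> y - x = subZ n (pdiv 5) m (q y - q x).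
  move=> xy; rewrite (subZD n_gt1 p1 nE) (subZN n_gt1 p1 nE) !(subZ_nat n_gt1 p1 nE).
  have key (z : R) : z = (m * (z %/ m))%:R + (z %% m)%:R.
    by rewrite -natrD [(m * _)%N]mulnC -divn_eq -Zn_natE.
  by rewrite {1}(key y) {1}(key x) xy; ring.
have hE x y : (h x == h y) = (x == y).
  rewrite xpair_eqE modI_eq (scaleI_eq _ gP); apply/andP/eqP => [[/eqP xy /eqP qxy]|->]; last by [].
  by apply/eqP; rewrite eq_sym -subr_eq0 (qE x y xy) qxy subrr subZ0.
apply: (is_cay_inv n_gt1 (h := h)); last first.
- move=> x y; have -> : mcopies m (cycle_graph 5) (h x) (h y) = (x == y %[mod m]) &&
    cycle_graph 5 (toI pr5 (q x * g ^+ r)) (toI pr5 (q y * g ^+ r)) by [].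
  have rr : (r + r = 0 %[mod 2])%N by rewrite addnn -muln2 modnMl.
  rewrite cycle5E -mulrBl -squares_F5 -(cyc_mod g rr) (cyc_scale gP L2).
  case: eqP => xy /=.
    by rewrite (qE x y xy) (mem_imset _ _ (subZ_inj n_gt1 p1 nE)).
  apply/esym/imsetP => -[d _ E]; apply/xy/eqP.
  by rewrite -(multiples_subE n_gt1 _ _ mn) E; exact: (subZ_mem n_gt1 nE).
- by rewrite card_prod !card_ord nE.
by move=> x y /eqP; rewrite hE => /eqP.
Qed.

End Pentagons.
End FamilyGraphs.

(** * The eight families are Deza graphs of WL-rank 4 *)

Section TwoSets.
Variables (n : nat) (n_gt1 : (1 < n)%N).
Local Notation R := 'Z_n.
Local Notation A := (galg int R).
Variables X1 X2 : {set R}.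
Hypotheses (X10 : 0 \notin X1) (X20 : 0 \notin X2) (X12 : [disjoint X1 & X2]).
Hypotheses (X1N : forall x, (- x \in X1) = (x \in X1)) (X2N : forall x, (- x \in X2) = (x \in X2)).

Definition colour2 (x : R) := (x == 0, x \in X1, x \in X2).
Local Notation c := colour2.

Lemma colour2_set (Y : {set R}) (b0 b1 b2 b3 : bool) :
  (forall x, (x \in Y) = if x == 0 then b0 else if x \in X1 then b1 else if x \in X2 then b2 else b3) ->
  cset c Y.
Proof. by move=> YE x y [x0 x1 x2]; rewrite !YE x0 x1 x2. Qed.

Lemma colour2_0 : cset c [set 0].
Proof. by move=> x y [x0 _ _]; rewrite !inE. Qed.
Lemma colour2_1 : cset c X1. Proof. by move=> x y []. Qed.
Lemma colour2_2 : cset c X2. Proof. by move=> x y []. Qed.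
Lemma colour2_T : cset c setT. Proof. by move=> x y _; rewrite !inE. Qed.

(** The remaining colour is traded for [ind setT], whose product with any indicator is a multiple of
    itself, so three products are left to check. *)
Lemma colour2_Sring : cconst c (ind X1 * ind X1 : A) -> cconst c (ind X1 * ind X2 : A) ->
  cconst c (ind X2 * ind X2 : A) -> Sring c.
Proof.
move=> c11 c12 c22.
have cT := cset_ind int colour2_T; have c1 := cset_ind int colour2_1.
have c2 := cset_ind int colour2_2.
have TX Y : cconst c (ind Y * ind setT : A) by rewrite mulrC indTM; apply: cconstZ.
apply: (@Sring_span _ _ _ (ind X1) (ind X2) (ind setT)) => //.
- exact: colour2_0.
- by move=> x y [x0 x1 x2]; rewrite /c /colour2 !oppr_eq0 !X1N !X2N x0 x1 x2.
move=> f cf.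
pose rep (P : pred R) : int := if [pick x | P x] is Some x then f x else 0.
have repE (P : pred R) x : P x -> (forall y, P y -> c y = c x) -> rep P = f x.
  by rewrite /rep; case: pickP => [y Py _ E|/(_ x) -> //]; apply: cf; rewrite E.
pose v1 := rep (fun x => x \in X1); pose v2 := rep (fun x => x \in X2).
pose v3 := rep (fun x => [&& x != 0, x \notin X1 & x \notin X2]).
exists (f 0 - v3), (v1 - v3), (v2 - v3), v3; apply/ffunP=> x.
rewrite !galgD !galgZ galg_int !indE inE.
have [->|x0] := eqVneq x 0; first by rewrite (negPf X10) (negPf X20) /=; ring.
have ne0 y (Y : {set R}) : 0 \notin Y -> y \in Y -> y == 0 = false.
  by move=> Y0 yY; apply: contraNF Y0 => /eqP <-.
case: (boolP (x \in X1)) => x1.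
  rewrite (disjointFr X12 x1) (_ : v1 = f x) /=; first by ring.
  by apply: repE => // y y1; rewrite /c /colour2 y1 x1 !(disjointFr X12) // !(ne0 _ X1).
case: (boolP (x \in X2)) => x2.
  rewrite (_ : v2 = f x) /=; first by ring.
  by apply: repE => // y y2; rewrite /c /colour2 y2 x2 !(disjointFl X12) // !(ne0 _ X2).
rewrite (_ : v3 = f x) /=; first by ring.
apply: repE; rewrite ?x0 ?x1 // => y /and3P[/negPf y0 /negPf y1 /negPf y2].
by rewrite /c /colour2 y0 y1 y2 (negPf x0) (negPf x1) (negPf x2).
Qed.

Variables (T : finType) (e : rel T) (S : {set R}).
Hypotheses (e_sym : symmetric e) (e_irr : irreflexive e) (eS : is_cay e S).
Hypotheses (c11 : cconst c (ind X1 * ind X1 : A)) (c12 : cconst c (ind X1 * ind X2 : A)).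
Hypotheses (c22 : cconst c (ind X2 * ind X2 : A)) (cS : cset c S).
Variables x1 x2 x3 : R.
Hypotheses (x1X : x1 \in X1) (x2X : x2 \in X2) (x30 : x3 != 0) (x3X1 : x3 \notin X1) (x3X2 : x3 \notin X2).
Local Notation sep x y := ((x \in S) != (y \in S) \/ (cn S x)%:Z <> (cn S y)%:Z).
Hypotheses (s12 : sep x1 x2) (s13 : sep x1 x3) (s23 : sep x2 x3).
Hypothesis d123 : [\/ (cn S x1)%:Z = (cn S x2)%:Z, (cn S x1)%:Z = (cn S x3)%:Z
  | (cn S x2)%:Z = (cn S x3)%:Z].

Theorem backward_two_sets : [/\ is_Deza e, is_circulant e & WL_rank_is e 4].
Proof.
have Sc := colour2_Sring c11 c12 c22.
have x10 : x1 != 0 by apply: contraNneq X10 => <-.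
have x20 : x2 != 0 by apply: contraNneq X20 => <-.
have sepE x y : sep x y -> (x \in S) != (y \in S) \/ cn S x != cn S y.
  by case=> [|/eqP]; [left|right].
apply: (@backward_bridge T e e_sym e_irr n n_gt1 S eS _ c Sc cS x1 x2 x3 x10 x20 x30);
  try exact: sepE.
- move=> x x0; rewrite /c /colour2 (negPf x0) (negPf x10) (negPf x20) (negPf x30).
  rewrite x1X x2X (negPf x3X1) (negPf x3X2) (disjointFr X12 x1X) (disjointFl X12 x2X).
  case: (boolP (x \in X1)) => xX1; first by rewrite (disjointFr X12 xX1); constructor 1.
  by case: (x \in X2); [constructor 2|constructor 3].
by case: d123 => /eqP; rewrite eqz_nat => /eqP; [constructor 1|constructor 2|constructor 3].
Qed.

End TwoSets.

Section Backward.
Variables (T : finType) (e : rel T).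
Hypotheses (e_sym : symmetric e) (e_irr : irreflexive e).
Variables (n : nat) (n_gt1 : (1 < n)%N) (S : {set 'Z_n}).
Hypothesis eS : is_cay e S.
Local Notation R := 'Z_n.
Local Notation A := (galg int R).
Local Notation good := [/\ is_Deza e, is_circulant e & WL_rank_is e 4].

Lemma subg_D0N (H : {set R}) x : is_subgroup H -> (- x \in H :\ 0) = (x \in H :\ 0).
Proof. by move=> sH; rewrite !in_setD1 oppr_eq0 subgN. Qed.

Lemma subg_CN (H : {set R}) x : is_subgroup H -> (- x \in ~: H) = (x \in ~: H).
Proof. by move=> sH; rewrite !in_setC subgN. Qed.

Section Tensor.
Variables h k : nat.
Hypotheses (nE : n = (h * k)%N) (co : coprime h k) (h1 : (1 < h)%N) (k1 : (1 < k)%N).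
Local Notation H := (multiples n h).
Local Notation K := (multiples n k).
Local Notation c := (colour2 (H :\ 0) (K :\ 0)).

Lemma backward_tensor : cset c S ->
  (((h%:R : R) \in S) != (k%:R \in S) \/ (cn S h%:R)%:Z <> (cn S k%:R)%:Z) ->
  (((h%:R : R) \in S) != (1 \in S) \/ (cn S h%:R)%:Z <> (cn S 1)%:Z) ->
  (((k%:R : R) \in S) != (1 \in S) \/ (cn S k%:R)%:Z <> (cn S 1)%:Z) ->
  [\/ (cn S h%:R)%:Z = (cn S k%:R)%:Z, (cn S h%:R)%:Z = (cn S 1)%:Z | (cn S k%:R)%:Z = (cn S 1)%:Z] ->
  good.
Proof.
move=> cS s12 s13 s23 d.
have hn : (h %| n)%N by rewrite nE dvdn_mulr.
have kn : (k %| n)%N by rewrite nE dvdn_mull.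
have h0 := ltnW h1; have k0 := ltnW k1.
have sH := multiples_subg n_gt1 hn; have sK := multiples_subg n_gt1 kn.
have [H0 _] := sH; have [K0 _] := sK.
have I0 := @multiplesI0 n n_gt1 h k nE co.
have dis : [disjoint H :\ 0 & K :\ 0].
  rewrite -setI_eq0; apply/eqP/setP=> x; rewrite in_set0 in_setI !in_setD1.
  by have := I0 x; case: (x == 0); case: (x \in H); case: (x \in K).
have cH : cset c H.
  apply: (@colour2_set _ _ _ _ true true false false) => x; rewrite !in_setD1.
  by have := I0 x; have [->|_] := eqVneq x 0; rewrite ?H0 //=; do 2 case: (_ \in _).
have cK : cset c K.
  apply: (@colour2_set _ _ _ _ true false true false) => x; rewrite !in_setD1.
  by have := I0 x; have [->|_] := eqVneq x 0; rewrite ?K0 //=; do 2 case: (_ \in _).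
have cH' := cset_ind int cH; have cK' := cset_ind int cK.
have cT' := cset_ind int (@colour2_T _ (H :\ 0) (K :\ 0)).
have c1 (a : int) : cconst c (a%:~R : A) by apply/cconst_int/colour2_0.
have kh : ~~ (h %| k)%N by apply/negP=> hk; move: co; rewrite /coprime (gcdn_idPl hk) => /eqP E; move: h1; rewrite E.
have hk : ~~ (k %| h)%N by apply/negP=> kh'; move: co; rewrite /coprime (gcdn_idPr kh') => /eqP E; move: k1; rewrite E.
have hK : (h%:R : R) \notin K by rewrite mem_multiples.
have kH : (k%:R : R) \notin H by rewrite mem_multiples.
have ne0 w M : is_subgroup M -> w \notin M -> w != 0 :> R.
  by case=> M0 _; apply: contraNneq => ->.
apply: (@backward_two_sets _ n_gt1 (H :\ 0) (K :\ 0) _ _ dis _ _ T e S e_sym e_irr eS _ _ _ cS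
   h%:R k%:R 1) => //.
- by rewrite in_setD1 eqxx.
- by rewrite in_setD1 eqxx.
- by move=> x; rewrite subg_D0N.
- by move=> x; rewrite subg_D0N.
- rewrite ind_setD0 //; have -> : (ind H - 1) * (ind H - 1) = (#|H|%:Z - 2)%:~R * ind H + 1%:~R :> A.
    by transitivity (ind H * ind H - 2%:R * ind H + 1 : A); [ring|rewrite ind_subgM //; ring].
  exact: cconstD (cconstZ _ cH') (c1 _).
- rewrite !ind_setD0 //; have -> : (ind H - 1) * (ind K - 1)
     = ind setT + (-1)%:~R * ind H + (-1)%:~R * ind K + 1%:~R :> A.
    by rewrite -(ind_coprimeM n_gt1 nE co); ring.
  by apply: cconstD (c1 _); apply: cconstD (cconstZ _ cK'); apply: cconstD (cconstZ _ cH').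
- rewrite ind_setD0 //; have -> : (ind K - 1) * (ind K - 1) = (#|K|%:Z - 2)%:~R * ind K + 1%:~R :> A.
    by transitivity (ind K * ind K - 2%:R * ind K + 1 : A); [ring|rewrite ind_subgM //; ring].
  exact: cconstD (cconstZ _ cK') (c1 _).
- by rewrite in_setD1 (ne0 _ _ sK hK) mem_multiples //=.
- by rewrite in_setD1 (ne0 _ _ sH kH) mem_multiples //=.
- by rewrite in_setD1 -[1]/(1%:R) mem_multiples // dvdn1 negb_and neq_ltn h1 !orbT.
- by rewrite in_setD1 -[1]/(1%:R) mem_multiples // dvdn1 negb_and neq_ltn k1 !orbT.
Qed.
End Tensor.

Lemma backward_fam1 : fam1 S -> good.
Proof.
move=> [m [nE m1 mo SE]].
have co : coprime 4 m by rewrite (_ : 4 = 2 ^ 2)%N // coprime_pexpl // coprime2n.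
have m0 := ltnW m1.
have dn4 : (4 %| n)%N by rewrite nE dvdn_mulr.
have dnm : (m %| n)%N by rewrite nE dvdn_mull.
have s4 := multiples_subg n_gt1 dn4; have sm := multiples_subg n_gt1 dnm.
have i4 : (4%:R : R) \in multiples n 4 by rewrite mem_multiples.
have o4 : (4%:R : R) \notin multiples n m.
  rewrite mem_multiples //; apply/negP=> m4; move: mo m1; have := dvdn_leq (isT : 0 < 4)%N m4.
  by case: m m4 {nE SE co m0 dnm sm} => [|[|[|[|[|]]]]].
have im : (m%:R : R) \in multiples n m by rewrite mem_multiples.
have om : (m%:R : R) \notin multiples n 4.
  by rewrite mem_multiples //; apply/negP=> /(dvdn_trans (isT : 2 %| 4)%N); rewrite dvdn2 mo.
have u4 : (1 : R) \notin multiples n 4 by rewrite -[1]/(1%:R) mem_multiples.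
have um : (1 : R) \notin multiples n m.
  by rewrite -[1]/(1%:R) mem_multiples // dvdn1 neq_ltn m1 orbT.
have ne0 w M : is_subgroup M -> w \notin M -> w != 0 :> R.
  by case=> M0 _; apply: contraNneq => ->.
have n4 := ne0 _ _ sm o4; have nm := ne0 _ _ s4 om; have n1 := ne0 _ _ s4 u4.
have E x := cn_tensor_rook n_gt1 nE co x.
have in4 : 4%:R \in S by rewrite SE in_setD1 in_setU n4 i4.
have inm : m%:R \in S by rewrite SE in_setD1 in_setU nm im orbT.
have in1 : 1 \notin S by rewrite SE in_setD1 in_setU (negPf u4) (negPf um) andbF.
apply: (backward_tensor nE co (isT : 1 < 4)%N m1).
- apply: (@colour2_set _ _ _ _ false true true false) => x; rewrite SE !in_setD1 in_setU.
  by case: (x == 0); do 2 case: (x \in _).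
(* Both representatives belong to [S], so the counts have to separate them: these are [m - 2] and 2,
   different for odd [m]. *)
- right; rewrite SE !E i4 (negPf o4) (negPf om) im (negPf n4) (negPf nm) /= => Em.
  by move: mo; have -> : m = 4%N by clear -Em; lia.
- by left; rewrite in4 (negPf in1).
- by left; rewrite inm (negPf in1).
- by constructor 3; rewrite SE !E (negPf om) im (negPf u4) (negPf um) (negPf nm) (negPf n1).
Qed.

Lemma backward_fam2 : fam2 S -> good.
Proof.
move=> [m [nE m1 mo SE]].
have co : coprime 2 m by rewrite coprime2n.
have m0 := ltnW m1.
have dn2 : (2 %| n)%N by rewrite nE dvdn_mulr.
have dnm : (m %| n)%N by rewrite nE dvdn_mull.
have s2 := multiples_subg n_gt1 dn2; have sm := multiples_subg n_gt1 dnm.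
have i2 : (2%:R : R) \in multiples n 2 by rewrite mem_multiples.
have m2 : (2 < m)%N by move: mo m1; case: m {nE SE co m0 dnm sm} => [|[|[|]]].
have o2 : (2%:R : R) \notin multiples n m.
  by rewrite mem_multiples //; apply/negP=> /(dvdn_leq (isT : 0 < 2)%N); rewrite leqNgt m2.
have im : (m%:R : R) \in multiples n m by rewrite mem_multiples.
have om : (m%:R : R) \notin multiples n 2 by rewrite mem_multiples // dvdn2 mo.
have u2 : (1 : R) \notin multiples n 2 by rewrite -[1]/(1%:R) mem_multiples.
have um : (1 : R) \notin multiples n m.
  by rewrite -[1]/(1%:R) mem_multiples // dvdn1 neq_ltn m1 orbT.
have ne0 w M : is_subgroup M -> w \notin M -> w != 0 :> R.
  by case=> M0 _; apply: contraNneq => ->.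
have n2 := ne0 _ _ sm o2; have nm := ne0 _ _ s2 om; have n1 := ne0 _ _ s2 u2.
have E x := cn_tensor_generic n_gt1 nE co x.
have in2 : 2%:R \notin S by rewrite SE in_setC in_setU i2.
have inm : m%:R \notin S by rewrite SE in_setC in_setU im orbT.
have in1 : 1 \in S by rewrite SE in_setC in_setU (negPf u2) (negPf um).
apply: (backward_tensor nE co (isT : 1 < 2)%N m1).
- have [Z2 _] := s2.
  apply: (@colour2_set _ _ _ _ false false false true) => x; rewrite SE !in_setD1 in_setC in_setU.
  by have [->|_] := eqVneq x 0; rewrite ?Z2 //=; do 2 case: (x \in _).
- right; rewrite SE !E i2 (negPf o2) (negPf om) im (negPf n2) (negPf nm) /= => Em.
  by clear -Em m2; lia.
- by left; rewrite in1 (negPf in2).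
- by left; rewrite in1 (negPf inm).
- by constructor 3; rewrite SE !E (negPf om) im (negPf u2) (negPf um) (negPf nm) (negPf n1) /=; ring.
Qed.


Section Chain.
Variables l m h : nat.
Hypotheses (nE : n = (l * m * h)%N) (l1 : (1 < l)%N) (m1 : (1 < m)%N) (h1 : (1 < h)%N).
Local Notation H := (multiples n (l * m)).
Local Notation U := (multiples n l).
Local Notation a := ((l * m)%:R : R).
Local Notation b := (l%:R : R).
Local Notation d := (1 : R).

Let l0 : (0 < l)%N. Proof. exact: ltnW. Qed.
Let lmn : (l * m %| n)%N. Proof. by rewrite nE dvdn_mulr. Qed.
Let ln : (l %| n)%N. Proof. by apply: dvdn_trans lmn; rewrite dvdn_mulr. Qed.

Lemma chain_subgroups : [/\ is_subgroup H, is_subgroup U, H \subset U, #|U| = (m * h)%N & #|H| = h].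
Proof.
split; [exact: multiples_subg|exact: multiples_subg|by rewrite multiples_sub // dvdn_mulr| |].
  by rewrite card_multiples // nE -mulnA mulKn.
by rewrite card_multiples // nE mulKn // muln_gt0 l0 ltnW.
Qed.

Lemma chain_reps : [/\ a \in H, b \in U, b \notin H, d \notin U & a != 0].
Proof.
split; rewrite ?mem_multiples //.
- by rewrite -[X in (_ %| X)%N]muln1 dvdn_pmul2l // dvdn1 neq_ltn m1 orbT.
- by rewrite -[1]/(1%:R) mem_multiples // dvdn1 neq_ltn l1 orbT.
rewrite Zn_eq0 // [X in (X %| _)%N]nE -[X in (_ %| X)%N]muln1 dvdn_pmul2l ?muln_gt0 ?l0 ?(ltnW m1) //.
by rewrite dvdn1 neq_ltn h1 orbT.
Qed.

Local Notation sep x y := ((x \in S) != (y \in S) \/ (cn S x)%:Z <> (cn S y)%:Z).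

Lemma backward_chain : cset (fun x => (x == 0, x \in H, x \in U)) S ->
  sep a b -> sep a d -> sep b d ->
  [\/ (cn S a)%:Z = (cn S b)%:Z, (cn S a)%:Z = (cn S d)%:Z | (cn S b)%:Z = (cn S d)%:Z] -> good.
Proof.
move=> cS s12 s13 s23 d123.
have [sH sU HU _ _] := chain_subgroups; have [aH bU bH dU a0] := chain_reps.
have HUx x : x \in H -> x \in U := subsetP HU x.
have dH : d \notin H by apply: contra dU; apply: HUx.
have b0 : b != 0 by apply: contraNneq bH => ->; case: sH.
have sepE x y : sep x y -> (x \in S) != (y \in S) \/ cn S x != cn S y.
  by case=> [|/eqP]; [left|right].
apply: (@backward_bridge T e e_sym e_irr n n_gt1 S eS _ _ (chain_colour_Sring sH sU HU) cS a b d a0 b0 (oner_neq0 _));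
  try exact: sepE.
- move=> x x0; rewrite (negPf x0) (negPf a0) (negPf b0) oner_eq0 aH (HUx _ aH) bU (negPf bH) (negPf dU) (negPf dH).
  case: (boolP (x \in H)) => [/HUx ->|_]; first by constructor 1.
  by case: (x \in U); [constructor 2|constructor 3].
by case: d123 => /eqP; rewrite eqz_nat => /eqP; [constructor 1|constructor 2|constructor 3].
Qed.
End Chain.

Lemma backward_fam4 : fam4 S -> good.
Proof.
move=> [l [m [nE l1 m1 SE]]].
have [sH sU HU cU cH] := chain_subgroups nE l1 (isT : 1 < 2)%N.
have [aH bU bH dU a0] := chain_reps nE l1 (isT : 1 < 2)%N m1.
have HUx x := subsetP HU x; have aU := HUx _ aH.
have dH : (1 : R) \notin multiples n (l * 2) by apply: contra dU; apply: HUx.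
have E x := cn_chain_mid sH sU HU x; rewrite cU cH in E.
have ia : (l * 2)%:R \notin S by rewrite SE in_setD aH.
have ib : l%:R \in S by rewrite SE in_setD bH bU.
have id : 1 \notin S by rewrite SE in_setD (negPf dU) andbF.
apply: (backward_chain nE l1 (isT : 1 < 2)%N m1).
- by move=> x y [x0 xH xU]; rewrite SE !in_setD xH xU.
- by left; rewrite ib (negPf ia).
(* Neither representative belongs to [S]; their counts are [m] and 0. *)
- right; rewrite SE !E aH aU (negPf dH) (negPf dU) /= => Em; clear -Em m1; lia.
- by left; rewrite ib (negPf id).
by constructor 3; rewrite SE !E bU (negPf bH) (negPf dH) (negPf dU) /=; clear; lia.
Qed.

Lemma backward_fam5 : fam5 S -> good.
Proof.
move=> [l [m [nE l1 m1 SE]]].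
have [sH sU HU cU cH] := chain_subgroups nE l1 m1.
have [aH bU bH dU a0] := chain_reps nE l1 m1 (isT : 1 < 2)%N.
have HUx x := subsetP HU x; have aU := HUx _ aH.
have dH : (1 : R) \notin multiples n (l * m) by apply: contra dU; apply: HUx.
have b0 : l%:R != 0 :> R by apply: contraNneq bH => ->; case: sH.
have E x := cn_chain_ends n_gt1 sH sU HU x; rewrite cU cH in E.
have ia : (l * m)%:R \in S by rewrite SE in_setU in_setD1 a0 aH orbT.
have ib : l%:R \notin S by rewrite SE in_setU in_setC in_setD1 bU (negPf bH) andbF.
have id : 1 \in S by rewrite SE in_setU in_setC dU.
apply: (backward_chain nE l1 m1 (isT : 1 < 2)%N).
- by move=> x y [x0 xH xU]; rewrite SE !in_setU !in_setC !in_setD1 x0 xH xU.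
- by left; rewrite ia (negPf ib).
- right; rewrite SE !E aH aU (negPf dH) (negPf dU) (negPf a0) oner_eq0 /= => Em; clear -Em m1; lia.
- by left; rewrite id (negPf ib).
by constructor 1; rewrite SE !E aH aU bU (negPf bH) (negPf a0) (negPf b0) /=; clear; lia.
Qed.

Lemma invol_mem (G : zmodType) (X : pred G) : (forall x, X x -> X (- x)) ->
  forall x, X (- x) = X x.
Proof. by move=> XN x; apply/idP/idP => /XN //; rewrite opprK. Qed.

Section OnePrime.
Variables (p : nat) (p_pr : prime p) (g : 'F_p) (gP : (#|'F_p|.-1).-primitive_root g).
Let p1 := pdiv_gt1 p_pr.

Lemma cyc_img_N d l i : n = (l * pdiv p)%N -> (d %| #|'F_p|.-1)%N -> -1 \in cyc g d 0 ->
  forall x, (- x \in [set subZ n (pdiv p) l y | y in cyc g d i])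
            = (x \in [set subZ n (pdiv p) l y | y in cyc g d i]).
Proof.
move=> nE dL N1; apply: invol_mem => x /imsetP[y yi ->]; rewrite -(subZN n_gt1 p1 nE).
by apply: imset_f; apply: cyc_opp.
Qed.

Lemma cyc_img0 d l i : n = (l * pdiv p)%N ->
  0 \notin [set subZ n (pdiv p) l y | y in cyc g d i].
Proof.
move=> nE; rewrite -(subZ0 n (pdiv p) l) (mem_imset _ _ (subZ_inj n_gt1 p1 nE)).
by rewrite inE eqxx.
Qed.

Section PaleySub.
Hypothesis p5 : p = 5.
Variables (l r : nat).
Hypotheses (nE : n = (l * pdiv p)%N) (l1 : (1 < l)%N).
Hypothesis SE : S = [set subZ n (pdiv p) l x | x in cyc g 2 r].
Local Notation U := (multiples n l).
Local Notation c := (colour2 S (~: U)).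

Lemma backward_paley_sub : good.
Proof.
have [L2 N1] : (2 %| #|'F_p|.-1)%N /\ -1 \in cyc g 2 0 by apply: cyc_N1 => //; rewrite p5.
have ln : (l %| n)%N by rewrite nE dvdn_mulr.
have sU := multiples_subg n_gt1 ln; have [U0 _] := sU.
have SU : S \subset U by rewrite SE; exact: (S0_subU n_gt1 g nE).
have S0 : 0 \notin S by rewrite SE; apply: cyc_img0.
have dis : [disjoint S & ~: U] by rewrite disjoints_subset setCK.
have cU : cset c U.
  by move=> x y [_ _]; rewrite !in_setC => /negb_inj.
have cS : cset c S := @colour2_1 _ _ _.
have cU' := cset_ind int cU; have cS' := cset_ind int cS.
have cT' := cset_ind int (@colour2_T _ S (~: U)).
have c1 (a : int) : cconst c (a%:~R : A) by apply/cconst_int/colour2_0.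
have [mu [pE US TS E]] := paley_sub_sqr n_gt1 p_pr gP L2 N1 nE r; rewrite -SE in US TS E.
have [mu' pE' cnS] := cn_paley_inside n_gt1 p_pr gP L2 N1 nE r; rewrite -SE in cnS.
have mu1 : mu' = 1%N by clear -pE' p5; lia.
have UU : ind U * ind U = (#|U|%:Z)%:~R * ind U :> A by rewrite ind_subgM.
have TU : ind setT * ind U = (#|U|%:Z)%:~R * ind setT :> A by rewrite indTM.
have inS k : (subZ n (pdiv p) l (g ^+ k) \in S) = (k == r %[mod 2]).
  by rewrite SE (mem_imset _ _ (subZ_inj n_gt1 p1 nE)) (mem_cyc gP L2).
have inU k : subZ n (pdiv p) l (g ^+ k) \in U by exact: (subZ_mem n_gt1 nE).
have n0 k : subZ n (pdiv p) l (g ^+ k) != 0.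
  by rewrite -(subZ0 n (pdiv p) l) (inj_eq (subZ_inj n_gt1 p1 nE)) (genX_neq0 gP).
have i1 : subZ n (pdiv p) l (g ^+ r) \in S by rewrite inS eqxx.
have i2 : subZ n (pdiv p) l (g ^+ r.+1) \notin S.
  by rewrite inS -addn1 -[X in _ == X %[mod _]]addn0 eqn_modDl.
have dU : (1 : R) \notin U by rewrite -[1]/(1%:R) mem_multiples // dvdn1 neq_ltn l1 orbT.
have dS : 1 \notin S by apply: contra dU; apply: (subsetP SU).
apply: (@backward_two_sets _ n_gt1 S (~: U) S0 _ dis _ _ T e S e_sym e_irr eS _ _ _ cS
   (subZ n (pdiv p) l (g ^+ r)) 1 (subZ n (pdiv p) l (g ^+ r.+1)) i1) => //.
- by rewrite in_setC U0.
- by rewrite SE; apply: cyc_img_N.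
- by move=> x; rewrite subg_CN.
- rewrite E mulr1; apply: cconstD (cconstZ _ cS'); apply: cconstD (c1 _) _.
  by apply: cconstZ; apply: cconstD cU' (c1 (-1)).
- rewrite ind_setT_sub mulrC; have -> : (ind setT - ind U) * ind S
      = (2 * mu%:Z)%:~R * ind setT + (- (2 * mu%:Z))%:~R * ind U :> A.
    by rewrite mulrBl US TS; ring.
  exact: cconstD (cconstZ _ cT') (cconstZ _ cU').
- rewrite ind_setT_sub; have -> : (ind setT - ind U) * (ind setT - ind U)
      = (n%:Z - 2 * #|U|%:Z)%:~R * ind setT + (#|U|%:Z)%:~R * ind U :> A.
    transitivity (ind setT * ind setT - 2%:R * (ind setT * ind U) + ind U * ind U : A); first by ring.
    by rewrite ind_TT // TU UU; ring.
  exact: cconstD (cconstZ _ cT') (cconstZ _ cU').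
- by rewrite in_setC.
- by rewrite in_setC negbK.
- by left; rewrite i1 (negPf dS).
- by left; rewrite i1 (negPf i2).
(* With [mu' = 1] the count is 1 on the other quadratic class, and 0 both on [S] and outside [U]:
   this separates the non-neighbours and leaves the coincidence that the Deza condition asks for. *)
- right; rewrite !cnS ?oner_eq0 // inU (negPf dU) (negPf dS) (negPf i2) mu1.
  by [].
constructor 1; rewrite !cnS ?oner_eq0 // inU (negPf dU) (negPf dS) i1 mu1.
by [].
Qed.
End PaleySub.

Section PaleyQuo.
Variable r : nat.
Hypotheses (p4 : (p %% 4 = 1)%N) (nE : n = (pdiv p * 2)%N).
Local Notation H := (multiples n (pdiv p)).
Local Notation S0 := [set y : R | (Zred (pdiv p) y : 'F_p) \in cyc g 2 r].
Hypothesis SE : S = (H :\ 0) :|: S0.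
Local Notation c := (colour2 S0 (H :\ 0)).

Lemma backward_paley_quo : good.
Proof.
have [L2 N1] : (2 %| #|'F_p|.-1)%N /\ -1 \in cyc g 2 0 by apply: cyc_N1.
have pn : (pdiv p %| n)%N by rewrite nE dvdn_mulr.
have sH := multiples_subg n_gt1 pn; have [H0 _] := sH.
pose pr (x : R) : 'F_p := Zred (pdiv p) x.
pose li (x : 'F_p) : R := Zred n x.
have prli x : pr (li x) = x by exact: Zred_lift.
have pr0 x : (pr x == 0) = (x \in H) by exact: Zred_eq0.
have inS0 x : (x \in S0) = (pr x \in cyc g 2 r) by rewrite inE.
have HS0 x : x \in H -> x \notin S0.
  by rewrite -pr0 => /eqP x0; rewrite inS0 x0 inE eqxx.
have dis : [disjoint S0 & H :\ 0].
  rewrite disjoint_sym disjoints_subset; apply/subsetP=> x; rewrite in_setD1 in_setC => /andP[_].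
  exact: HS0.
have c1' : cset c S0 := @colour2_1 _ _ _.
have cH : cset c H.
  apply: (@colour2_set _ _ _ _ true false true false) => x; rewrite in_setD1.
  have [->|_] := eqVneq x 0; first by rewrite H0.
  by case: (boolP (x \in S0)) => [xS|_] /=; [apply/negbTE; apply: contraL xS; apply: HS0|case: (x \in H)].
have cS : cset c S.
  by move=> x y [_ x1 x2]; rewrite SE !in_setU x1 x2.
have cH' := cset_ind int cH; have cS' := cset_ind int c1'.
have cT' := cset_ind int (@colour2_T _ S0 (H :\ 0)).
have c1 (a : int) : cconst c (a%:~R : A) by apply/cconst_int/colour2_0.
have [mu [pE HS E]] := paley_quo_sqr n_gt1 p_pr gP L2 N1 nE r.
have [mu' pE' cnS] := cn_paley_clique n_gt1 p_pr gP L2 N1 nE r; rewrite -SE in cnS.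
have mu0 : (0 < mu')%N by move: pE' (prime_gt1 p_pr); clear; lia.
have HH : ind H * ind H = (#|H|%:Z)%:~R * ind H :> A by rewrite ind_subgM.
have liH k : li (g ^+ k) \notin H by rewrite -pr0 prli (genX_neq0 gP).
have n0 k : li (g ^+ k) != 0 by apply: contraNneq (liH k) => ->.
have inS k : (li (g ^+ k) \in S0) = (k == r %[mod 2]) by rewrite inS0 prli (mem_cyc gP L2).
have i1 : li (g ^+ r) \in S0 by rewrite inS eqxx.
have i2 : li (g ^+ r.+1) \notin S0 by rewrite inS -addn1 -[X in _ == X %[mod _]]addn0 eqn_modDl.
have aH : ((pdiv p)%:R : R) \in H by rewrite mem_multiples.
have a0 : ((pdiv p)%:R : R) != 0.
  by rewrite Zn_eq0 // [X in (X %| _)%N]nE -[X in (_ %| X)%N]muln1 dvdn_pmul2l ?(ltnW p1).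
have aS := HS0 _ aH.
apply: (@backward_two_sets _ n_gt1 S0 (H :\ 0) _ _ dis _ _ T e S e_sym e_irr eS _ _ _ cS
   (li (g ^+ r)) (pdiv p)%:R (li (g ^+ r.+1)) i1) => //.
- exact: HS0.
- by rewrite in_setD1 eqxx.
- apply: (@invol_mem _ (fun x => x \in S0)) => x; rewrite !inS0 /pr ZredN //; exact: cyc_opp.
- by move=> x; rewrite subg_D0N.
- rewrite E; apply: cconstD (cconstZ _ cS'); apply: cconstD (cconstZ _ cH') _.
  apply: cconstZ; have -> : ind setT - ind H = ind setT + (-1)%:~R * ind H :> A by ring.
  exact: cconstD cT' (cconstZ _ cH').
- rewrite ind_setD0 // mulrBr mulr1 mulrC HS.
  have -> (u : A) : (2%:Z)%:~R * u - u = (1%:Z)%:~R * u by ring.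
  exact: cconstZ.
- rewrite ind_setD0 //; have -> : (ind H - 1) * (ind H - 1) = (#|H|%:Z - 2)%:~R * ind H + 1%:~R :> A.
    by transitivity (ind H * ind H - 2%:R * ind H + 1 : A); [ring|rewrite HH; ring].
  exact: cconstD (cconstZ _ cH') (c1 _).
- by rewrite in_setD1 a0.
- by rewrite in_setD1 (negPf (liH _)) andbF.
- right; rewrite !cnS // i1 aH (negPf aS) (negPf (liH _)) => Em; clear -Em mu0; lia.
- by left; rewrite SE !in_setU !in_setD1 i1 (negPf i2) !(negPf (liH _)) !andbF.
- by left; rewrite SE !in_setU !in_setD1 aH a0 (negPf i2) !(negPf (liH _)) !andbF.
constructor 2; rewrite !cnS // i1 (negPf i2) !(negPf (liH _)); clear; lia.
Qed.
End PaleyQuo.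

Section Cubic.
Variable r : nat.
Hypotheses (L3 : (3 %| #|'F_p|.-1)%N) (nE : n = (1 * pdiv p)%N).
Local Notation io := (subZ n (pdiv p) 1).
Local Notation Xs i := [set io x | x in cyc g 3 i].
Local Notation c := (colour2 (Xs r) (Xs (1 + r))).

Let N1 := cyc3_N1 gP L3.
Let io_inj : injective io := subZ_inj n_gt1 p1 nE.

Let io0 x : (io x == 0) = (x == 0).
Proof. by rewrite -(subZ0 n (pdiv p) 1) (inj_eq io_inj). Qed.

Let ioE i x : (io x \in Xs i) = (x \in cyc g 3 i).
Proof. exact: mem_imset. Qed.

Let sur x : exists y, x = io y.
Proof. by apply: (subZ_surj n_gt1 p1 nE); rewrite multiples1 inE. Qed.

(** Membership in two of the three cubic classes determines the class of a nonzero element, the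
    third being the one where both fail. *)
Lemma cubic_colour x y : c (io x) = c (io y) -> x = y \/
  [/\ x != 0, y != 0 & lg g x = lg g y %[mod 3]].
Proof.
move=> []; rewrite !io0 !ioE; have [->|x0] := eqVneq x 0.
  by move=> /esym/eqP ->; left.
move=> /esym/negbT y0; rewrite !inE x0 y0 /= => E0 E1; right; split=> //; apply/eqP.
have lt u : (u %% 3 < 3)%N by rewrite ltn_mod.
move: E0 E1 (lt (lg g x)) (lt (lg g y)) (lt r).
rewrite -[((1 + r) %% 3)%N]modnDmr.
by case: (r %% 3)%N => [|[|[|//]]]; case: (lg g x %% 3)%N => [|[|[|//]]];
  case: (lg g y %% 3)%N => [|[|[|//]]].
Qed.

Lemma cubic_const i j : cconst c (ind (Xs i) * ind (Xs j) : A).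
Proof.
move=> x y; have [u ->] := sur x; have [v ->] := sur y => /cubic_colour[-> //|[u0 v0 uv]].
rewrite -!(galg_sub_ind n_gt1 p1 nE) -(galg_subM n_gt1 p1 nE) !(galg_subE n_gt1 p1 nE).
have vc : v \in cyc g 3 (lg g u) by rewrite inE v0 uv eqxx.
have uc : u \in cyc g 3 (lg g u) by rewrite inE u0 eqxx.
by rewrite (cyc_const gP _ _ L3 uc) (cyc_const gP _ _ L3 vc).
Qed.

Hypothesis cS : cset c S.
Local Notation z j := (io (g ^+ (j + r))).
Local Notation sep x y := ((x \in S) != (y \in S) \/ (cn S x)%:Z <> (cn S y)%:Z).

Lemma backward_cubic : sep (z 0%N) (z 1%N) -> sep (z 0%N) (z 2%N) -> sep (z 1%N) (z 2%N) ->
  [\/ (cn S (z 0%N))%:Z = (cn S (z 1%N))%:Z, (cn S (z 0%N))%:Z = (cn S (z 2%N))%:Z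
    | (cn S (z 1%N))%:Z = (cn S (z 2%N))%:Z] -> good.
Proof.
move=> s01 s02 s12 d.
have mc i j : (g ^+ (j + r) \in cyc g 3 (i + r)) = (j == i %[mod 3]).
  by rewrite (mem_cyc gP L3) eqn_modDr.
have dis : [disjoint Xs r & Xs (1 + r)].
  rewrite -setI_eq0; apply/eqP/setP=> x; have [y ->] := sur x; rewrite in_set0 in_setI !ioE.
  apply/negP=> /andP[y1 y2]; have /eqP := cyc_disjoint y1 y2.
  by rewrite -[X in X == _ %[mod _]]add0n eqn_modDr.
have mcr j : (g ^+ (j + r) \in cyc g 3 r) = (j == 0 %[mod 3]) by rewrite -(mc 0%N).
apply: (@backward_two_sets _ n_gt1 (Xs r) (Xs (1 + r)) _ _ dis _ _ T e S e_sym e_irr eS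
  (cubic_const _ _) (cubic_const _ _) (cubic_const _ _) cS (z 0%N) (z 1%N) (z 2%N)) => //.
- exact: cyc_img0.
- exact: cyc_img0.
- exact: cyc_img_N.
- exact: cyc_img_N.
- by rewrite ioE mcr.
- by rewrite ioE mc.
- by rewrite io0 (genX_neq0 gP).
- by rewrite ioE mcr.
- by rewrite ioE mc.
Qed.
End Cubic.

Section CubicFamilies.
Variables (r t : nat) (p3 : (3 %| p.-1)%N) (nE : n = (1 * pdiv p)%N).
Local Notation io := (subZ n (pdiv p) 1).

Let L3 : (3 %| #|'F_p|.-1)%N. Proof. by rewrite card_Fp_pred. Qed.

Let mcr j : (g ^+ (j + r) \in cyc g 3 r) = (j == 0 %[mod 3]).
Proof. by rewrite (mem_cyc gP L3) -[X in _ == X %[mod _]]add0n eqn_modDr. Qed.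

Lemma cubic_neq B C D : p = (3 * (B + C + D) + 1)%N -> cubic_rel B C D -> B <> C.
Proof.
move=> pE rel BC; have [s sE] := cubic_rel_square rel BC; move: p_pr.
by rewrite pE sE (negPf (square_not_prime s)).
Qed.

Lemma backward_plus3 : p = (t ^ 2 + 3)%N -> S = [set io x | x in cyc g 3 r] -> good.
Proof.
move=> pt SE; have [B [C [D [pE rel E]]]] := cn_cubic p_pr gP L3 r.
have mc j : g ^+ (j + r) \in cyc g 3 (j + r) by rewrite (mem_cyc gP L3).
have [E0 _] := E _ 0%N isT (mc 0%N); have [E1 _] := E _ 1%N isT (mc 1%N).
have [E2 _] := E _ 2%N isT (mc 2%N).
have inS j : (io (g ^+ (j + r)) \in S) = (j == 0 %[mod 3]).
  by rewrite SE (mem_imset _ _ (subZ_inj n_gt1 p1 nE)) mcr.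
apply: (backward_cubic (r := r) L3 nE).
- by rewrite SE; apply: colour2_1.
- by left; rewrite !inS.
- by left; rewrite !inS.
(* The two other classes both lie outside [S]; their counts [B] and [C] differ because [p] is not a
   square. *)
- right; rewrite SE !(cn_sub p_pr n_gt1 nE) E1 E2 /= => -[].
  exact: (cubic_neq pE rel).
rewrite SE !(cn_sub p_pr n_gt1 nE) E0 E1 E2 /=.
by case: (plus3_cubic_rel p_pr pE rel pt) => ->; [constructor 1|constructor 2]; lia.
Qed.

Lemma backward_plus12 : p = (t ^ 2 + 12)%N ->
  S = [set io x | x in ~: cyc g 3 r :\ 0] -> good.
Proof.
move=> pt SE; have [B [C [D [pE rel E]]]] := cn_cubic p_pr gP L3 r.
have mc j : g ^+ (j + r) \in cyc g 3 (j + r) by rewrite (mem_cyc gP L3).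
have [_ E0] := E _ 0%N isT (mc 0%N); have [_ E1] := E _ 1%N isT (mc 1%N).
have [_ E2] := E _ 2%N isT (mc 2%N).
have ioS x : (io x \in S) = (x != 0) && (x \notin cyc g 3 r).
  by rewrite SE (mem_imset _ _ (subZ_inj n_gt1 p1 nE)) in_setD1 in_setC.
have inS j : (io (g ^+ (j + r)) \in S) = (j != 0 %[mod 3]) by rewrite ioS mcr (genX_neq0 gP).
apply: (backward_cubic (r := r) L3 nE).
- have sur x : exists y, x = io y.
    by apply: (subZ_surj n_gt1 p1 nE); rewrite multiples1 inE.
  move=> x y; have [u ->] := sur x; have [v ->] := sur y => -[].
  have io0 w : (io w == 0) = (w == 0).
    by rewrite -(subZ0 n (pdiv p) 1) (inj_eq (subZ_inj n_gt1 p1 nE)).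
  rewrite !ioS !io0.
  by rewrite !(mem_imset _ _ (subZ_inj n_gt1 p1 nE)) => -> ->.
- by left; rewrite !inS.
- by left; rewrite !inS.
- right; rewrite SE !(cn_sub p_pr n_gt1 nE) E1 E2 /= => BC.
  by apply: (cubic_neq pE rel); clear -BC; lia.
rewrite SE !(cn_sub p_pr n_gt1 nE) E0 E1 E2 /=.
by case: (plus12_cubic_rel p_pr pE rel pt) => ->; [constructor 1|constructor 2]; lia.
Qed.
End CubicFamilies.
End OnePrime.

Lemma backward_fam3 : fam3 S -> good.
Proof.
by move=> [m [g [r [nE m1 gP SE]]]]; apply: (@backward_paley_sub 5 isT g gP erefl m r).
Qed.

Lemma backward_fam6 : fam6 S -> good.
Proof.
by move=> [p [g [r [nE p_pr p4 gP SE]]]]; apply: (@backward_paley_quo p p_pr g gP r).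
Qed.

Lemma backward_fam7 : fam7 S -> good.
Proof.
by move=> [p [t [g [r [nE p_pr pt p3 [gP SE]]]]]]; apply: (@backward_plus3 p p_pr g gP r t).
Qed.

Lemma backward_fam8 : fam8 S -> good.
Proof.
by move=> [p [t [g [r [nE p_pr pt p3 [gP SE]]]]]]; apply: (@backward_plus12 p p_pr g gP r t).
Qed.
End Backward.

(** * Assembling the two directions *)

Section Assembly.
Variables (T : finType) (e : rel T).
Hypotheses (e_sym : symmetric e) (e_irr : irreflexive e).

(** Four nonempty classes need at least four pairs of vertices. *)
Lemma WL_rank4_card : WL_rank_is e 4 -> (1 < #|T|)%N.
Proof.
move=> [P [[cP _ _] P4]]; case: cP => PT _ _ _.
have : (#|P| <= #|{: T * T}|)%N.
  rewrite -cardsT (card_partition PT) -sum1_card; apply: leq_sum => A AP.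
  by rewrite card_gt0; apply: contraTneq AP => ->; case/and3P: PT.
by rewrite P4 card_prod; case: #|T| => [|[|]].
Qed.

Lemma forward_sets : is_Deza e -> is_circulant e -> WL_rank_is e 4 ->
  exists n (S : {set 'Z_n}), [/\ (1 < n)%N, is_cay e S &
    fam1 S \/ fam2 S \/ fam3 S \/ fam4 S \/ fam5 S \/ fam6 S \/ fam7 S \/ fam8 S].
Proof.
move=> dz circ rk4; have [n [S [n1 eS]]] := circulant_cay circ (WL_rank4_card rk4).
exists n, S; split=> //; have [f [[fi fK fiK] fE]] := eS; have [P [PWL P4]] := rk4.
have [x1 [x2 [x3 [x10 x20 x30 c12 [c13 c23 c_all]]]]] := closure_colours fK fiK fE PWL P4.
apply: (forward_families n1 (closure_Sring fK fiK fE PWL)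
  (closure_symmetric e_sym fK fiK fE PWL) x10 x20 x30 c12 c13 c23 c_all).
- exact: (closure_cset fiK fE PWL).
- exact: (cay_S0 e_irr fi fE).
- exact: (closure_coarsest fK fiK fE PWL).
exact/(cay_Deza e_sym fK fiK fE).
Qed.

Lemma backward_sets n (S : {set 'Z_n}) : (1 < n)%N -> is_cay e S ->
  fam1 S \/ fam2 S \/ fam3 S \/ fam4 S \/ fam5 S \/ fam6 S \/ fam7 S \/ fam8 S ->
  is_Deza e /\ is_circulant e /\ WL_rank_is e 4.
Proof.
move=> n1 eS; suff W : [/\ is_Deza e, is_circulant e & WL_rank_is e 4] ->
  is_Deza e /\ is_circulant e /\ WL_rank_is e 4.
  move=> [|[|[|[|[|[|[|]]]]]]] h; apply: W.
  - exact: backward_fam1 h.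
  - exact: backward_fam2 h.
  - exact: backward_fam3 h.
  - exact: backward_fam4 h.
  - exact: backward_fam5 h.
  - exact: backward_fam6 h.
  - exact: backward_fam7 h.
  exact: backward_fam8 h.
by case.
Qed.
End Assembly.

(** The parity under which [GPaley] is defined: 3 does not divide 2 - 1, so [p] is odd, and dividing
    the even number [p.-1] by 3 leaves it even. *)
Lemma odd_prime_pred3 p : prime p -> (3 %| p.-1)%N -> ~~ odd (p.-1 %/ 3).
Proof.
move=> p_pr p3; case: (even_prime p_pr) => [pE|]; first by rewrite pE in p3.
move=> po; have : ~~ odd p.-1 by move: po (prime_gt0 p_pr); case: p {p_pr p3}.
by rewrite -{1}(divnK p3) oddM andbT.
Qed.

Local Close Scope ring_scope.

Theorem theorem1p1 (T : finType) (e : rel T) :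
  simple_graph e ->
  (is_Deza e /\ is_circulant e /\ WL_rank_is e 4) <->
  (     (exists m, [/\ 1 < m, odd m &
          graph_iso e (gcompl (tensor (complete 4) (complete m)))]) \/
      (exists m, [/\ 1 < m, odd m &
          graph_iso e (tensor (complete 2) (complete m))]) \/
      (exists m, 1 < m /\ graph_iso e (mcopies m (cycle_graph 5))) \/
      (exists l m, [/\ 1 < l, 1 < m & graph_iso e (mcopies l (complete_bip m m))]) \/
      (exists l m, [/\ 1 < l, 1 < m &
          graph_iso e (lexprod (complete l) (mcopies m (complete 2)))]) \/
      (exists p, [/\ prime p, p %% 4 = 1 &
          graph_iso e (lexprod (paley p) (complete 2))]) \/
      (exists p t, [/\ prime p, p = t ^ 2 + 3, 3 %| p.-1, ~~ odd (p.-1 %/ 3) &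
          graph_iso e (gpaley p (p.-1 %/ 3))]) \/
      (exists p t, [/\ prime p, p = t ^ 2 + 12, 3 %| p.-1, ~~ odd (p.-1 %/ 3) &
          graph_iso e (gcompl (gpaley p (p.-1 %/ 3)))])).
Proof.
case=> e_sym e_irr; split=> [[dz [circ rk4]]|].
  have [n [S [n1 eS fam]]] := forward_sets e_sym e_irr dz circ rk4.
  case: fam => [[m [nE m1 mo SE]]|fam].
    left; exists m; split=> //; rewrite SE in eS; apply: cay_iso eS _.
    exact: fam1_cay.
  case: fam => [[m [nE m1 mo SE]]|fam].
    right; left; exists m; split=> //; rewrite SE in eS; apply: cay_iso eS _.
    exact: fam2_cay.
  case: fam => [[m [g [r [nE m1 gP SE]]]]|fam].
    do 2 right; left; exists m; split=> //; rewrite SE in eS; apply: cay_iso eS _.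
    exact: fam3_cay.
  case: fam => [[l [m [nE l1 m1 SE]]]|fam].
    do 3 right; left; exists l, m; split=> //; rewrite SE in eS; apply: cay_iso eS _.
    exact: fam4_cay.
  case: fam => [[l [m [nE l1 m1 SE]]]|fam].
    do 4 right; left; exists l, m; split=> //; rewrite SE in eS; apply: cay_iso eS _.
    exact: fam5_cay.
  case: fam => [[p [g [r [nE p_pr p4 gP SE]]]]|fam].
    do 5 right; left; exists p; split=> //; rewrite SE in eS; apply: cay_iso eS _.
    exact: fam6_cay.
  case: fam => [[p [t [g [r [nE p_pr pt p3 [gP SE]]]]]]|fam].
    do 6 right; left; exists p, t; split=> //; first exact: odd_prime_pred3.
    by rewrite SE in eS; apply: cay_iso eS _; apply: fam7_cay.
  case: fam => p [t [g [r [nE p_pr pt p3 [gP SE]]]]].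
  do 7 right; exists p, t; split=> //; first exact: odd_prime_pred3.
  by rewrite SE in eS; apply: cay_iso eS _; apply: fam8_cay.
case=> [[m [m1 mo iso]]|].
  have n1 : 1 < 4 * m by lia.
  apply: (backward_sets e_sym e_irr n1 (iso_cay iso (fam1_cay n1 erefl m1 mo))).
  by left; exists m.
case=> [[m [m1 mo iso]]|].
  have n1 : 1 < 2 * m by lia.
  apply: (backward_sets e_sym e_irr n1 (iso_cay iso (fam2_cay n1 erefl m1 mo))).
  by right; left; exists m.
case=> [[m [m1 iso]]|].
  have n1 : 1 < m * pdiv 5 by rewrite pdiv_id //; lia.
  have [g gP] := finField_primitive 'F_5.
  apply: (backward_sets e_sym e_irr n1 (iso_cay iso (fam3_cay n1 gP 0 erefl m1))).
  by do 2 right; left; exists m, g, 0.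
case=> [[l [m [l1 m1 iso]]]|].
  have n1 : 1 < l * 2 * m by nia.
  apply: (backward_sets e_sym e_irr n1 (iso_cay iso (fam4_cay n1 erefl l1 m1))).
  by do 3 right; left; exists l, m.
case=> [[l [m [l1 m1 iso]]]|].
  have n1 : 1 < l * m * 2 by nia.
  apply: (backward_sets e_sym e_irr n1 (iso_cay iso (fam5_cay n1 erefl l1 m1))).
  by do 4 right; left; exists l, m.
case=> [[p [p_pr p4 iso]]|].
  have p1 := pdiv_gt1 p_pr; have n1 : 1 < pdiv p * 2 by lia.
  have [g gP] := finField_primitive 'F_p.
  apply: (backward_sets e_sym e_irr n1 (iso_cay iso (fam6_cay n1 p_pr gP 0 erefl p4))).
  by do 5 right; left; exists p, g, 0.
case=> [[p [t [p_pr pt p3 _ iso]]]|[p [t [p_pr pt p3 _ iso]]]].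
  have n1 : 1 < 1 * pdiv p by rewrite mul1n; exact: pdiv_gt1.
  have [g gP] := finField_primitive 'F_p.
  apply: (backward_sets e_sym e_irr n1 (iso_cay iso (fam7_cay n1 p_pr gP 0 erefl p3))).
  by do 6 right; left; exists p, t, g, 0.
have n1 : 1 < 1 * pdiv p by rewrite mul1n; exact: pdiv_gt1.
have [g gP] := finField_primitive 'F_p.
apply: (backward_sets e_sym e_irr n1 (iso_cay iso (fam8_cay n1 p_pr gP 0 erefl p3))).
by do 7 right; exists p, t, g, 0.
Qed.
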